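(* Let $X,Y,A,B,F,V,\psi$ be as in the context, with $A$ analytic in a neighborhood of zero, and suppose that $B$ is an entire function. Let $\alpha<0$ and suppose $F$ (restricted to the negative real axis) is of exponential order $-\alpha$ at $-\infty$. Suppose that the zeroes of $F$ with strictly negative real part, listed with multiplicity, have an enumeration $\{z_n: n\in\mathbb Z\}$ such that $z_{-n}=\overline{z}_n$ for all $n$ and, as $n\to+\infty$, $\Re z_n=o(n^{1/2})$ and $\Im z_n=-2\pi n/\alpha+\beta+o(1)$ for a real constant $\beta$. Suppose finally that there exist $\eta>0$, $\epsilon>0$ and an $\eta$-sublinear sequence of radii $\{r_n,\ n\ge n_1\}$ such that $|F(\theta)|>\epsilon$ whenever $\Re\theta<0$ and $|\theta|=r_n$. Then $$\psi(\theta)=\exp\{-\alpha\theta/2\}\,(1-\theta/z_0)^{-1}\prod_{k=1}^{\infty}\Big(1-\frac{2\,\Re(z_k)\,\theta}{z_k\overline{z}_k}+\frac{\theta^2}{z_k\overline{z}_k}\Big)^{-1}.$$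
   Context: $X\ge 0$ (interarrival time) and $Y\ge0$ (service time) are independent random variables with $E[Y]<E[X]$, at least one of which is non-lattice; $U=Y-X$. Their Laplace transforms are $A(\theta)=E[\exp(-\theta X)]$ and $B(\theta)=E[\exp(-\theta Y)]$, both assumed analytic in a strip $\{\theta:-\epsilon_0<\Re\theta<\epsilon_0\}$ with $\epsilon_0>0$. Put $F(\theta)=B(\theta)A(-\theta)-1$; when $B$ is entire, $F$ is analytic on $\{\Re\theta<\epsilon_0\}$. $V\ge 0$ is the steady-state unfinished workload of the single-server queue just prior to an arrival, i.e. $V$ and $(V+U)^+$ are equal in law, with $V$ and $U$ independent in the second expression; $\psi(\theta)=E[\exp(-\theta V)]$ is its Laplace transform, extended by meromorphic continuation. Exponential order: a real function $f$ is of exponential order $a$ at $b\in\{\pm\infty\}$ if for every $\epsilon>0$, $\lim_{x\to b}f(x)\exp(-(a+\epsilon)|x|)=\lim_{x\to b}\exp((a-\epsilon)|x|)/f(x)=0$. A non-decreasing sequence $\{r_n\}$ is $\eta$-sublinear if there is $n_0$ with $r_{n+1}-r_n<\eta$ whenever $n\ge n_0$. *)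

(* Defs.v *)
From HB Require Import structures.
From mathcomp Require Import all_boot all_order all_algebra.
From mathcomp Require Import complex.
From mathcomp Require Import all_classical all_reals all_analysis.

Set Implicit Arguments.
Unset Strict Implicit.
Unset Printing Implicit Defensive.

Import Order.TTheory GRing.Theory Num.Theory.
Import numFieldNormedType.Exports.

Local Open Scope classical_set_scope.
Local Open Scope complex_scope.
Local Open Scope ring_scope.

(* The topology and norm of R[i] as a normed space over itself; the library
   provides them for [K^o] with [K : numFieldType], but does not key them on
   [complex]. *)
HB.instance Definition _ (R : realType) := NormedModule.copy R[i] R[i]^o.

Section ComplexAnalysis.
Context {R : realType}.
Implicit Types (f g : R[i] -> R[i]) (w : R[i]).

Definition cexp (w : R[i]) : R[i] :=
  (expR (complex.Re w) * cos (complex.Im w)) +i*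
  (expR (complex.Re w) * sin (complex.Im w)).

(* The norm of R[i] has values in R[i], hence the radius [rho : R[i]]; over
   R[i], [0 < rho] forces [rho] to be real. *)
Definition analytic_at f w :=
  exists (a : nat -> R[i]) (rho : R[i]), 0 < rho /\
    forall t : R[i], `|t - w| < rho ->
      series (fun n => a n * (t - w) ^+ n) @ \oo --> f t.

Definition analytic_on f (D : set R[i]) := forall w, D w -> analytic_at f w.

(* The case [m = 0] means that [f] is analytic and nonzero at [w]. *)
Definition zero_of_order f w (m : nat) :=
  exists g, [/\ analytic_at g w, g w != 0 &
    \forall t \near w, f t = (t - w) ^+ m * g t].

Definition pole f w :=
  exists (k : nat) g, [/\ (0 < k)%N, analytic_at g w, g w != 0 &
    \forall t \near w^', f t = g t / (t - w) ^+ k].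

(* Functions are total: the value of [f] at a pole is arbitrary, but removable
   singularities are required to be filled in. *)
Definition meromorphic f := forall w, analytic_at f w \/ pole f w.

End ComplexAnalysis.

Section Growth.
Context {R : realType}.

(* [b] is meant to be [+oo_R] or [-oo_R].  The nonvanishing clause is implicit
   in the limit of a quotient by [f x]; it is needed since [0^-1 = 0] here. *)
Definition exponential_order (f : R -> R) (a : R) (b : set_system R) :=
  (\forall x \near b, f x != 0) /\
  forall eps : R, 0 < eps ->
    (f x * expR (- (a + eps) * `|x|) @[x --> b] --> (0 : R)) /\
    (expR ((a - eps) * `|x|) / f x @[x --> b] --> (0 : R)).

(* The sequence considered is [r n] for [n >= n1]. *)
Definition sublinear_from (n1 : nat) (eta : R) (r : nat -> R) :=
  (forall m n, (n1 <= m)%N -> (m <= n)%N -> r m <= r n) /\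
  exists n0, forall n, (n1 <= n)%N -> (n0 <= n)%N -> r n.+1 - r n < eta.

End Growth.

Section Probability.
Context d (T : measurableType d) (R : realType) (P : probability T R).
Implicit Types (X Y : T -> R) (f : T -> R[i]).

Definition independent_rv X Y :=
  forall A B : set R, measurable A -> measurable B ->
    P (X @^-1` A `&` Y @^-1` B) = (P (X @^-1` A) * P (Y @^-1` B))%E.

Definition equal_in_law X Y :=
  forall A : set R, measurable A -> P (X @^-1` A) = P (Y @^-1` A).

Definition lattice_rv X :=
  exists2 h : R, 0 < h & P [set t | exists k : int, X t = k%:~R * h] = 1%E.

Definition cintegrable f :=
  P.-integrable setT (fun t => (complex.Re (f t))%:E) /\
  P.-integrable setT (fun t => (complex.Im (f t))%:E).

Definition cexpectation f : R[i] :=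
  fine 'E_P[fun t => complex.Re (f t)] +i* fine 'E_P[fun t => complex.Im (f t)].

Definition laplace X (theta : R[i]) : R[i] :=
  cexpectation (fun t => cexp (- theta * (X t)%:C)).

(* [laplace X] is an honest (absolutely convergent) expectation on [D], and is
   analytic there. *)
Definition laplace_analytic X (D : set R[i]) :=
  (forall theta, D theta -> cintegrable (fun t => cexp (- theta * (X t)%:C))) /\
  analytic_on (laplace X) D.

Definition laplace_continuation X (psi : R[i] -> R[i]) :=
  meromorphic psi /\
  forall theta, 0 <= complex.Re theta -> psi theta = laplace X theta.

Definition queueF X Y (theta : R[i]) : R[i] :=
  laplace Y theta * laplace X (- theta) - 1.

(* [V] is stationary for the recursion [V <- (V + Y - X)^+]. *)
Definition stationary_workload X Y V :=
  [/\ forall t, 0 <= V t,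
      independent_rv V (Y \- X) &
      equal_in_law V (fun t => Num.max (V t + (Y t - X t)) 0)].

End Probability.

(* Main.v *)
Require Import Defs.
From HB Require Import structures.
From mathcomp Require Import all_boot all_order all_algebra.
From mathcomp Require Import cyclic separable cyclotomic.
From mathcomp Require Import complex finmap.
From mathcomp Require Import all_classical all_reals all_analysis.
From mathcomp Require Import measurable_realfun.
From mathcomp Require Import zify ring lra.

(** The formula expresses that the reciprocal of the Laplace transform [psi]
    of [V] extends to an entire function [L] of exponential type, whose zeros
    are the [z n], and that the Hadamard product of [L] has the exponential
    factor [exp (alpha * theta / 2)].

    Entire reciprocal. Put [U = Y - X] and let [k] be the (defective) law of
    the first positive value of the random walk with increments [U]. Because
    [F] has exponential order [- alpha] at minus infinity, [U] is almost
    surely bounded above, so [k] lives on a bounded interval [(0, b]]. The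
    stationarity of [V] says that [E f(V) = k (s |-> E f(s + V)) + (1 - k 1)
    f(0)] for bounded [f] ([wiener_hopf]). With [L = (1 - k^) / (1 - k 1)],
    where [k^] is the transform of [k], exponentials turn this into [psi * L =
    1] on the closed right half-plane. Splitting [V + U] into its positive and
    negative parts gives a second identity ([wiener_hopf_factor]), which
    becomes [F = L * H] on the open left half-plane, where [H + 1] is the
    transform of [min (V + U) 0]. There [H] has no zero, and its modulus stays
    between positive constants on the negative axis. So [L] is entire of
    exponential type with the zeros of [F], is bounded on the positive axis
    and inherits the growth of [F] on the negative one ([wiener_hopf_exists]).
    As [T] need not carry independent copies of [U], the walk itself is never
    built: [k] is a sum of iterated one-step expectations, convergent by an
    exponential (Chernoff) estimate that uses [E U < 0].

    Product formula. Divide [L] by the linear factors of its zeros [z n], [|n|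
    <= N]. What remains is entire, keeps the exponential bound far away and
    has no zero in a disc of radius proportional to [N]. Such a function is
    close to [exp (c1 * u)], [c1] being its linear coefficient
    ([zero_free_near_exp]): its Taylor polynomials split into linear factors,
    the density of their zeros is controlled by Cauchy estimates, here
    averages over roots of unity, and the sum of the inverse squares of these
    zeros is [O (1 / N)]. The coefficients [c1] converge to a real [g], by the
    conjugate symmetry and the growth condition on [Re z_n]; hence the finite
    products converge to [L u * exp (- g u)] ([hadamard_product]). To find
    [g], compare the two real half-axes: the product has the same rate of
    growth at [x] and at [- x], while [L] is bounded at [x] and of order [exp
    (- alpha x)] at [- x]. This forces [2 g = alpha] ([canonical_product]).

    Continuation. Zeros of [L] being isolated, [1 / L] is meromorphic; a
    meromorphic [psi] with [psi * L = 1] in the right half-plane satisfies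
    this everywhere, by propagation along horizontal lines
    ([inverse_continuation]). *)

Set Implicit Arguments.
Unset Strict Implicit.
Unset Printing Implicit Defensive.

Import Order.TTheory GRing.Theory Num.Theory.
Import numFieldNormedType.Exports.

Local Open Scope classical_set_scope.
Local Open Scope complex_scope.
Local Open Scope ring_scope.

Local Notation Re := complex.Re.
Local Notation Im := complex.Im.

(** * Modulus and exponential of complex numbers *)

Section Modulus.
Context {R : realType}.
Implicit Types (u v w : R[i]) (x y : R).

(** The norm of [R[i]] takes its values in [R[i]]; the analysis below needs a
    real modulus. *)
Definition cmod (w : R[i]) : R := Re `|w|.

Lemma normE w : `|w| = (cmod w)%:C.
Proof. by []. Qed.

Lemma cmodE w : cmod w = Num.sqrt (Re w ^+ 2 + Im w ^+ 2).
Proof. by rewrite /cmod normc_def. Qed.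

Lemma cmod_sqr w : cmod w ^+ 2 = Re w ^+ 2 + Im w ^+ 2.
Proof. by rewrite cmodE sqr_sqrtr// addr_ge0// sqr_ge0. Qed.

Lemma cmod_ge0 w : 0 <= cmod w.
Proof. by rewrite cmodE sqrtr_ge0. Qed.

Lemma cmod0 : cmod 0 = 0.
Proof. by rewrite /cmod normr0. Qed.

Lemma cmod1 : cmod 1 = 1.
Proof. by rewrite /cmod normr1. Qed.

Lemma cmod_eq0 w : (cmod w == 0) = (w == 0).
Proof. by rewrite -(normr_eq0 w) normE; apply/eqP/eqP => [->//|[]]. Qed.

Lemma cmod_gt0 w : (0 < cmod w) = (w != 0).
Proof. by rewrite lt_def cmod_ge0 andbT cmod_eq0. Qed.

Lemma cmodM u v : cmod (u * v) = cmod u * cmod v.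
Proof. by apply: complexI; rewrite -normE normrM !normE -rmorphM. Qed.

Lemma cmodN u : cmod (- u) = cmod u.
Proof. by rewrite /cmod normrN. Qed.

Lemma cmodC u v : cmod (u - v) = cmod (v - u).
Proof. by rewrite /cmod distrC. Qed.

Lemma cmodV u : cmod u^-1 = (cmod u)^-1.
Proof. by apply: complexI; rewrite -normE normfV normE -fmorphV. Qed.

Lemma cmodX u n : cmod (u ^+ n) = cmod u ^+ n.
Proof. by apply: complexI; rewrite -normE normrX normE -rmorphXn. Qed.

Lemma cmodD u v : cmod (u + v) <= cmod u + cmod v.
Proof. by rewrite -lecR rmorphD/= -!normE ler_normD. Qed.

Lemma cmodB u v : cmod (u - v) <= cmod u + cmod v.
Proof. by rewrite -(cmodN v) cmodD. Qed.

Lemma cmod_dist u v : cmod u - cmod v <= cmod (u - v).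
Proof. by rewrite lerBlDr -[X in cmod X <= _](subrK v) cmodD. Qed.

Lemma cmod_real x : cmod x%:C = `|x|.
Proof. by rewrite cmodE/= expr0n/= addr0 sqrtr_sqr. Qed.

Lemma cmod_nat n : cmod n%:R = n%:R.
Proof. by rewrite -(rmorph_nat (real_complex R)) cmod_real ger0_norm. Qed.

Lemma cmod_conj w : cmod w^* = cmod w.
Proof. by rewrite /cmod normcJ. Qed.

Lemma cmod_sum (I : Type) (s : seq I) (P : pred I) (f : I -> R[i]) :
  cmod (\sum_(i <- s | P i) f i) <= \sum_(i <- s | P i) cmod (f i).
Proof.
elim/big_ind2: _ => // [|a b c d h h']; first by rewrite cmod0.
by apply: le_trans (cmodD _ _) _; exact: lerD.
Qed.

Lemma cmod_prod (I : Type) (s : seq I) (P : pred I) (f : I -> R[i]) :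
  cmod (\prod_(i <- s | P i) f i) = \prod_(i <- s | P i) cmod (f i).
Proof. by apply: big_morph; [exact: cmodM | exact: cmod1]. Qed.

Lemma Re_le_cmod w : `|Re w| <= cmod w.
Proof. by rewrite cmodE -sqrtr_sqr ler_sqrt ?lerDl ?addr_ge0 ?sqr_ge0. Qed.

Lemma Im_le_cmod w : `|Im w| <= cmod w.
Proof. by rewrite cmodE -sqrtr_sqr ler_sqrt ?lerDr ?addr_ge0 ?sqr_ge0. Qed.

Lemma cmod_le_ReIm w : cmod w <= `|Re w| + `|Im w|.
Proof.
rewrite -(@ler_pXn2r _ 2)// ?nnegrE ?cmod_ge0 ?addr_ge0//.
rewrite cmod_sqr sqrrD !real_normK ?num_real// -addrA lerD2l lerDr.
by rewrite mulrn_wge0// mulr_ge0.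
Qed.

Lemma Re_conj w : Re w^* = Re w. Proof. by case: w. Qed.
Lemma Im_conj w : Im w^* = - Im w. Proof. by case: w. Qed.
Lemma ReD u v : Re (u + v) = Re u + Re v. Proof. by case: u; case: v. Qed.
Lemma ImD u v : Im (u + v) = Im u + Im v. Proof. by case: u; case: v. Qed.
Lemma ReN u : Re (- u) = - Re u. Proof. by case: u. Qed.
Lemma ImN u : Im (- u) = - Im u. Proof. by case: u. Qed.
Lemma ReM u v : Re (u * v) = Re u * Re v - Im u * Im v.
Proof. by case: u; case: v. Qed.
Lemma ImM u v : Im (u * v) = Re u * Im v + Im u * Re v.
Proof. by case: u; case: v. Qed.

Lemma complexP u v : Re u = Re v -> Im u = Im v -> u = v.
Proof. by case: u => a b; case: v => c d /= -> ->. Qed.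

Lemma mulC_conj w : w * w^* = (cmod w ^+ 2)%:C.
Proof.
rewrite cmod_sqr; apply: complexP; rewrite ?(ReM, ImM, Re_conj, Im_conj)/=; ring.
Qed.

Lemma Re_sum (I : Type) (s : seq I) (P : pred I) (f : I -> R[i]) :
  Re (\sum_(i <- s | P i) f i) = \sum_(i <- s | P i) Re (f i).
Proof. exact: (big_morph _ ReD). Qed.

Lemma Im_sum (I : Type) (s : seq I) (P : pred I) (f : I -> R[i]) :
  Im (\sum_(i <- s | P i) f i) = \sum_(i <- s | P i) Im (f i).
Proof. exact: (big_morph _ ImD). Qed.

End Modulus.

(** The right-hand side is monotone in the moduli of the terms, so a bound for
    nonnegative terms, where the left-hand side is explicit, transfers to
    complex ones. *)
Lemma cauchy_product_tail (F : comPzRingType) (A B : nat -> F) M :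
  (\sum_(0 <= i < M) A i) * (\sum_(0 <= j < M) B j) -
  \sum_(0 <= n < M) \sum_(0 <= i < n.+1) A i * B (n - i)%N =
  \sum_(0 <= i < M) A i * \sum_(M - i <= j < M) B j.
Proof.
have -> : \sum_(0 <= n < M) \sum_(0 <= i < n.+1) A i * B (n - i)%N =
  \sum_(0 <= i < M) A i * \sum_(0 <= j < M - i) B j.
  transitivity (\sum_(0 <= n < M) \sum_(0 <= i < M | (i <= n)%N) A i * B (n - i)%N).
    apply: eq_big_nat => n /andP[_ nM].
    by rewrite -(big_nat_widen 0 n.+1 M predT).
  rewrite (exchange_big_dep_nat xpredT)//=; apply: eq_big_nat => i /andP[_ iM].
  rewrite -(@big_nat_widenl _ _ _ i 0 M xpredT)//= mulr_sumr.
  rewrite -{1}(add0n i) big_addn; apply: eq_big_nat => j _.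
  by rewrite addnK.
rewrite mulr_suml -sumrB; apply: eq_big_nat => i /andP[_ iM].
rewrite -mulrBr; congr (_ * _).
by rewrite (@big_cat_nat _ _ _ (M - i))//= ?leq_subr// addrAC subrr add0r.
Qed.

Section ComplexExponential.
Context {R : realType}.
Implicit Types (u v w : R[i]) (x y : R).

Lemma cexpD u v : cexp (u + v) = cexp u * cexp v.
Proof.
apply: complexP; rewrite ?(ReM, ImM) /= !(ReD, ImD) expRD ?cosD ?sinD; ring.
Qed.

Lemma cexp0 : cexp (0 : R[i]) = 1.
Proof. by rewrite /cexp/= expR0 cos0 sin0 mulr0 mulr1. Qed.

Lemma cmod_cexp w : cmod (cexp w) = expR (Re w).
Proof.
rewrite cmodE/= !exprMn -mulrDr cos2Dsin2 mulr1 sqrtr_sqr ger0_norm//.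
Qed.

Lemma cexp_neq0 w : cexp w != 0.
Proof. by rewrite -cmod_gt0 cmod_cexp expR_gt0. Qed.

Lemma cexp_real x : cexp x%:C = (expR x)%:C.
Proof. by rewrite /cexp/= cos0 sin0 mulr0 mulr1. Qed.

(** Over any field, since both [R] and [R[i]] are needed. *)
Definition exp_sum (F : fieldType) (M : nat) (w : F) :=
  \sum_(0 <= n < M) w ^+ n / n`!%:R.

Lemma exp_sumD (F : numFieldType) M (u v : F) :
  exp_sum M u * exp_sum M v - exp_sum M (u + v) =
  \sum_(0 <= i < M) u ^+ i / i`!%:R * \sum_(M - i <= j < M) v ^+ j / j`!%:R.
Proof.
rewrite -cauchy_product_tail; congr (_ - _); apply: eq_bigr => n _.
rewrite addrC exprDn mulr_suml big_mkord; apply: eq_bigr => i _.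
have iln : (i <= n)%N by rewrite -ltnS.
rewrite -(bin_fact iln) !natrM -mulr_natr.
have := @bin_gt0 n i; rewrite iln => h.
by field; rewrite !pnatr_eq0 -!lt0n h !fact_gt0.
Qed.

(** Reduces the functional equation of the complex Taylor sums to that of
    [expR]. *)
Lemma cmod_exp_sumD M (u v : R[i]) :
  cmod (exp_sum M u * exp_sum M v - exp_sum M (u + v)) <=
  exp_sum M (cmod u) * exp_sum M (cmod v) - exp_sum M (cmod u + cmod v).
Proof.
rewrite !exp_sumD.
apply: le_trans (cmod_sum _ _ _) _; apply: ler_sum => i _.
rewrite cmodM cmodM cmodX cmodV cmod_nat ler_wpM2l//.
  by rewrite mulr_ge0 ?exprn_ge0 ?cmod_ge0 ?invr_ge0.
apply: le_trans (cmod_sum _ _ _) _; apply: ler_sum => j _.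
by rewrite cmodM cmodX cmodV cmod_nat.
Qed.

Lemma exp_sum_series x M : exp_sum M x = series (exp_coeff x) M.
Proof. by []. Qed.

Lemma exp_sum_cvg x : exp_sum M x @[M --> \oo] --> expR x.
Proof. exact: is_cvg_series_exp_coeff. Qed.

Lemma exp_sum_le x M : 0 <= x -> exp_sum M x <= expR x.
Proof.
move=> x0; rewrite exp_sum_series.
apply: nondecreasing_cvgn_le; last exact: is_cvg_series_exp_coeff.
apply: nondecreasing_series => n _ _.
exact: exp_coeff_ge0.
Qed.

Lemma exp_sum_real x M : exp_sum M x%:C = (exp_sum M x)%:C.
Proof.
rewrite /exp_sum rmorph_sum; apply: eq_bigr => i _.
by rewrite rmorphM/= rmorphXn fmorphV rmorph_nat.
Qed.

(** The exponential series on the imaginary axis is built from the cosine and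
    sine series. *)
Lemma expi_coeff y n : (0 +i* y) ^+ n / n`!%:R = cos_coeff y n +i* sin_coeff y n.
Proof.
rewrite /cos_coeff /sin_coeff.
have hy : (0 +i* y) = 'i%C * y%:C :> R[i].
  by apply: complexP; rewrite ?(ReM, ImM)/=; ring.
have hn m : (m%:R : R[i])^-1 = ((m%:R : R)^-1)%:C.
  by rewrite fmorphV rmorph_nat.
have he m : ('i%C : R[i]) ^+ m.*2 = ((-1) ^+ m)%:C.
  by rewrite -muln2 mulnC exprM sqr_i rmorphXn/= rmorphN1.
rewrite hy exprMn hn -rmorphXn -mulrA -rmorphM/=.
rewrite -[in 'i%C ^+ n](odd_double_half n) exprD he.
have [on|en] := boolP (odd n); rewrite /= ?expr1 ?expr0 ?mul1r.
- have -> : n.-1./2 = n./2 by case: (n) on => //= m; rewrite uphalf_half => /negbTE ->.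
  by apply: complexP; rewrite ?(ReM, ImM)/=; ring.
- by apply: complexP; rewrite ?(ReM, ImM)/= ?mul0r ?mulr0 ?subr0 ?addr0 ?mulrA.
Qed.

Lemma fact_mul_le m n : (m`! * n`! <= (m + n)`!)%N.
Proof.
rewrite -[X in (_ <= X)%N](bin_fact (leq_addr n m)) addKn leq_pmull//.
by rewrite bin_gt0 leq_addr.
Qed.

Lemma exp_sum_tail M J w : (M <= J)%N ->
  cmod (exp_sum J w - exp_sum M w) <= cmod w ^+ M / M`!%:R * expR (cmod w).
Proof.
move=> MJ; rewrite /exp_sum (@big_cat_nat _ _ _ M)//= addrAC subrr add0r.
rewrite -{1}[M]add0n big_addn.
apply: le_trans (cmod_sum _ _ _) _.
have h : \sum_(0 <= i < J - M) cmod (w ^+ (i + M) / (i + M)`!%:R) <=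
  \sum_(0 <= i < J - M) cmod w ^+ M / M`!%:R * (cmod w ^+ i / i`!%:R).
  apply: ler_sum => i _; rewrite cmodM cmodV cmodX cmod_nat addnC exprD.
  rewrite [leRHS]mulrACA -invfM ler_wpM2l ?mulr_ge0 ?exprn_ge0 ?cmod_ge0//.
  by rewrite lef_pV2 ?posrE ?mulr_gt0 ?ltr0n ?fact_gt0// -natrM ler_nat fact_mul_le.
apply: le_trans h _; rewrite -mulr_sumr ler_wpM2l//.
  by rewrite mulr_ge0 ?exprn_ge0 ?cmod_ge0 ?invr_ge0.
by rewrite exp_sum_le ?cmod_ge0.
Qed.

(** The real and imaginary parts of the argument are treated by the series of
    [expR], [cos] and [sin], and are put together by [cmod_exp_sumD]. *)
Lemma cexp_sum_cvg w : cmod (cexp w - exp_sum M w) @[M --> \oo] --> (0 : R).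
Proof.
case: w => x y.
have hw : x +i* y = x%:C + (0 +i* y) :> R[i].
  by apply: complexP; rewrite ?(ReD, ImD)/= ?addr0 ?add0r.
pose u : R[i] := x%:C; pose v : R[i] := 0 +i* y.
have ev M : exp_sum M v = series (cos_coeff y) M +i* series (sin_coeff y) M.
  rewrite /exp_sum (eq_bigr _ (fun n _ => expi_coeff y n)).
  apply: complexP; rewrite ?(Re_sum, Im_sum)/= /series/=; exact: eq_bigr.
pose b M := `|expR x * cos y - exp_sum M x * series (cos_coeff y) M| +
            `|expR x * sin y - exp_sum M x * series (sin_coeff y) M| +
   (exp_sum M (cmod u) * exp_sum M (cmod v) - exp_sum M (cmod u + cmod v)).
have b0 : b M @[M --> \oo] --> (0 : R).
  rewrite [X in _ --> X](_ : 0 =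
    `|expR x * cos y - expR x * cos y| + `|expR x * sin y - expR x * sin y| +
    (expR (cmod u) * expR (cmod v) - expR (cmod u + cmod v))); last first.
    by rewrite -expRD !subrr normr0 !addr0.
  have c1 : series (cos_coeff y) M @[M --> \oo] --> cos y.
    rewrite unlock; exact: is_cvg_series_cos_coeff.
  have c2 : series (sin_coeff y) M @[M --> \oo] --> sin y.
    rewrite unlock; exact: is_cvg_series_sin_coeff.
  apply: cvgD; first (apply: cvgD; apply: cvg_norm; apply: cvgB).
  - exact: cvg_cst.
  - by apply: cvgM => //; exact: exp_sum_cvg.
  - exact: cvg_cst.
  - by apply: cvgM => //; exact: exp_sum_cvg.
  apply: cvgB; last exact: exp_sum_cvg.
  by apply: cvgM; exact: exp_sum_cvg.
apply: (squeeze_cvgr _ (cvg_cst 0) b0).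
near=> M; rewrite cmod_ge0/=.
have -> : cexp (x +i* y) - exp_sum M (x +i* y) =
  (cexp (x +i* y) - exp_sum M u * exp_sum M v) +
  (exp_sum M u * exp_sum M v - exp_sum M (u + v)).
  by rewrite hw addrA subrK.
apply: le_trans (cmodD _ _) _; rewrite lerD ?cmod_exp_sumD//.
apply: le_trans (cmod_le_ReIm _) _.
rewrite exp_sum_real ev ReD ImD ReN ImN ReM ImM /= !mul0r subr0 addr0.
by [].
Unshelve. all: by end_near.
Qed.

(** The tail of the exponential series is its [M]-th term times a series
    dominated by that of [expR], because [M! n! <= (M + n)!]. *)
Lemma cexp_taylor M w :
  cmod (cexp w - exp_sum M w) <= cmod w ^+ M / M`!%:R * expR (cmod w).
Proof.
have h : cmod (cexp w - exp_sum J w) +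
    cmod w ^+ M / M`!%:R * expR (cmod w) @[J --> \oo] -->
    0 + cmod w ^+ M / M`!%:R * expR (cmod w).
  by apply: cvgD; [exact: cexp_sum_cvg | exact: cvg_cst].
rewrite -[leRHS]add0r -(cvg_lim _ h)//; apply: limr_ge; first by apply/cvg_ex; eexists; exact: h.
near=> J.
rewrite -(subrKA (exp_sum J w)).
apply: le_trans (cmodD _ _) _; rewrite lerD2l exp_sum_tail//.
by near: J; exact: nbhs_infty_ge.
Unshelve. all: by end_near.
Qed.

End ComplexExponential.

(** * Power series *)

Lemma subrACA (V : zmodType) (a b c d : V) :
  (a - b) - (c - d) = (a - c) - (b - d).
Proof. by rewrite !opprB addrACA [RHS]addrACA [- b - c]addrC. Qed.

Section PowerSeries.
Context {R : realType}.
Implicit Types (c : nat -> R[i]) (u v w t : R[i]) (r K : R).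

Definition psum c (M : nat) t : R[i] := \sum_(0 <= n < M) c n * t ^+ n.

(** Real and imaginary parts are summed separately, so that only limits of
    real sequences are involved. *)
Definition pser c t : R[i] :=
  limn (fun M => Re (psum c M t)) +i* limn (fun M => Im (psum c M t)).

Lemma psumS c M t : psum c M.+1 t = psum c M t + c M * t ^+ M.
Proof. by rewrite /psum big_nat_recr. Qed.

Lemma cmod_coef_le c r K n t : 0 < r -> (forall n, cmod (c n) * r ^+ n <= K) ->
  cmod (c n * t ^+ n) <= K * (cmod t / r) ^+ n.
Proof.
move=> r0 cK; rewrite cmodM cmodX expr_div_n.
by rewrite [leLHS]mulrC mulrCA ler_wpM2l ?exprn_ge0 ?cmod_ge0// ler_pdivlMr ?exprn_gt0.
Qed.

(** Comparison with a geometric series of ratio at most [1/2]. *)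
Lemma psum_tail c r K M J t : 0 < r -> (forall n, cmod (c n) * r ^+ n <= K) ->
  cmod t <= r / 2 -> (M <= J)%N ->
  cmod (psum c J t - psum c M t) <= 2 * K * (cmod t / r) ^+ M.
Proof.
move=> r0 cK tr MJ.
have K0 : 0 <= K by apply: le_trans (cK 0); rewrite mulr_ge0 ?cmod_ge0.
set q := cmod t / r.
have q0 : 0 <= q by rewrite divr_ge0 ?cmod_ge0 ?ltW.
have q2 : q <= 2^-1 by rewrite ler_pdivrMr// mulrC.
rewrite /psum (@big_cat_nat _ _ _ M)//= addrAC subrr add0r.
apply: le_trans (cmod_sum _ _ _) _.
have -> : J = (M + (J - M))%N by rewrite subnKC.
move: (J - M)%N => k; elim: k M {MJ} => [|k IH] m.
  by rewrite addn0 big_geq// !mulr_ge0 ?exprn_ge0.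
rewrite big_ltn; last by rewrite -addSnnS leq_addr.
rewrite -addSnnS.
apply: (le_trans (lerD (cmod_coef_le m t r0 cK) (IH m.+1))).
rewrite -/q exprS.
have : 0 <= K * q ^+ m by rewrite mulr_ge0 ?exprn_ge0.
nra.
Qed.

Lemma geo_half_le M : \sum_(0 <= n < M) 2^-1 ^+ n <= 2 :> R.
Proof.
suff -> : \sum_(0 <= n < M) 2^-1 ^+ n = 2 - 2 * 2^-1 ^+ M :> R.
  by rewrite gerBl mulr_ge0// exprn_ge0.
elim: M => [|M IH]; first by rewrite big_geq//; ring.
by rewrite big_nat_recr//= IH exprS; field.
Qed.

Lemma geo_half_cvg K : K / 2 ^+ M @[M --> \oo] --> (0 : R).
Proof.
rewrite -(mulr0 K); apply: cvgM; first exact: cvg_cst.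
under eq_fun do rewrite -exprVn.
by apply: cvg_expr; rewrite gtr0_norm ?invf_lt1 ?ltr1n.
Qed.

Lemma pser_cvg c r K t : 0 < r -> (forall n, cmod (c n) * r ^+ n <= K) ->
  cmod t <= r / 2 -> cmod (pser c t - psum c M t) @[M --> \oo] --> (0 : R).
Proof.
move=> r0 cK tr.
have K0 : 0 <= K by apply: le_trans (cK 0); rewrite mulr_ge0 ?cmod_ge0.
have q0 : 0 <= cmod t / r by rewrite divr_ge0 ?cmod_ge0 ?ltW.
have q2 : cmod t / r <= 2^-1 by rewrite ler_pdivrMr// mulrC.
have tail M J : (M <= J)%N ->
    cmod (psum c J t - psum c M t) <= 2 * K / 2 ^+ M.
  move=> MJ; apply: le_trans (psum_tail r0 cK tr MJ) _.
  by rewrite ler_wpM2l ?mulr_ge0// -exprVn lerXn2r ?nnegrE.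
have key (p : R[i] -> R) : (forall u v, p (u - v) = p u - p v) ->
    (forall u, `|p u| <= cmod u) -> cvgn (fun M => p (psum c M t)).
  move=> pB ple; apply: R_complete; apply/cauchyP => e e0.
  have [M0 _ hM0] : \forall M \near \oo, 2 * K / 2 ^+ M < e.
    by apply: (cvgr_lt 0) => //; exact: geo_half_cvg.
  exists (p (psum c M0 t)); exists M0 => // M M0M.
  suff: `|p (psum c M0 t) - p (psum c M t)| < e by [].
  rewrite distrC -pB.
  apply: le_lt_trans (ple _) _; apply: le_lt_trans (hM0 M0 (leqnn _)).
  exact: tail.
have cR := key (@Re R) (fun u v => etrans (ReD _ _) (congr1 _ (ReN _))) (@Re_le_cmod R).
have cI := key (@Im R) (fun u v => etrans (ImD _ _) (congr1 _ (ImN _))) (@Im_le_cmod R).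
pose b M := `|limn (fun M => Re (psum c M t)) - Re (psum c M t)| +
            `|limn (fun M => Im (psum c M t)) - Im (psum c M t)|.
have b0 : b M @[M --> \oo] --> (0 : R).
  rewrite [X in _ --> X](_ : 0 = `|limn (fun M => Re (psum c M t)) - limn (fun M => Re (psum c M t))| + `|limn (fun M => Im (psum c M t)) - limn (fun M => Im (psum c M t))|); last first.
    by rewrite !subrr normr0 addr0.
  by apply: cvgD; apply: cvg_norm; apply: cvgB => //; exact: cvg_cst.
apply: (squeeze_cvgr _ (cvg_cst 0) b0).
near=> M; rewrite cmod_ge0/=.
by apply: le_trans (cmod_le_ReIm _) _; rewrite ReD ImD ReN ImN.
Unshelve. all: by end_near.
Qed.

Lemma cmod_limit_le (f : nat -> R[i]) u B :
  cmod (u - f M) @[M --> \oo] --> (0 : R) ->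
  (\forall M \near \oo, cmod (f M) <= B) -> cmod u <= B.
Proof.
move=> fu fB; rewrite -[leRHS]add0r.
have h : cmod (u - f M) + B @[M --> \oo] --> 0 + B.
  by apply: cvgD => //; exact: cvg_cst.
rewrite -(cvg_lim _ h)//; apply: limr_ge; first by apply/cvg_ex; eexists; exact: h.
near=> M; rewrite -[X in cmod X <= _](subrK (f M)).
apply: le_trans (cmodD _ _) _; rewrite lerD2l; near: M; exact: fB.
Unshelve. all: by end_near.
Qed.

Lemma cmod_limit_unique (f : nat -> R[i]) u v :
  cmod (u - f M) @[M --> \oo] --> (0 : R) ->
  cmod (v - f M) @[M --> \oo] --> (0 : R) -> u = v.
Proof.
move=> fu fv; apply/eqP; rewrite -subr_eq0 -cmod_eq0 eq_le cmod_ge0 andbT.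
apply/ler_addgt0Pr => e e0; rewrite add0r.
apply: (cmod_limit_le (f := fun M => f M - v)).
  by under eq_fun do rewrite opprB addrA subrK.
near=> M; rewrite cmodC; apply/ltW; near: M; apply: (cvgr_lt 0) => //.
Unshelve. all: by end_near.
Qed.

Lemma pser_unique c r K t u : 0 < r -> (forall n, cmod (c n) * r ^+ n <= K) ->
  cmod t <= r / 2 -> cmod (u - psum c M t) @[M --> \oo] --> (0 : R) ->
  u = pser c t.
Proof.
by move=> r0 cK tr h; apply: cmod_limit_unique h (pser_cvg r0 cK tr).
Qed.

Lemma pser_tail c r K M t : 0 < r -> (forall n, cmod (c n) * r ^+ n <= K) ->
  cmod t <= r / 2 ->
  cmod (pser c t - psum c M t) <= 2 * K * (cmod t / r) ^+ M.
Proof.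
move=> r0 cK tr.
apply: (cmod_limit_le (f := fun J => psum c J t - psum c M t)).
  under eq_fun do rewrite opprB addrA subrK.
  exact: pser_cvg cK tr.
by near=> J; apply: psum_tail cK tr _ => //; near: J; exact: nbhs_infty_ge.
Unshelve. all: by end_near.
Qed.

Lemma pser_tail2 c r K M t : 0 < r -> (forall n, cmod (c n) * r ^+ n <= K) ->
  cmod t <= r / 2 -> cmod (pser c t - psum c M t) <= 2 * K / 2 ^+ M.
Proof.
move=> r0 cK tr; apply: le_trans (pser_tail M r0 cK tr) _.
have K0 : 0 <= K by apply: le_trans (cK 0); rewrite mulr_ge0 ?cmod_ge0.
rewrite ler_wpM2l ?mulr_ge0// -exprVn lerXn2r ?nnegrE//.
  by rewrite divr_ge0 ?cmod_ge0 ?ltW.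
by rewrite ler_pdivrMr// mulrC.
Qed.

Lemma pser0 c r K : 0 < r -> (forall n, cmod (c n) * r ^+ n <= K) ->
  pser c 0 = c 0.
Proof.
move=> r0 cK; have h : cmod (0 : R[i]) <= r / 2 by rewrite cmod0 divr_ge0// ltW.
have := pser_tail 1 r0 cK h.
rewrite cmod0 mul0r mulr0 /psum big_nat1 expr0 mulr1 => h1.
by apply/eqP; rewrite -subr_eq0 -cmod_eq0 eq_le h1 cmod_ge0.
Qed.

(** The factor [n] of the termwise derivative is absorbed by halving the
    radius once more. *)
Lemma pser_lipschitz c r K u v : 0 < r -> (forall n, cmod (c n) * r ^+ n <= K) ->
  cmod u <= r / 4 -> cmod v <= r / 4 ->
  cmod (pser c u - pser c v) <= 8 * K / r * cmod (u - v).
Proof.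
move=> r0 cK ur vr.
have K0 : 0 <= K by apply: le_trans (cK 0); rewrite mulr_ge0 ?cmod_ge0.
have ur2 : cmod u <= r / 2 by lra.
have vr2 : cmod v <= r / 2 by lra.
apply: (cmod_limit_le (f := fun M => psum c M u - psum c M v)).
  apply: (squeeze_cvgr _ (cvg_cst 0) (_ : cmod (pser c u - psum c M u) + cmod (pser c v - psum c M v) @[M --> \oo] --> (0 : R))); last first.
    by rewrite -[X in _ --> X]addr0; apply: cvgD; [exact: pser_cvg cK ur2 | exact: pser_cvg cK vr2].
  near=> M; rewrite cmod_ge0/=.
  have -> : pser c u - pser c v - (psum c M u - psum c M v) =
    (pser c u - psum c M u) - (pser c v - psum c M v) by exact: subrACA.
  exact: cmodB.
near=> M.
have pw n : cmod (u ^+ n - v ^+ n) <= cmod (u - v) * (n%:R * (r / 4) ^+ n.-1).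
  rewrite subrXX cmodM ler_wpM2l ?cmod_ge0//.
  apply: le_trans (cmod_sum _ _ _) _.
  apply: (@le_trans _ _ (\sum_(i < n) (r / 4) ^+ n.-1)); last first.
    by rewrite sumr_const card_ord mulr_natl.
  apply: ler_sum => i _; rewrite cmodM !cmodX.
  have hi : (i <= n.-1)%N by rewrite -ltnS (ltn_predK (ltn_ord i)).
  rewrite -[X in _ <= _ ^+ X](subnK hi) exprD.
  have r4 : 0 <= r / 4 by rewrite divr_ge0// ltW.
  by apply: ler_pM; rewrite ?exprn_ge0 ?cmod_ge0// lerXn2r ?nnegrE ?cmod_ge0.
rewrite /psum -sumrB.
apply: le_trans (cmod_sum _ _ _) _.
apply: (@le_trans _ _ (\sum_(0 <= n < M) 4 * K / r * cmod (u - v) * 2^-1 ^+ n)).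
  apply: ler_sum => n _; rewrite -mulrBr cmodM.
  apply: le_trans (ler_wpM2l (cmod_ge0 _) (pw n)) _.
  rewrite mulrCA [leRHS]mulrAC [leRHS]mulrC ler_wpM2l ?cmod_ge0//.
  case: n => [|n]; first by rewrite mul0r mulr0 mulr_ge0// divr_ge0 ?mulr_ge0// ltW.
  rewrite /= [leLHS](_ : _ = cmod (c n.+1) * r ^+ n.+1 * (r^-1 * (n.+1%:R / 4 ^+ n))); last first.
    by rewrite exprS expr_div_n; field; rewrite ?(lt0r_neq0 r0) ?expf_neq0.
  rewrite [leRHS](_ : _ = K * (r^-1 * (4 * 2^-1 ^+ n.+1))); last by ring.
  apply: ler_pM; rewrite ?mulr_ge0 ?cmod_ge0 ?exprn_ge0 ?invr_ge0 ?(ltW r0)//.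
  rewrite ler_wpM2l ?invr_ge0 ?(ltW r0)// ler_pdivrMr ?exprn_gt0//.
  rewrite (_ : 4 ^+ n = 2 ^+ n * 2 ^+ n :> R); last by rewrite -exprMn -natrM.
  rewrite [leRHS](_ : _ = 2 * 2 ^+ n); last first.
    by rewrite exprS exprVn; field; rewrite expf_neq0.
  by rewrite -exprS -natrX ler_nat ltnW// ltn_expl.
rewrite -mulr_sumr [leRHS](_ : _ = 4 * K / r * cmod (u - v) * 2); last by ring.
rewrite ler_wpM2l ?geo_half_le// mulr_ge0 ?cmod_ge0// divr_ge0 ?mulr_ge0// ltW.
Unshelve. all: by end_near.
Qed.
End PowerSeries.

Section EntireSeries.
Context {R : realType}.
Implicit Types (c d : nat -> R[i]) (u v w t : R[i]) (r K : R).

(** Entire functions are represented by their Taylor coefficients at [0]. *)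
Definition entire c := forall r, 0 < r ->
  exists K, forall n, cmod (c n) * r ^+ n <= K.

Lemma entire_pser_cvg c t : entire c ->
  cmod (pser c t - psum c M t) @[M --> \oo] --> (0 : R).
Proof.
move=> ec; have r0 : 0 < 2 * (cmod t + 1) by have := cmod_ge0 t; lra.
by have [K cK] := ec _ r0; apply: (pser_cvg r0 cK); lra.
Qed.

Lemma entire_pser_unique c t u : entire c ->
  cmod (u - psum c M t) @[M --> \oo] --> (0 : R) -> u = pser c t.
Proof.
by move=> ec h; apply: cmod_limit_unique h (entire_pser_cvg t ec).
Qed.

(** The coefficients of [pser c t / (1 - t / w)]. *)
Definition quot_coef c w (n : nat) := psum c n.+1 w / w ^+ n.

Lemma quot_coef0 c w : quot_coef c w 0 = c 0.
Proof. by rewrite /quot_coef /psum big_nat1 expr0 divr1 mulr1. Qed.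

Lemma quot_coef1 c w : w != 0 -> quot_coef c w 1 = c 1 + c 0 / w.
Proof.
move=> w0; rewrite /quot_coef !psumS /psum big_geq// expr0 expr1 add0r mulr1.
by rewrite mulrDl mulfK// addrC.
Qed.

(** Up to the factor [w ^- n] the quotient coefficients are the partial sums
    of [c] at the root [w], hence, with the opposite sign, the remainders of a
    series that vanishes: this is why they are again entire. *)
Lemma entire_quot c w : entire c -> w != 0 -> pser c w = 0 ->
  entire (quot_coef c w).
Proof.
move=> ec w0 cw r r0.
pose s := r + cmod w.
have s0 : 0 < s by rewrite ltr_pwDl ?cmod_ge0.
have s20 : 0 < 2 * s by rewrite mulr_gt0.
have [K cK] := ec _ s20; exists (2 * K) => n.
have K0 : 0 <= K by apply: le_trans (cK 0%N); rewrite mulr_ge0 ?cmod_ge0.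
have ws : cmod w <= 2 * s / 2 by rewrite mulrAC divff// mul1r lerDr ltW.
have := pser_tail n.+1 s20 cK ws; rewrite cw sub0r cmodN => h.
rewrite /quot_coef cmodM cmodV cmodX.
have wn0 : 0 < cmod w ^+ n by rewrite exprn_gt0// cmod_gt0.
rewrite mulrAC ler_pdivrMr//.
apply: le_trans (ler_wpM2r _ h) _; first by rewrite exprn_ge0// ltW.
rewrite -[leLHS]mulrA ler_wpM2l ?mulr_ge0// exprS.
rewrite [leLHS](_ : _ = cmod w / (2 * s) * (r / (2 * s)) ^+ n * cmod w ^+ n); last first.
  by rewrite !expr_div_n; ring.
rewrite ler_piMl ?(ltW wn0)// mulr_ile1 ?exprn_ge0 ?divr_ge0 ?cmod_ge0 ?(ltW r0) ?(ltW s20)//.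
  by rewrite ler_pdivrMr// mul1r /s; have := cmod_ge0 w; lra.
rewrite exprn_ile1 ?divr_ge0 ?(ltW r0) ?(ltW s20)//.
by rewrite ler_pdivrMr// mul1r /s; have := cmod_ge0 w; lra.
Qed.

Lemma psum_quot c w t M : w != 0 ->
  (1 - t / w) * psum (quot_coef c w) M t =
  psum c M t - (t / w) ^+ M * psum c M w.
Proof.
move=> w0; elim: M => [|M IH]; first by rewrite /psum !big_geq// !mulr0 subr0.
have aux (F : fieldType) (A B a x y t' w' : F) : y != 0 -> w' != 0 ->
    A - x / y * B + (1 - t' / w') * ((B + a * y) / y * x) =
    A + a * x - (t' / w' * (x / y)) * (B + a * y).
  by move=> y0 w'0; field; rewrite y0 w'0.
rewrite psumS mulrDr IH /quot_coef !psumS exprS !expr_div_n.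
by apply: aux; rewrite ?expf_neq0.
Qed.

Lemma pser_quot c w t : entire c -> w != 0 -> pser c w = 0 ->
  pser c t = (1 - t / w) * pser (quot_coef c w) t.
Proof.
move=> ec w0 cw; have ed := entire_quot ec w0 cw.
have [-> | tw] := eqVneq t w; first by rewrite cw divff// subrr mul0r.
apply/esym; apply: entire_pser_unique => //.
set d := quot_coef c w.
have s0 : 0 < 2 * (cmod t + 1) by have := cmod_ge0 t; lra.
have [K dK] := ed _ s0.
have ht : cmod t <= 2 * (cmod t + 1) / 2 by lra.
have K0 : 0 <= K by apply: le_trans (dK 0%N); rewrite mulr_ge0 ?cmod_ge0.
pose b M := cmod (1 - t / w) * cmod (pser d t - psum d M t) +
  cmod (t / w) * (K / 2 ^+ M.-1).
have b0 : b M @[M --> \oo] --> (0 : R).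
  rewrite -[X in _ --> X]addr0; apply: cvgD.
    rewrite -(mulr0 (cmod (1 - t / w))); apply: cvgM; first exact: cvg_cst.
    exact: entire_pser_cvg.
  rewrite -(mulr0 (cmod (t / w))); apply: cvgM; first exact: cvg_cst.
  have := geo_half_cvg K; rewrite -(cvg_shiftS _ (nbhs 0)) => h.
  by rewrite -(cvg_shiftS _ (nbhs 0))/=; exact: geo_half_cvg.
apply: (squeeze_cvgr _ (cvg_cst 0) b0).
near=> M; rewrite cmod_ge0/=.
have -> : (1 - t / w) * pser d t - psum c M t =
  (1 - t / w) * (pser d t - psum d M t) - (t / w) ^+ M * psum c M w.
  by rewrite mulrBr psum_quot// opprB addrAC subrKA.
rewrite /b; apply: le_trans (cmodB _ _) _.
apply: lerD; first by rewrite cmodM.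
have M0 : (0 < M)%N by near: M; exact: nbhs_infty_gt.
case: (M) M0 => // m _.
have -> : (t / w) ^+ m.+1 * psum c m.+1 w = t / w * (d m * t ^+ m).
  rewrite exprS -mulrA; congr (_ * _); rewrite expr_div_n /d /quot_coef mulrC.
  by rewrite mulrA mulrAC.
rewrite cmodM ler_wpM2l ?cmod_ge0//=.
apply: le_trans (cmod_coef_le m t s0 dK) _.
rewrite ler_wpM2l// -exprVn lerXn2r ?nnegrE//.
  by rewrite divr_ge0 ?cmod_ge0 ?ltW.
by rewrite ler_pdivrMr// mulrC.
Unshelve. all: by end_near.
Qed.

End EntireSeries.

(** * Cauchy estimates by averages over roots of unity *)

Section RootsOfUnity.
Context {R : realType}.

(** ['X^N - 1] is separable and splits, so it has [N] distinct roots, which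
    form a cyclic group. *)
Lemma exists_prim_root N : (0 < N)%N -> exists w : R[i], N.-primitive_root w.
Proof.
move=> N0; pose p : {poly R[i]} := 'X^N - 1.
have [rs hp] := closed_field_poly_normal p.
have lp : lead_coef p = 1 by apply/monicP; exact: monicXnsubC.
rewrite lp scale1r in hp.
have sz : size rs = N.
  by apply: succn_inj; rewrite -(size_prod_XsubC rs id) -hp size_XnsubC.
have un : uniq rs.
  rewrite -separable_prod_XsubC -hp /p.
  by apply: separable_Xn_sub_1; rewrite pnatr_eq0 -lt0n.
have au : all N.-unity_root rs.
  apply/allP => x xrs; suff: root p x by [].
  rewrite hp.
  by rewrite root_prod_XsubC.
have /hasP[w _ wp] := has_prim_root N0 au un (eq_leq (esym sz)).
by exists w.
Qed.

Lemma cmod_unity_root (w : R[i]) N : (0 < N)%N -> w ^+ N = 1 -> cmod w = 1.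
Proof.
move=> N0 wN; apply/eqP; rewrite -(@pexpr_eq1 _ _ N)// ?cmod_ge0//.
by rewrite -cmodX wN cmod1.
Qed.

Lemma sum_prim_root (w : R[i]) N k : N.-primitive_root w ->
  \sum_(0 <= j < N) (w ^+ j) ^+ k = if (N %| k)%N then N%:R else 0.
Proof.
move=> wp; have [/dvdnP[q ->]|nk] := boolP (N %| k)%N.
  rewrite (eq_bigr (fun=> 1)) => [|j _]; first by rewrite sumr_const_nat subn0.
  by rewrite exprAC (mulnC q) exprM (prim_expr_order wp) !expr1n.
have wk : w ^+ k != 1 by rewrite -(prim_order_dvd wp).
apply/eqP; rewrite -(inj_eq (mulfI (_ : w ^+ k - 1 != 0))) ?subr_eq0// mulr0.
rewrite big_mkord (eq_bigr (fun i : 'I_N => (w ^+ k) ^+ i)); last first.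
  by move=> i _; rewrite -!exprM mulnC.
by rewrite -subrX1 -exprM mulnC exprM (prim_expr_order wp) expr1n subrr.
Qed.

(** Averaging over a sufficiently fine set of roots of unity isolates one
    coefficient. *)
Lemma psum_cauchy (c : nat -> R[i]) M n (r B : R) : (n < M)%N -> 0 < r ->
  (forall t, cmod t = r -> cmod (psum c M t) <= B) -> cmod (c n) * r ^+ n <= B.
Proof.
move=> nM r0 cB.
have M0 : (0 < M)%N by apply: leq_ltn_trans nM.
have [w wp] := exists_prim_root M0.
have w1 j : cmod (w ^+ j) = 1.
  by rewrite cmodX (cmod_unity_root M0) ?expr1n// prim_expr_order.
have e : \sum_(0 <= j < M) psum c M (r%:C * w ^+ j) * (w ^+ j) ^+ (M - n) =
    M%:R * (c n * r%:C ^+ n).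
  transitivity (\sum_(0 <= m < M) c m * r%:C ^+ m *
      \sum_(0 <= j < M) (w ^+ j) ^+ (m + (M - n))).
    rewrite /psum; under eq_bigr do rewrite mulr_suml.
    rewrite exchange_big/=; apply: eq_bigr => m _.
    rewrite mulr_sumr; apply: eq_bigr => j _.
    by rewrite exprMn exprD !mulrA.
  rewrite (bigD1_seq n)/= ?mem_index_iota ?iota_uniq//.
  rewrite sum_prim_root// subnKC ?(ltnW nM)// dvdnn.
  rewrite big1_seq ?addr0; first by rewrite mulrC.
  move=> m /andP[mn]; rewrite mem_index_iota => /andP[_ mM].
  rewrite sum_prim_root// ifF ?mulr0//; apply/negbTE/negP => /dvdnP[q].
  have [q0|[q1|]] : (q = 0 \/ q = 1 \/ 2 <= q)%N by lia.
  - by rewrite q0 mul0n; lia.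
  - by rewrite q1 mul1n; move/eqP: mn; lia.
  - by nia.
have MR : (0 : R) < M%:R by rewrite ltr0n.
rewrite -(ler_pM2l MR).
have -> : M%:R * (cmod (c n) * r ^+ n) = cmod (M%:R * (c n * r%:C ^+ n)).
  by rewrite !cmodM cmodX cmod_real cmod_nat (gtr0_norm r0).
rewrite -e; apply: le_trans (cmod_sum _ _ _) _.
rewrite mulr_natl -[X in _ *+ X]subn0 -sumr_const_nat; apply: ler_sum => j _.
rewrite cmodM -exprM cmodX (cmod_unity_root M0 (prim_expr_order wp)) expr1n mulr1.
by apply: cB; rewrite cmodM w1 mulr1 cmod_real gtr0_norm.
Qed.

Lemma pser_cauchy (c : nat -> R[i]) n (r B : R) : entire c -> 0 < r ->
  (forall t, cmod t = r -> cmod (pser c t) <= B) -> cmod (c n) * r ^+ n <= B.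
Proof.
move=> ec r0 cB; have s0 : 0 < 2 * r by lra.
have [K cK] := ec _ s0.
have h (M : nat) : (n < M)%N -> cmod (c n) * r ^+ n <= B + 2 * K / 2 ^+ M.
  move=> nM; apply: psum_cauchy nM r0 _ => t tr.
  have tr2 : cmod t <= 2 * r / 2 by rewrite tr; lra.
  rewrite -(subKr (pser c t) (psum c M t)).
  apply: le_trans (cmodB _ _) _; apply: lerD; first exact: cB.
  exact: pser_tail2 cK tr2.
apply: (@le_trans _ _ (limn (fun M => B + 2 * K / 2 ^+ M))).
  apply: limr_ge.
    by apply: is_cvgD; [exact: is_cvg_cst | apply/cvg_ex; eexists; exact: geo_half_cvg].
  by near=> M; apply: h; near: M; exact: nbhs_infty_gt.
rewrite (cvg_lim _ (_ : _ --> B + 0)) ?addr0//.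
by rewrite -[X in _ --> X]addr0; apply: cvgD; [exact: cvg_cst | exact: geo_half_cvg].
Unshelve. all: by end_near.
Qed.

End RootsOfUnity.

(** * Zeros of polynomials with exponential bounds *)

Section RootPolynomials.
Context {R : realType}.
Implicit Types (rs : seq R[i]) (p : {poly R[i]}) (c : nat -> R[i]).
Implicit Types (u v w t : R[i]).

(** Every polynomial with constant coefficient [1] has this form. *)
Definition rpoly rs : {poly R[i]} := \prod_(z <- rs) (1 - z^-1 *: 'X).

Lemma horner_rpoly rs t : (rpoly rs).[t] = \prod_(z <- rs) (1 - t / z).
Proof.
rewrite /rpoly horner_prod; apply: eq_bigr => z _.
by rewrite !hornerE mulrC.
Qed.

Lemma rpoly_coef0 rs : (rpoly rs)`_0 = 1.
Proof.
rewrite -horner_coef0 horner_rpoly big1// => z _.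
by rewrite mul0r subr0.
Qed.

Lemma rpoly_coef1 rs : (rpoly rs)`_1 = - \sum_(z <- rs) z^-1.
Proof.
elim: rs => [|z rs IH]; first by rewrite /rpoly !big_nil oppr0 coef1.
have e : rpoly (z :: rs) = rpoly rs - z^-1 *: (rpoly rs * 'X).
  by rewrite /rpoly big_cons mulrBl mul1r -scalerAl mulrC.
by rewrite e coefB coefZ coefMX /= IH rpoly_coef0 mulr1 big_cons opprD addrC.
Qed.

Lemma poly_rpoly p : p`_0 = 1 -> exists2 rs, all (fun z : R[i] => z != 0) rs & p = rpoly rs.
Proof.
move=> p0; have [rs hp] := closed_field_poly_normal p; exists rs.
  apply/allP => z zrs; apply/eqP => z0; move: p0.
  rewrite -horner_coef0 hp hornerZ.
  have /rootP -> : root (\prod_(z <- rs) ('X - z%:P)) 0 by rewrite root_prod_XsubC -z0.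
  by rewrite mulr0 => /esym/eqP; rewrite oner_eq0.
have h (s : seq R[i]) : all (fun z : R[i] => z != 0) s ->
    \prod_(z <- s) ('X - z%:P) = (\prod_(z <- s) (- z)) *: rpoly s.
  elim: s => [|z s IH]; first by rewrite /rpoly !big_nil scale1r.
  move=> /andP[z0 /IH e].
  have hz : 'X - z%:P = (- z) *: (1 - z^-1 *: 'X).
    by rewrite scalerBr scalerA mulNr divff// scaleN1r opprK addrC scaleNr alg_polyC.
  by rewrite /rpoly !big_cons e hz -scalerAl -scalerAr scalerA.
have nz : all (fun z : R[i] => z != 0) rs.
  apply/allP => z zrs; apply/eqP => z0; move: p0.
  rewrite -horner_coef0 hp hornerZ.
  have /rootP -> : root (\prod_(z <- rs) ('X - z%:P)) 0 by rewrite root_prod_XsubC -z0.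
  by rewrite mulr0 => /esym/eqP; rewrite oner_eq0.
rewrite h// scalerA in hp; move: p0; rewrite hp coefZ rpoly_coef0 mulr1 => ->.
by rewrite scale1r.
Qed.

Lemma psum_horner c M t : psum c M t = (\poly_(i < M) c i).[t].
Proof. by rewrite horner_poly /psum big_mkord. Qed.

Lemma horner_psum p M t : (size p <= M)%N -> p.[t] = psum (fun n => p`_n) M t.
Proof. by move=> sp; rewrite (horner_coef_wide _ sp) /psum big_mkord. Qed.

(** On the circle of radius [3 s] each factor of a zero in the disc of radius
    [s] has modulus at least [2], while the product of the other factors has,
    by Cauchy's estimate, a maximum of at least its value [1] at the origin. *)
Lemma rpoly_count rs (s B : R) : 0 < s -> all (fun z : R[i] => z != 0) rs ->
  (forall u, cmod u = 3 * s -> cmod (rpoly rs).[u] <= B) ->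
  2 ^+ count (fun z => cmod z <= s) rs <= B.
Proof.
move=> s0 nz hB; set a := fun z => cmod z <= s.
pose q := rpoly [seq z <- rs | ~~ a z].
have s30 : 0 < 3 * s by lra.
suff h : cmod q`_0 * (3 * s) ^+ 0 <= B / 2 ^+ count a rs.
  move: h; rewrite rpoly_coef0 cmod1 expr0 mulr1 ler_pdivlMr ?exprn_gt0//.
  by rewrite mul1r.
apply: (@psum_cauchy _ (fun n => q`_n) (size q).+1 0%N) => // u us.
rewrite -horner_psum// ler_pdivlMr ?exprn_gt0// mulrC.
apply: le_trans (hB _ us); rewrite !horner_rpoly !cmod_prod.
rewrite big_filter [leRHS](bigID a)/= ler_wpM2r ?prodr_ge0// => [z _|].
  exact: cmod_ge0.
elim: rs nz {hB q} => [_|z rs IH /andP[z0 nz]]; first by rewrite big_nil.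
rewrite big_cons/=; case: ifPn => az /=; last exact: IH.
rewrite add1n exprS ler_pM ?exprn_ge0 ?IH//.
apply: le_trans (_ : cmod (u / z) - cmod 1 <= _); last by rewrite cmodC cmod_dist.
rewrite cmod1 cmodM cmodV us lerBrDr ler_pdivlMr ?cmod_gt0//.
by move: az; rewrite /a; lra.
Qed.

(** Summation by dyadic shells. *)
Lemma sum_inv_sqr_le rs (rho A : R) : 0 < rho ->
  all (fun z => rho < cmod z) rs ->
  (forall s, rho <= s -> (count (fun z => cmod z <= s) rs)%:R <= A * s) ->
  \sum_(z <- rs) cmod z ^- 2 <= 4 * A / rho.
Proof.
move=> rho0 rrs hA.
pose s j : R := 2 ^+ j * rho; pose a j (z : R[i]) : bool := cmod z <= s j.+1.
have s0 j : 0 < s j by rewrite mulr_gt0 ?exprn_gt0.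
have A0 : 0 <= A.
  have := le_trans (ler0n _ _) (hA _ (lexx _)).
  by rewrite pmulr_lge0.
have [J hJ] : exists J, all (fun z => cmod z <= s J) rs.
  exists (Num.bound ((\sum_(z <- rs) cmod z) / rho)).
  apply/allP => z zrs; rewrite -ler_pdivrMr//.
  apply: (@le_trans _ _ ((\sum_(z <- rs) cmod z) / rho)).
    rewrite ler_pM2r ?invr_gt0// (big_rem z)//= lerDl sumr_ge0// => ? _.
    exact: cmod_ge0.
  have := archi_boundP (_ : 0 <= (\sum_(z <- rs) cmod z) / rho).
  have h0 : 0 <= (\sum_(z <- rs) cmod z) / rho.
    by rewrite divr_ge0 ?(ltW rho0)// sumr_ge0// => ? _; exact: cmod_ge0.
  move=> /(_ h0) /ltW h1; apply: le_trans h1 _.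
  by rewrite -natrX ler_nat ltnW// ltn_expl.
have one z J' : rho < cmod z -> cmod z <= s J' ->
    cmod z ^- 2 <= \sum_(0 <= j < J') (a j z)%:R * s j ^- 2.
  move=> rz; elim: J' => [|J' IH] zs.
    by move: zs; rewrite /s expr0 mul1r leNgt rz.
  rewrite big_nat_recr//=; have [/IH h|h] := leP (cmod z) (s J').
    by apply: le_trans h _; rewrite lerDl mulr_ge0// invr_ge0 exprn_ge0// ltW.
  apply: (@le_trans _ _ (s J' ^- 2)).
    by rewrite lef_pV2 ?posrE ?exprn_gt0 ?(lt_trans _ h)// ler_pXn2r ?nnegrE ?cmod_ge0 ?ltW.
  rewrite /a zs mul1r lerDr sumr_ge0// => j _.
  by rewrite mulr_ge0// invr_ge0 exprn_ge0// ltW.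
apply: (@le_trans _ _ (\sum_(z <- rs) \sum_(0 <= j < J) (a j z)%:R * s j ^- 2)).
  rewrite big_seq [leRHS]big_seq; apply: ler_sum => z zrs.
  by apply: one; [exact: (allP rrs) | exact: (allP hJ)].
rewrite exchange_big/=.
apply: (@le_trans _ _ (\sum_(0 <= j < J) 2 * A / rho * 2^-1 ^+ j)).
  apply: ler_sum => j _; rewrite -mulr_suml.
  have -> : \sum_(z <- rs) (a j z)%:R = (count (a j) rs)%:R :> R.
    by rewrite -sum1_count natr_sum [RHS]big_mkcond; apply: eq_bigr => z _; case: ifP.
  have sj : rho <= s j.+1 by rewrite /s ler_peMl ?(ltW rho0) ?exprn_ege1 ?ler1n.
  apply: le_trans (ler_wpM2r _ (hA _ sj)) _; first by rewrite invr_ge0 exprn_ge0// ltW.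
  rewrite [leLHS](_ : _ = 2 * A / rho * 2^-1 ^+ j)// /s exprS exprVn.
  by field; rewrite ?expf_neq0 ?(lt0r_neq0 rho0).
rewrite -mulr_sumr; apply: le_trans (ler_wpM2l _ (geo_half_le _)) _.
  by rewrite divr_ge0 ?mulr_ge0// ltW.
by rewrite le_eqVlt; apply/orP; left; apply/eqP; ring.
Qed.

Lemma cmod_prod_sub1 (I : eqType) (s : seq I) (f : I -> R[i]) (b : I -> R) :
  (forall i, i \in s -> cmod (f i - 1) <= b i) ->
  cmod (\prod_(i <- s) f i - 1) <= expR (\sum_(i <- s) b i) - 1.
Proof.
elim: s => [|i s IH] fbs; first by rewrite !big_nil subrr cmod0 expR0 subrr.
have fb : cmod (f i - 1) <= b i by apply: fbs; rewrite mem_head.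
have {}IH := IH (fun j js => fbs j (@mem_behead _ (i :: s) j js)).
rewrite !big_cons; set p := \prod_(j <- s) f j in IH *.
have -> : f i * p - 1 = f i * (p - 1) + (f i - 1) by rewrite mulrBr mulr1 subrKA.
apply: le_trans (cmodD _ _) _; rewrite cmodM.
have h1 : cmod (f i) <= 1 + b i.
  rewrite -(subrK 1 (f i)) addrC; apply: le_trans (cmodD _ _) _.
  by rewrite cmod1 lerD2l.
have b0 : 0 <= b i by apply: le_trans fb; exact: cmod_ge0.
apply: (@le_trans _ _ ((1 + b i) * (expR (\sum_(j <- s) b j) - 1) + b i)).
  apply: lerD; last by [].
  by apply: ler_pM => //; exact: cmod_ge0.
rewrite expRD mulrBr mulr1 opprD addrA addrNK lerD2r.
by rewrite ler_wpM2r ?expR_ge0// expR_ge1Dx.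
Qed.

(** The linear terms of [1 - v] and [cexp v] cancel. *)
Lemma cmod_weierstrass v : cmod v <= 1 ->
  cmod ((1 - v) * cexp v - 1) <= (1 + 2 * expR 1) * cmod v ^+ 2.
Proof.
move=> v1; have h := cexp_taylor 2 v.
have -> : (1 - v) * cexp v - 1 = (1 - v) * (cexp v - exp_sum 2 v) - v ^+ 2.
  rewrite /exp_sum big_nat_recr//= big_nat1 expr0 expr1 !divr1 mulrBr.
  have aux (F : fieldType) (x e : F) :
    (1 - x) * e - 1 = (1 - x) * e - (1 - x) * (1 + x) - x ^+ 2 by ring.
  exact: aux.
have hv : cmod (1 - v) <= 2.
  by apply: le_trans (cmodB _ _) _; rewrite cmod1; lra.
have he : expR (cmod v) <= expR 1 by rewrite ler_expR.
apply: le_trans (cmodB _ _) _; rewrite cmodM cmodX mulrDl mul1r addrC lerD2l.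
rewrite -mulrA; apply: ler_pM => //; rewrite ?cmod_ge0//.
apply: le_trans h _; rewrite mulrC ler_pM ?expR_ge0//.
  by rewrite divr_ge0 ?exprn_ge0 ?cmod_ge0.
by rewrite ler_pdivrMr ?ltr0n ?fact_gt0// ler_peMr ?exprn_ge0 ?cmod_ge0// ler1n.
Qed.

(** The polynomial times the exponential is a product of Weierstrass factors
    of genus one. *)
Lemma rpoly_near_exp rs (rho S : R) u : 0 < rho ->
  all (fun z => rho < cmod z) rs -> \sum_(z <- rs) cmod z ^- 2 <= S ->
  cmod u <= rho ->
  cmod ((rpoly rs).[u] * cexp (- (rpoly rs)`_1 * u) - 1) <=
  expR ((1 + 2 * expR 1) * S * cmod u ^+ 2) - 1.
Proof.
move=> rho0 rrs hS ur.
have -> : (rpoly rs).[u] * cexp (- (rpoly rs)`_1 * u) =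
    \prod_(z <- rs) ((1 - u / z) * cexp (u / z)).
  rewrite big_split/= -horner_rpoly rpoly_coef1 opprK mulr_suml; congr (_ * _).
  rewrite (@big_morph _ _ (@cexp R) 1 *%R 0 +%R)//; [|exact: cexpD|exact: cexp0].
  by apply: eq_bigr => z _; rewrite mulrC.
apply: (le_trans (cmod_prod_sub1 (b := fun z => (1 + 2 * expR 1) * cmod u ^+ 2 * cmod z ^- 2) _)).
  move=> z zrs; have rz := allP rrs _ zrs.
  have z0 : 0 < cmod z by exact: lt_trans rz.
  have := cmod_weierstrass (v := u / z).
  rewrite cmodM cmodV ler_pdivrMr// mul1r expr_div_n mulrA; apply.
  by apply: le_trans ur _; exact: ltW.
rewrite lerD2r ler_expR -mulr_sumr mulrAC ler_wpM2r ?exprn_ge0 ?cmod_ge0//.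
by rewrite ler_wpM2l// addr_ge0// mulr_ge0// expR_ge0.
Qed.
End RootPolynomials.

(** * Entire functions without zeros in a large disc *)

Section ZeroFree.
Context {R : realType}.
Implicit Types (c : nat -> R[i]) (u v w t : R[i]).

Lemma cmod_dist_norm u v : `|cmod u - cmod v| <= cmod (u - v).
Proof. by rewrite ler_norml lerNl opprB [in X in X && _]cmodC !cmod_dist. Qed.

Lemma entire_lipschitz c (r : R) : entire c -> 0 < r ->
  exists2 L : R, 0 <= L & forall u v, cmod u <= r -> cmod v <= r ->
    cmod (pser c u - pser c v) <= L * cmod (u - v).
Proof.
move=> ec r0; have r40 : 0 < 4 * r by lra.
have [K cK] := ec _ r40; exists (8 * K / (4 * r)).
  have K0 : 0 <= K by apply: le_trans (cK 0%N); rewrite mulr_ge0 ?cmod_ge0.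
  by rewrite divr_ge0 ?mulr_ge0// ltW.
by move=> u v ur vr; apply: pser_lipschitz cK _ _ => //; lra.
Qed.

Lemma entire_continuous_plane c : entire c ->
  continuous (fun p : R * R => cmod (pser c (p.1 +i* p.2))).
Proof.
move=> ec -[x y]; apply/cvgrPdist_lt => e e0.
set w := x +i* y.
have r0 : 0 < cmod w + 2 by have := cmod_ge0 w; lra.
have [L L0 hL] := entire_lipschitz ec r0.
pose de := Num.min 1 (e / (2 * (L + 1))).
have de0 : 0 < de by rewrite lt_min ltr01 divr_gt0// mulr_gt0//; lra.
near=> p => /=.
have dp : cmod (w - (p.1 +i* p.2)) <= 2 * de.
  apply: le_trans (cmod_le_ReIm _) _; rewrite /= mulr_natl mulr2n; apply: lerD.
    by near: p; apply: cvgr_dist_le => //; exact: cvg_fst.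
  by near: p; apply: cvgr_dist_le => //; exact: cvg_snd.
have de1 : de <= 1 by rewrite ge_min lexx.
have pr : cmod (p.1 +i* p.2) <= cmod w + 2.
  rewrite -(subKr w (p.1 +i* p.2)); apply: le_trans (cmodB _ _) _; lra.
have wr : cmod w <= cmod w + 2 by lra.
apply: (@le_lt_trans _ _ (cmod (pser c w - pser c (p.1 +i* p.2)))).
  exact: cmod_dist_norm.
apply: le_lt_trans (hL _ _ wr pr) _.
apply: (@le_lt_trans _ _ (L * (2 * de))); first by rewrite ler_wpM2l.
have : de <= e / (2 * (L + 1)) by rewrite ge_min lexx orbT.
rewrite ler_pdivlMr; last by lra.
by nra.
Unshelve. all: by end_near.
Qed.

(** A continuous function without zeros on a compact set is bounded away from
    [0]. *)
Lemma entire_lower_bound c (rho : R) : entire c -> 0 < rho ->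
  (forall t, cmod t <= 2 * rho -> pser c t != 0) ->
  exists2 de : R, 0 < de & forall t, cmod t <= rho -> de <= cmod (pser c t).
Proof.
move=> ec r0 nz.
pose f := fun p : R * R => cmod (pser c (p.1 +i* p.2)).
pose A : set (R * R) := `[- rho, rho] `*` `[- rho, rho].
have cA : compact A by apply: compact_setX; exact: segment_compact.
have A0 : A !=set0 by exists (0, 0); split; rewrite /= in_itv/=; apply/andP; lra.
have cf : {within A, continuous f}.
  by apply: continuous_subspaceT; exact: entire_continuous_plane.
have [[x y]] := compact_EVT_min A0 cA cf.
rewrite inE => -[/=]; rewrite !in_itv/= => xr yr hmin.
exists (f (x, y)).
  rewrite /f/= cmod_gt0; apply: nz; apply: le_trans (cmod_le_ReIm _) _ => /=.
  by rewrite mulr_natl mulr2n lerD// ler_norml.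
move=> [a b] tr; apply: (hmin (a, b)); rewrite inE; split; rewrite /= in_itv/= -ler_norml.
  exact: le_trans (Re_le_cmod _) tr.
exact: le_trans (Im_le_cmod _) tr.
Qed.

(** Logarithmic form of [rpoly_count]. *)
Lemma rpoly_count_linear (rs : seq R[i]) (s a kappa C : R) :
  1 <= s -> 1 <= kappa -> 0 <= a ->
  all (fun z : R[i] => z != 0) rs ->
  (forall v, cmod v = 3 * (kappa * s) -> cmod (rpoly rs).[v] <= expR (a + C * s)) ->
  (count (fun z => cmod z <= s) rs)%:R <= (a + C) / ln 2 * s.
Proof.
move=> s1 k1 a0 rs0 hv.
have s0 : 0 < s by exact: lt_le_trans s1.
have k0 : 0 < kappa by exact: lt_le_trans k1.
have ln2 : 0 < ln 2 :> R by rewrite ln_gt0// ltr1n.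
have hc := rpoly_count (mulr_gt0 k0 s0) rs0 hv.
rewrite mulrAC ler_pdivlMr//.
set m2 := count _ _ in hc.
have hm : (count (fun z => cmod z <= s)%R rs <= m2)%N.
  by apply: sub_count => z /= zs; apply: le_trans zs _; rewrite ler_peMl// ltW.
apply: (@le_trans _ _ (m2%:R * ln 2)); first by rewrite ler_wpM2r ?(ltW ln2)// ler_nat.
have : ln (2 ^+ m2) <= a + C * s.
  by rewrite -[leRHS]expRK ler_ln ?posrE ?exprn_gt0 ?expR_gt0.
rewrite lnXn// => h; rewrite mulr_natl; apply: (le_trans h).
by rewrite mulrDl lerD2r ler_peMr.
Qed.

(** The factor [(ln (2 B) + 6 b kappa) / ln 2] bounds the density of the zeros
    of the Taylor polynomials. *)
Definition near_exp_const (B b kappa : R) :=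
  (1 + 2 * expR 1) * (4 * ((ln (2 * B) + 6 * b * kappa) / ln 2)).

(** The Taylor polynomials inherit the absence of zeros in the disc and,
    through Cauchy's estimates, the exponential bound, so that their zeros
    have linear density; hence the sum of the inverse squares of the zeros is
    [O (1 / rho)], and [rpoly_near_exp] applies to them, uniformly in the
    degree. *)
Lemma zero_free_near_exp c (B b kappa rho : R) u :
  entire c -> c 0 = 1 -> 1 <= B -> 0 <= b -> 1 <= kappa -> 1 <= rho ->
  (forall t, cmod t <= 2 * rho -> pser c t != 0) ->
  (forall t, kappa * rho <= cmod t -> cmod (pser c t) <= B * expR (b * cmod t)) ->
  cmod u <= rho ->
  cmod (pser c u * cexp (- c 1 * u) - 1) <=
  expR (near_exp_const B b kappa * cmod u ^+ 2 / rho) - 1.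
Proof.
move=> ec c0 B1 b0 k1 r1 nz gr ur.
have r0 : 0 < rho by lra.
have [de de0 hde] := entire_lower_bound ec r0 nz.
have r20 : 0 < 2 * rho by lra.
have [K cK] := ec _ r20.
have coef n r : kappa * rho <= r -> cmod (c n) * r ^+ n <= B * expR (b * r).
  move=> kr; apply: pser_cauchy => //; first by nra.
  by move=> t tr; rewrite -tr; apply: gr; rewrite tr.
have grow M t : kappa * rho <= 2 * cmod t ->
    cmod (psum c M t) <= 2 * B * expR (2 * b * cmod t).
  move=> kt; have t0 : 0 < 2 * cmod t by nra.
  have cK' n := @coef n _ kt.
  have tt : cmod t / (2 * cmod t) = 2^-1.
    by rewrite invfM mulrCA divff ?mulr1//; move: t0; rewrite pmulr_rgt0// => /lt0r_neq0.
  apply: le_trans (cmod_sum _ _ _) _.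
  apply: (@le_trans _ _ (\sum_(0 <= n < M) B * expR (b * (2 * cmod t)) * 2^-1 ^+ n)).
    by apply: ler_sum => n _; rewrite -tt; exact: cmod_coef_le cK'.
  rewrite -mulr_sumr [leRHS](_ : _ = B * expR (b * (2 * cmod t)) * 2); last first.
    by rewrite (mulrC 2 b) -(mulrA b); ring.
  by rewrite ler_wpM2l ?geo_half_le// mulr_ge0 ?expR_ge0//; lra.
apply: (cmod_limit_le (f := fun M => psum c M u * cexp (- c 1 * u) - 1)).
  under eq_fun do rewrite opprB addrA subrK -mulrBl cmodM.
  rewrite -(mul0r (cmod (cexp (- c 1 * u)))); apply: cvgM; last exact: cvg_cst.
  exact: entire_pser_cvg.
near=> M.
have M2 : (2 <= M)%N by near: M; exact: nbhs_infty_ge.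
pose p := \poly_(i < M) c i.
have [rs rs0 prs] : exists2 rs, all (fun z : R[i] => z != 0) rs & p = rpoly rs.
  by apply: poly_rpoly; rewrite coef_poly (ltnW M2) c0.
have pE t : psum c M t = (rpoly rs).[t] by rewrite psum_horner -/p prs.
have p1 : (rpoly rs)`_1 = c 1%N by rewrite -prs coef_poly M2.
have big : all (fun z => rho < cmod z) rs.
  apply/allP => z zrs; rewrite ltNge; apply/negP => zr.
  have pz : psum c M z = 0.
    rewrite pE horner_rpoly (big_rem z)//= divff ?subrr ?mul0r//.
    exact: (allP rs0).
  have h1 : cmod (pser c z - psum c M z) <= 2 * K / 2 ^+ M.
    by apply: pser_tail2 cK _ => //; lra.
  have := hde _ zr; rewrite pz subr0 in h1 => h2.
  have : 2 * K / 2 ^+ M < de.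
    by near: M; apply: (cvgr_lt 0) => //; exact: geo_half_cvg.
  by lra.
rewrite -p1 pE /near_exp_const.
set A := (ln (2 * B) + 6 * b * kappa) / ln 2.
have hS : \sum_(z <- rs) cmod z ^- 2 <= 4 * A / rho.
  apply: sum_inv_sqr_le => // s rs'.
  have s1 : 1 <= s by exact: le_trans rs'.
  have k0 : 0 <= kappa by exact: le_trans k1.
  have B20 : 1 <= 2 * B by rewrite -[leLHS]mul1r; apply: ler_pM => //; rewrite ler1n.
  apply: (rpoly_count_linear s1 k1 (ln_ge0 B20) rs0) => v vs; rewrite -pE.
  apply: (le_trans (grow M v _)); rewrite vs.
    by have := ler_wpM2l k0 rs'; clear -s1 k1; nra.
  rewrite expRD lnK ?posrE ?(lt_le_trans ltr01 B20)//.
  by have -> : 2 * b * (3 * (kappa * s)) = 6 * b * kappa * s by ring.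
have := rpoly_near_exp r0 big hS ur.
rewrite (_ : _ * (4 * A / rho) * _ = (1 + 2 * expR 1) * (4 * A) * cmod u ^+ 2 / rho)//.
by ring.
Unshelve. all: by end_near.
Qed.

End ZeroFree.

(** * Orders of vanishing *)

Section ComplexTopology.
Context {R : realType}.
Implicit Types (f g : R[i] -> R[i]) (u v w t : R[i]).

Lemma near_cmod w (P : R[i] -> Prop) :
  (\forall t \near w, P t) <->
  exists2 e : R, 0 < e & forall t, cmod (t - w) < e -> P t.
Proof.
split.
  move=> /nbhs_ballP[e /= e0 he].
  have er : e = (Re e)%:C by rewrite RRe_real// gtr0_real.
  exists (Re e); first by move: e0; rewrite er ltcR.
  by move=> t tw; apply: he; rewrite /ball/= er normE ltcR cmodC.
move=> [e e0 he]; apply/nbhs_ballP; exists e%:C => /=; first by rewrite ltcR.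
by move=> t; rewrite /ball/= normE ltcR cmodC; exact: he.
Qed.

Lemma near_punctured_cmod w (P : R[i] -> Prop) :
  (\forall t \near w^', P t) <->
  exists2 e : R, 0 < e & forall t, t != w -> cmod (t - w) < e -> P t.
Proof.
rewrite /dnbhs; split.
  by move=> /near_cmod[e e0 he]; exists e => // t tw te; exact: he.
by move=> [e e0 he]; apply/near_cmod; exists e => // t te tw; exact: he.
Qed.

Lemma continuous_cmod g w : {for w, continuous g} <->
  forall e : R, 0 < e -> exists2 d : R, 0 < d &
    forall t, cmod (t - w) < d -> cmod (g t - g w) < e.
Proof.
split.
  move=> gw e e0.
  have /(cvgrPdist_lt _ _)/(_ e%:C) := gw.
  rewrite ltcR => /(_ e0)/near_cmod[d d0 hd]; exists d => // t /hd.
  by rewrite normE ltcR cmodC.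
move=> h; apply/(@cvgrPdist_lt _ _ _ (nbhs w)) => e e0.
have er : e = (Re e)%:C by rewrite RRe_real// gtr0_real.
have e0' : 0 < Re e by move: e0; rewrite er ltcR.
have [d d0 hd] := h _ e0'; apply/near_cmod; exists d => // t td.
by rewrite er normE ltcR cmodC hd.
Qed.

Lemma ccontM f g w : {for w, continuous f} -> {for w, continuous g} ->
  {for w, continuous (fun t => f t * g t)}.
Proof. by move=> h h'; exact: (@cvgM R[i] _ (nbhs w) _ f g _ _ h h'). Qed.

Lemma ccontV f w : {for w, continuous f} -> f w != 0 ->
  {for w, continuous (fun t => (f t)^-1)}.
Proof. by move=> h h'; exact: (@cvgV R[i] _ (nbhs w) _ f _ h' h). Qed.

Lemma ccontB f g w : {for w, continuous f} -> {for w, continuous g} ->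
  {for w, continuous (fun t => f t - g t)}.
Proof. by move=> h h'; exact: (@cvgB R[i] R[i] _ (nbhs w) _ f g _ _ h h'). Qed.

Lemma ccont_cst u w : {for w, continuous (fun _ : R[i] => u)}.
Proof.
by apply/continuous_cmod => e e0; exists 1 => // t _; rewrite subrr cmod0.
Qed.

Lemma ccont_id w : {for w, continuous (fun t : R[i] => t)}.
Proof. by apply/continuous_cmod => e e0; exists e. Qed.

Lemma ccontX f n w : {for w, continuous f} ->
  {for w, continuous (fun t => f t ^+ n)}.
Proof.
move=> h; elim: n => [|n IH]; first exact: ccont_cst.
have /continuous_cmod hS := ccontM h IH; apply/continuous_cmod => e e0.
by have [d d0 hd] := hS e e0; exists d => // t /hd; rewrite !exprS.
Qed.

Lemma ccont_shift u w : {for w, continuous (fun t : R[i] => t - u)}.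
Proof. exact: ccontB (@ccont_id w) (@ccont_cst u w). Qed.

Lemma cvgn_cmod (s : nat -> R[i]) u :
  (s @ \oo --> u) <-> (cmod (u - s M) @[M --> \oo] --> (0 : R)).
Proof.
split.
  move=> su; apply/cvgrPdist_lt => e e0.
  have /(cvgrPdist_lt _ _)/(_ e%:C) := su; rewrite ltcR => /(_ e0) [N _ hN].
  exists N => // M NM /=; have := hN _ NM; rewrite /= normE ltcR sub0r normrN.
  by rewrite ger0_norm ?cmod_ge0.
move=> /(cvgrPdist_lt _ _) h; apply/cvgrPdist_lt => e e0.
have er : e = (Re e)%:C by rewrite RRe_real// gtr0_real.
have e0' : 0 < Re e by move: e0; rewrite er ltcR.
have [N _ hN] := h _ e0'; exists N => // M NM /=; have := hN _ NM.
by rewrite /= sub0r normrN ger0_norm ?cmod_ge0// er normE ltcR.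
Qed.

Lemma continuous_punctured_eq f g w :
  {for w, continuous f} -> {for w, continuous g} ->
  (\forall t \near w^', f t = g t) -> f w = g w.
Proof.
move=> /continuous_cmod fw /continuous_cmod gw /near_punctured_cmod[d d0 hd].
apply/eqP; rewrite -subr_eq0 -cmod_eq0 eq_le cmod_ge0 andbT.
apply/ler_addgt0Pr => e e0; rewrite add0r.
have e20 : 0 < e / 2 by rewrite divr_gt0.
have [d1 d10 h1] := fw _ e20; have [d2 d20 h2] := gw _ e20.
pose x := Num.min d (Num.min d1 d2) / 2.
have x0 : 0 < x by rewrite divr_gt0// !lt_min d0 d10.
have hx : [/\ x < d, x < d1 & x < d2].
  have : x < Num.min d (Num.min d1 d2) by rewrite /x ltr_pdivrMr// ltr_pMr ?ltr1n// !lt_min d0 d10.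
  by rewrite !lt_min => /and3P[].
pose t := w + x%:C.
have tw : cmod (t - w) = x by rewrite /t addrAC subrr add0r cmod_real gtr0_norm.
have tnw : t != w by rewrite -subr_eq0 -cmod_eq0 tw gt_eqF.
have e1 : f t = g t by apply: hd => //; rewrite tw; case: hx.
have -> : f w - g w = (f w - f t) - (g w - g t) by rewrite -e1 opprB addrA subrK.
apply: le_trans (cmodB _ _) _; rewrite (cmodC (f w)) (cmodC (g w)).
have := h1 t; have := h2 t; rewrite tw; case: hx => _ hx1 hx2 /(_ hx2) a /(_ hx1) b.
lra.
Qed.

Lemma pser_continuous c : entire c -> continuous (@pser R c).
Proof.
move=> ec w; apply/continuous_cmod => e e0.
have r0 : 0 < cmod w + 1 by have := cmod_ge0 w; lra.
have [L L0 hL] := entire_lipschitz ec r0.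
exists (Num.min 1 (e / (L + 1))); first by rewrite lt_min ltr01 divr_gt0//; lra.
move=> t; rewrite lt_min => /andP[t1 te].
have tr : cmod t <= cmod w + 1.
  by rewrite -(subrK w t) addrC; apply: le_trans (cmodD _ _) _; lra.
apply: le_lt_trans (hL _ _ tr _) _; first by lra.
move: te; rewrite ltr_pdivlMr; last by lra.
by have := cmod_ge0 (t - w); nra.
Qed.

(** Only continuity is asked of the cofactor, so that quotients of functions
    can be handled without proving them analytic. *)
Definition order_at f w (m : nat) := exists g,
  [/\ {for w, continuous g}, g w != 0 & \forall t \near w, f t = (t - w) ^+ m * g t].

Lemma order_at0 f w : order_at f w 0 -> f w != 0.
Proof. by move=> [g [_ gw /nbhs_singleton ->]]; rewrite expr0 mul1r. Qed.

Lemma order_atS f w m : order_at f w m.+1 -> f w = 0.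
Proof. by move=> [g [_ gw /nbhs_singleton ->]]; rewrite subrr expr0n mul0r. Qed.

Lemma order_at_quot_same c w m : entire c -> w != 0 ->
  order_at (pser c) w m.+1 -> order_at (pser (quot_coef c w)) w m.
Proof.
move=> ec w0 ho; have cw := order_atS ho; case: ho => g [gc gw hg].
have ed := entire_quot ec w0 cw.
have hc : {for w, continuous (fun t => - w * g t)}.
  exact: ccontM (@ccont_cst _ w) gc.
exists (fun t => - w * g t); split => //; first by rewrite mulf_neq0// oppr_eq0.
have he t : t != w -> pser c t = (t - w) ^+ m.+1 * g t ->
    pser (quot_coef c w) t = (t - w) ^+ m * (- w * g t).
  move=> tw h; have tw0 : t - w != 0 by rewrite subr_eq0.
  have e : t - w = - w * (1 - t / w).
    by rewrite mulrBr mulr1 mulrCA mulNr divff// mulrN1 opprK addrC.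
  apply: (mulfI tw0); rewrite {1}e -mulrA -(pser_quot t ec w0 cw) h exprS.
  by rewrite mulrCA !mulrA.
have [d d0 hd] := (near_cmod _ _).1 hg.
apply/near_cmod; exists d => // t td.
have [->|tw] := eqVneq t w; last by apply: he => //; exact: hd.
apply: (@continuous_punctured_eq _ (fun t => (t - w) ^+ m * (- w * g t)) w).
- exact: pser_continuous.
- by apply: ccontM hc; apply: ccontX; exact: ccont_shift.
apply/near_punctured_cmod; exists d => // x xw xd.
by apply: he => //; exact: hd.
Qed.

Lemma order_at_quot_other c w w' m : entire c -> w != 0 -> pser c w = 0 ->
  w' != w -> order_at (pser c) w' m -> order_at (pser (quot_coef c w)) w' m.
Proof.
move=> ec w0 cw w'w [g [gc gw hg]].
have n0 : 1 - w' / w != 0.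
  by rewrite subr_eq0 eq_sym -(divff w0) (inj_eq (mulIf _))// invr_eq0.
exists (fun t => g t / (1 - t / w)); split.
- exact: (ccontM gc (ccontV (ccontB (@ccont_cst 1 w')
    (ccontM (@ccont_id w') (@ccont_cst w^-1 w'))) n0)).
- by rewrite mulf_neq0// invr_eq0.
have [d d0 hd] := (near_cmod _ _).1 hg.
have dw0 : 0 < cmod (w - w') by rewrite cmod_gt0 subr_eq0 eq_sym.
apply/near_cmod; exists (Num.min d (cmod (w - w'))); first by rewrite lt_min d0.
move=> t; rewrite lt_min => /andP[td tw].
have n1 : 1 - t / w != 0.
  rewrite subr_eq0 eq_sym -(divff w0) (inj_eq (mulIf _)) ?invr_eq0//.
  by apply: contraTneq tw => ->; rewrite ltxx.
by apply: (mulfI n1); rewrite -pser_quot// hd// mulrCA (mulrCA (1 - t / w)) divff// mulr1.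
Qed.

Fixpoint quot_list c (s : seq R[i]) : nat -> R[i] :=
  if s is w :: s' then quot_list (quot_coef c w) s' else c.

(** The linear coefficient grows by the inverse of each zero removed; this is
    the source of the exponential factor in the product formula. *)
Lemma quot_listP c (s : seq R[i]) (n : R[i] -> nat) :
  entire c -> all (fun w => w != 0) s -> c 0%N = 1 ->
  (forall w, count_mem w s <= n w)%N ->
  (forall w, order_at (pser c) w (n w)) ->
  [/\ entire (quot_list c s),
      forall t, pser c t = (\prod_(w <- s) (1 - t / w)) * pser (quot_list c s) t,
      quot_list c s 0%N = 1,
      quot_list c s 1%N = c 1%N + \sum_(w <- s) w^-1 &
      forall w, order_at (pser (quot_list c s)) w (n w - count_mem w s)].
Proof.
elim: s c n => [|w s IH] c n ec.
  by split => //= [t||w]; rewrite ?big_nil ?mul1r ?addr0 ?subn0.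
move=> /andP[w0 nz] c0 cn on.
have wn : (0 < n w)%N.
  by apply: leq_trans (cn w); rewrite /= eqxx.
have owS : order_at (pser c) w (n w).-1.+1 by rewrite prednK.
have cw : pser c w = 0 by exact: order_atS owS.
have ed := entire_quot ec w0 cw.
pose n' x := if x == w then (n w).-1 else n x.
have [|x|x|h1 h2 h3 h4 h5] := IH (quot_coef c w) n' ed nz.
- by rewrite quot_coef0.
- have := cn x; rewrite /= /n' eq_sym.
  by case: eqP => [->|_]; rewrite ?add0n// add1n => h; rewrite -ltnS prednK.
- rewrite /n'; case: eqP => [->|/eqP xw]; first exact: order_at_quot_same.
  exact: order_at_quot_other.
split => //=.
- by move=> t; rewrite big_cons (pser_quot t ec w0 cw) h2 mulrA.
- by rewrite h4 quot_coef1// c0 mul1r big_cons addrA.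
- move=> x; have := h5 x; rewrite /n' (eq_sym w).
  by have [->|xw] := eqVneq x w; rewrite ?add0n// add1n -subn1 -subnDA add1n.
Qed.

Lemma cvgnM (s s' : nat -> R[i]) (u v : R[i]) : s @ \oo --> u -> s' @ \oo --> v ->
  (fun N => s N * s' N) @ \oo --> u * v.
Proof. by move=> h h'; exact: (@cvgM R[i] _ \oo _ s s' _ _ h h'). Qed.

End ComplexTopology.

(** * Convergence of finite products of zeros *)

Section Hadamard.
Context {R : realType}.
Implicit Types (u v w t : R[i]).

Lemma cvgn_cexp (s : nat -> R[i]) u :
  s @ \oo --> u -> (fun N => cexp (s N)) @ \oo --> cexp u.
Proof.
move=> /cvgn_cmod su; apply/cvgn_cmod.
have su' : cmod (s N - u) @[N --> \oo] --> (0 : R) by under eq_fun do rewrite cmodC.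
have hb : cmod (cexp u) * (cmod (s N - u) * expR (cmod (s N - u))) @[N --> \oo] --> (0 : R).
  rewrite -[X in _ --> X](mulr0 (cmod (cexp u))); apply: cvgM; first exact: cvg_cst.
  rewrite -[X in _ --> X](mul0r (expR 0)); apply: cvgM => //.
  by apply: continuous_cvg => //; exact: continuous_expR.
apply: (squeeze_cvgr _ (cvg_cst 0) hb); near=> N; rewrite cmod_ge0/=.
have -> : cexp (s N) = cexp u * cexp (s N - u) by rewrite -cexpD addrC subrK.
rewrite cmodC -[X in _ - X]mulr1 -mulrBr cmodM ler_wpM2l ?cmod_ge0//.
have := cexp_taylor 1 (s N - u).
by rewrite /exp_sum big_nat1 expr0 expr1 !divr1.
Unshelve. all: by end_near.
Qed.

Variables (c : nat -> R[i]) (n : R[i] -> nat) (s : nat -> seq R[i]).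
Variables (B b a0 a1 : R).
Hypotheses (ec : entire c) (c0 : c 0%N = 1).
Hypothesis growth : forall t, cmod (pser c t) <= B * expR (b * cmod t).
Hypotheses (B1 : 1 <= B) (b0 : 0 <= b) (a00 : 0 < a0).
Hypothesis ord : forall w, order_at (pser c) w (n w).
Hypothesis scount : forall N w, (count_mem w (s N) <= n w)%N.
Hypothesis snz : forall N, all (fun w => w != 0) (s N).
Hypothesis sbig : forall N, all (fun w => cmod w <= a1 * N.+1%:R) (s N).
Hypothesis sout : forall N w, cmod w < a0 * N.+1%:R -> count_mem w (s N) = n w.

(** The quotient by the first zeros has no zero in a disc of radius
    proportional to [N], and keeps the exponential bound at distances from the
    origin at least twice those of the zeros removed, where each factor has
    modulus at least [1]. *)
Lemma hadamard_quot u :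
  pser (quot_list c (s N)) u * cexp (- (c 1%N + \sum_(w <- s N) w^-1) * u)
    @[N --> \oo] --> (1 : R[i]).
Proof.
(* With [rho = a0 * (N + 1) / 4], the zeros removed have modulus at most [a1 *
   (N + 1)], which is half of [8 * a1 / a0 * rho]; the others have modulus at
   least [4 * rho]. *)
pose kappa := Num.max 1 (8 * a1 / a0).
pose D := near_exp_const B b kappa * cmod u ^+ 2.
have hb : expR (D / (a0 * N.+1%:R / 4)) - 1 @[N --> \oo] --> (0 : R).
  rewrite -[X in _ --> X](subrr 1) -[X in _ --> X - _]expR0.
  apply: cvgB; last exact: cvg_cst.
  apply: continuous_cvg; first exact: continuous_expR.
  have -> : (fun N : nat => D / (a0 * N.+1%:R / 4)) = (fun N => (4 * D / a0) * N.+1%:R^-1).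
    apply/funext => N; rewrite !invfM invrK; ring.
  rewrite -[X in _ --> X](mulr0 (4 * D / a0)); apply: cvgM; first exact: cvg_cst.
  exact: cvg_harmonic.
have hN : forall x : R, \forall N \near \oo, x <= a0 * N.+1%:R / 4.
  move=> x; near=> M; rewrite ler_pdivlMr// -ler_pdivrMl//.
  apply: (@le_trans _ _ M%:R); last by rewrite ler_nat.
  by near: M; exact: nbhs_infty_ger.
apply/cvgn_cmod; apply: (squeeze_cvgr _ (cvg_cst 0) hb); near=> N.
rewrite cmod_ge0/= cmodC.
have [ed dE d0 d1 od] := quot_listP (s := s N) ec (snz N) c0 (scount N) ord.
have N0 : 0 < N.+1%:R :> R by rewrite ltr0n.
rewrite -d1 /D; apply: zero_free_near_exp => //.
- by rewrite le_max lexx.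
- by near: N; exact: hN.
- move=> t tr; apply: order_at0; have := od t.
  rewrite sout ?subnn//; apply: le_lt_trans tr _.
  by rewrite -subr_gt0; have := mulr_gt0 a00 N0; lra.
- move=> t tr; apply: le_trans (growth t); rewrite dE cmodM cmod_prod.
  rewrite ler_peMl ?cmod_ge0//.
  have t2 : 2 * (a1 * N.+1%:R) <= cmod t.
    apply: le_trans tr; apply: (@le_trans _ _ ((8 * a1 / a0) * (a0 * N.+1%:R / 4))).
      rewrite le_eqVlt; apply/orP; left; apply/eqP; field; exact: lt0r_neq0.
    by rewrite ler_wpM2r ?le_max ?lexx ?orbT// divr_ge0 ?mulr_ge0// ltW.
  have := sbig N; have := snz N; elim: (s N) => [|w l IH] /=; first by rewrite big_nil.
  move=> /andP[w0 l0] /andP[wa la]; rewrite big_cons.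
  rewrite -[leLHS]mul1r; apply: ler_pM => //; last exact: IH.
  apply: le_trans (_ : cmod (t / w) - cmod 1 <= _); last by rewrite cmodC cmod_dist.
  rewrite cmod1 cmodM cmodV lerBrDr ler_pdivlMr ?cmod_gt0//.
  by move: wa t2; lra.
- by near: N; exact: hN.
Unshelve. all: by end_near.
Qed.

Theorem hadamard_product (g u : R[i]) :
  (fun N => c 1%N + \sum_(w <- s N) w^-1) @ \oo --> g ->
  (fun N => \prod_(w <- s N) (1 - u / w)) @ \oo --> pser c u * cexp (- g * u).
Proof.
move=> hg.
pose gN N := c 1%N + \sum_(w <- s N) w^-1.
pose q N := pser (quot_list c (s N)) u.
have h1 : (fun N => q N * cexp (- gN N * u)) @ \oo --> (1 : R[i]) := hadamard_quot u.
have hn : \forall N \near \oo, cmod (1 - q N * cexp (- gN N * u)) < 1.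
  by have h1' := (cvgn_cmod _ _).1 h1; exact: (cvgr_lt _ h1' _ ltr01).
have h2 : (fun N => cexp (- gN N * u)) @ \oo --> cexp (- g * u).
  apply: cvgn_cexp; apply: (@cvgM R[i] _ _ _ (fun N => - gN N) (fun=> u) (- g) u).
    exact: (@cvgN R[i] R[i] _ _ _ gN g hg).
  exact: cvg_cst.
have h3 : (fun N => (q N * cexp (- gN N * u))^-1) @ \oo --> (1 : R[i])^-1.
  exact: (@cvgV R[i] _ _ _ _ _ (oner_neq0 _) h1).
have h4 := cvgnM h2 h3.
have h0 : (fun _ : nat => pser c u) @ \oo --> pser c u by exact: cvg_cst.
have h5 := cvgnM h0 h4.
rewrite invr1 mulr1 in h5.
apply: cvg_trans h5; apply: near_eq_cvg; near=> N.
have [ed dE d0 d1 od] := quot_listP (s := s N) ec (snz N) c0 (scount N) ord.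
rewrite /= dE -/(q N) invfM.
have nz : q N * cexp (- gN N * u) != 0.
  rewrite -cmod_gt0.
  have : cmod (1 - q N * cexp (- gN N * u)) < 1.
    by near: N; exact: hn.
  have := cmodD (1 - q N * cexp (- gN N * u)) (q N * cexp (- gN N * u)).
  by rewrite subrK cmod1; lra.
move: nz; rewrite mulf_eq0 negb_or => /andP[q0 e0].
by rewrite [cexp _ * _]mulrCA divff// mulr1 mulfK.
Unshelve. all: by end_near.
Qed.

End Hadamard.

(** * Products over zeros close to the imaginary axis *)

Section ZeroAsymptotics.
Context {R : realType}.
Variables (z : int -> R[i]) (alpha beta : R).
Hypothesis alpha0 : alpha < 0.
Hypothesis zneg : forall n, Re (z n) < 0.
Hypothesis zconj : forall n, z (- n) = (z n)^*.
Hypothesis zRe : (fun n : nat => Re (z n%:Z)) =o_\oo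
    (fun n : nat => Num.sqrt n%:R : R).
Hypothesis zIm : (fun n : nat => Im (z n%:Z)) =
    (fun n : nat => - 2 * pi * n%:R / alpha + beta) +o_\oo
    (fun _ : nat => 1 : R).

Lemma zero_neq0 n : z n != 0.
Proof. by have := zneg n; apply: contraTneq => ->; rewrite ltxx. Qed.

Lemma cmod_zeroN n : cmod (z (- n)) = cmod (z n).
Proof. by rewrite zconj cmod_conj. Qed.

(** The finitely many terms outside the tail only change the constants. *)
Lemma positive_bounds (s : nat -> R) (l h : R) (k0 : nat) : 0 < l ->
  (forall k, 0 < s k) -> (forall k, (k0 <= k)%N -> l <= s k <= h) ->
  exists2 l' : R, 0 < l' & exists h' : R, forall k, l' <= s k <= h'.
Proof.
elim: k0 l h => [|k0 IH] l h l0 s0 hs; first by exists l => //; exists h => k; exact: hs.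
apply: (IH (Num.min l (s k0)) (Num.max h (s k0))) => //.
  by rewrite lt_min l0 s0.
move=> k; rewrite leq_eqVlt => /orP[/eqP <-|/hs/andP[a b]].
  by rewrite ge_min le_max !lexx !orbT.
by rewrite ge_min le_max a b.
Qed.

Lemma zero_near : exists k0 : nat, forall k : nat, (k0 <= k)%N ->
  `|Re (z k%:Z)| <= Num.sqrt k%:R /\
  `|Im (z k%:Z) - (- 2 * pi * k%:R / alpha + beta)| <= 1.
Proof.
have [N1 _ h1] := (eqoP _ _ _).1 zRe 1 ltr01.
have [N2 _ h2] := (eqaddoP _ _ _ _).1 zIm 1 ltr01.
exists (maxn N1 N2) => k; rewrite geq_max => /andP[k1 k2]; split.
  have := h1 _ k1; rewrite /= mul1r => h; apply: le_trans h _.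
  by rewrite ger0_norm// sqrtr_ge0.
by have := h2 _ k2; rewrite /= mul1r normr1.
Qed.

Lemma sqrt_le_nat (k : nat) : Num.sqrt k%:R <= k%:R :> R.
Proof.
rewrite -(@ler_pXn2r _ 2)// ?nnegrE ?sqrtr_ge0// sqr_sqrtr// -natrX ler_nat.
by case: k => // k; rewrite expnS leq_pmulr// expn_gt0.
Qed.

Lemma zero_modulus : exists2 a0 : R, 0 < a0 & exists a1 : R, forall n : int,
  a0 * (absz n).+1%:R <= cmod (z n) <= a1 * (absz n).+1%:R.
Proof.
have [k0 hk] := zero_near.
pose c : R := - 2 * pi / alpha.
have c0 : 0 < c.
  by rewrite /c mulNr mulNr -mulrN -invrN divr_gt0 ?oppr_gt0// mulr_gt0// pi_gt0.
pose s (k : nat) := cmod (z k%:Z) / k.+1%:R.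
have k1 (k : nat) : 0 < k.+1%:R :> R by rewrite ltr0n.
have [N hN] : exists N : nat, 4 * (`|beta| + 1 + c) / c <= N%:R.
  have x0 : 0 <= 4 * (`|beta| + 1 + c) / c.
    by rewrite divr_ge0 ?(ltW c0)// mulr_ge0// addr_ge0 ?(ltW c0)// addr_ge0.
  by exists (Num.bound (4 * (`|beta| + 1 + c) / c)); apply/ltW; exact: archi_boundP.
have [|k|k|a0 a00 [a1 ha]] := @positive_bounds s (c / 4) (2 + c + `|beta|) (maxn k0 N).
- by rewrite divr_gt0.
- by rewrite divr_gt0// cmod_gt0 zero_neq0.
- rewrite geq_max => /andP[kk0 kN]; have [hr hi] := hk _ kk0.
  have kb : 4 * (`|beta| + 1 + c) <= c * k%:R.
    rewrite [leRHS]mulrC -ler_pdivrMr//; apply: le_trans hN _; by rewrite ler_nat.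
  have e : - 2 * pi * k%:R / alpha = c * k%:R by rewrite /c mulrAC.
  rewrite e in hi; rewrite /s ler_pdivlMr// ler_pdivrMr//.
  have h1 := Im_le_cmod (z k%:Z); have h2 := cmod_le_ReIm (z k%:Z).
  have h3 := sqrt_le_nat k.
  have h4 : `|c * k%:R + beta| <= c * k%:R + `|beta|.
    apply: le_trans (ler_normD _ _) _; rewrite lerD2r ger0_norm//.
    by rewrite mulr_ge0// ltW.
  have h5 : c * k%:R - `|beta| <= `|c * k%:R + beta|.
    apply: le_trans (ler_norm _); have := ler_norm (- beta); rewrite normrN; lra.
  have h6 : `|Im (z k%:Z)| <= `|c * k%:R + beta| + 1.
    by rewrite -lerBlDl; apply: le_trans hi; exact: lerB_dist.
  have h7 : `|c * k%:R + beta| - 1 <= `|Im (z k%:Z)|.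
    rewrite lerBlDl -lerBlDr; apply: le_trans hi; rewrite distrC; exact: lerB_dist.
  have kr0 : 0 <= k%:R :> R by rewrite ler0n.
  have b0 : 0 <= `|beta| by [].
  rewrite -(natr1 k); apply/andP; split; first by nra.
  have : 0 <= `|beta| * k%:R by rewrite mulr_ge0.
  by nra.
exists a0 => //; exists a1 => n.
have [k [->|->]] : exists k : nat, n = k%:Z \/ n = - k%:Z.
  by case: n => m; [exists m; left | exists m.+1; right; rewrite NegzE].
  by have := ha k; rewrite /s ler_pdivlMr// ler_pdivrMr.
by rewrite cmod_zeroN abszN; have := ha k; rewrite /s ler_pdivlMr// ler_pdivrMr.
Qed.

(** Gives the summability of [k ^ (- 3/2)] by a telescoping sum. *)
Lemma inv_sqrt_telescope (k : nat) : (0 < k)%N ->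
  Num.sqrt k%:R / k.+1%:R ^+ 2 <=
  2 * ((Num.sqrt k%:R)^-1 - (Num.sqrt k.+1%:R)^-1) :> R.
Proof.
move=> k0; set p : R := Num.sqrt k%:R; set q : R := Num.sqrt k.+1%:R.
have p0 : 0 < p by rewrite sqrtr_gt0 ltr0n.
have q0 : 0 < q by rewrite sqrtr_gt0 ltr0n.
have pp : p ^+ 2 = k%:R by rewrite sqr_sqrtr.
have qq : q ^+ 2 = k.+1%:R by rewrite sqr_sqrtr.
have pq : q ^+ 2 = p ^+ 2 + 1 by rewrite pp qq natr1.
rewrite -qq.
have d0 : 0 < p * q ^+ 4 by rewrite mulr_gt0 ?exprn_gt0.
rewrite [leLHS](_ : _ = p ^+ 2 / (p * q ^+ 4)); last first.
  by field; rewrite !lt0r_neq0.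
rewrite [leRHS](_ : _ = (2 * q ^+ 2 - 2 * p * q) * q ^+ 2 / (p * q ^+ 4)); last first.
  by field; rewrite !lt0r_neq0.
rewrite ler_pM2r ?invr_gt0//.
have h1 : 1 <= 2 * q ^+ 2 - 2 * p * q by have := sqr_ge0 (q - p); lra.
have := ler_wpM2r (sqr_ge0 q) h1; rewrite mul1r; apply: le_trans; rewrite pq; lra.
Qed.

(** The modulus of the real part of the inverse of a zero: it measures how far
    the direction of the zero is from the imaginary axis, relative to its
    size. *)
Definition zero_tilt (k : nat) : R := `|Re (z k%:Z)| / cmod (z k%:Z) ^+ 2.

Lemma zero_tilt_ge0 k : 0 <= zero_tilt k.
Proof. by rewrite divr_ge0// exprn_ge0// cmod_ge0. Qed.

(** [|Re z_k|] is at most [sqrt k] and [|z_k|] is of order [k]. *)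
Lemma zero_tilt_summable : cvgn (series zero_tilt).
Proof.
have [k0 hk] := zero_near; have [a0 a00 [a1 ha]] := zero_modulus.
pose k1 := maxn k0 1.
pose C := \sum_(0 <= k < k1) zero_tilt k + 2 / a0 ^+ 2.
apply: nondecreasing_is_cvgn; first by apply: nondecreasing_series => *; exact: zero_tilt_ge0.
exists C => _ [N _ <-]; rewrite /series/=.
have one k : (k1 <= k)%N -> zero_tilt k <=
    2 / a0 ^+ 2 * ((Num.sqrt k%:R)^-1 - (Num.sqrt k.+1%:R)^-1).
  rewrite geq_max => /andP[kk0 kk1]; have [hr _] := hk _ kk0.
  have /andP[hz _] := ha k%:Z; rewrite mulrAC mulrC.
  apply: le_trans (_ : Num.sqrt k%:R / k.+1%:R ^+ 2 / a0 ^+ 2 <= _); last first.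
    by rewrite [leLHS]mulrC ler_wpM2l ?invr_ge0 ?exprn_ge0 ?(ltW a00)// inv_sqrt_telescope.
  rewrite -mulrA -invfM; apply: ler_pM => //; first by rewrite invr_ge0 exprn_ge0 ?cmod_ge0.
  have az : 0 < a0 * k.+1%:R by rewrite mulr_gt0// ltr0n.
  rewrite lef_pV2 ?posrE ?mulr_gt0 ?exprn_gt0 ?ltr0n ?cmod_gt0 ?zero_neq0//.
  by rewrite mulrC -exprMn lerXn2r ?nnegrE ?cmod_ge0 ?(ltW az).
have C0 : 0 <= 2 / a0 ^+ 2 by rewrite divr_ge0// exprn_ge0// ltW.
have [Nk|kN] := leqP N k1.
  rewrite /C (@big_cat_nat _ _ _ N 0 k1)//= -addrA lerDl addr_ge0//.
  by rewrite sumr_ge0// => *; exact: zero_tilt_ge0.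
rewrite /C (@big_cat_nat _ _ _ k1 0 N)//= ?(ltnW kN)// lerD2l.
apply: (@le_trans _ _ (\sum_(k1 <= k < N) 2 / a0 ^+ 2 * ((Num.sqrt k%:R)^-1 - (Num.sqrt k.+1%:R)^-1))).
  by rewrite big_nat [leRHS]big_nat; apply: ler_sum => k /andP[k1k _]; exact: one.
rewrite -mulr_sumr -[leRHS]mulr1 ler_wpM2l//.
under eq_bigr do rewrite -opprB.
rewrite sumrN telescope_sumr ?(ltnW kN)// opprB.
apply: (@le_trans _ _ (Num.sqrt k1%:R)^-1); first by rewrite gerBl invr_ge0 sqrtr_ge0.
have k11 : 1 <= Num.sqrt k1%:R :> R by rewrite -[X in X <= _]sqrtr1 ler_wsqrtr// ler1n leq_maxr.
by rewrite invf_le1// (lt_le_trans ltr01 k11).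
Qed.

Definition zints (N : nat) : seq int :=
  [seq k%:Z | k <- iota 0 N.+1] ++ [seq - k%:Z | k <- iota 1 N].

Lemma mem_zints N k : (k \in zints N) = (absz k <= N)%N.
Proof.
rewrite mem_cat; apply/orP/idP => [[/mapP[m + ->]|/mapP[m + ->]]|kN].
- by rewrite mem_iota ltnS.
- by rewrite mem_iota abszN/= add1n ltnS => /andP[].
case: k kN => m mN; first by left; apply/mapP; exists m => //; rewrite mem_iota.
right; apply/mapP; exists m.+1; last by rewrite NegzE.
by rewrite mem_iota /= add1n ltnS.
Qed.

Lemma uniq_zints N : uniq (zints N).
Proof.
rewrite cat_uniq !map_inj_uniq ?iota_uniq// => [|a b /oppr_inj[]//|a b []//].
rewrite andbT; apply/hasPn => _ /mapP[m + ->]; rewrite mem_iota => /andP[m0 _].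
by apply/negP => /mapP[n _]; case: m m0.
Qed.

(** The factor of the zeros [z k] and [z (- k)], which are conjugate. *)
Definition pair_factor (k : nat) (u : R[i]) : R[i] :=
  1 - (2 * Re (z k%:Z))%:C * u / (z k%:Z * (z k%:Z)^*) +
    u ^+ 2 / (z k%:Z * (z k%:Z)^*).

Lemma pair_factorE k u :
  pair_factor k u = (1 - u / z k%:Z) * (1 - u / z (- k%:Z)).
Proof.
have z0 := zero_neq0 k%:Z; have z1 : (z k%:Z)^* != 0 by rewrite conjc_eq0.
have e : (2 * Re (z k%:Z))%:C = z k%:Z + (z k%:Z)^*.
  by rewrite addcJ rmorphM/= rmorph_nat.
have aux (F : fieldType) (x y v : F) : x != 0 -> y != 0 ->
    1 - (x + y) * v / (x * y) + v ^+ 2 / (x * y) = (1 - v / x) * (1 - v / y).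
  by move=> x0 y0; field; rewrite x0 y0.
by rewrite /pair_factor e zconj; exact: aux.
Qed.

Definition zero_prod (N : nat) (u : R[i]) :=
  \prod_(w <- map z (zints N)) (1 - u / w).

Lemma zero_prodE N u : zero_prod N u =
  (1 - u / z 0) * \prod_(1 <= k < N.+1) pair_factor k u.
Proof.
rewrite /zero_prod big_map big_cat !big_map /= big_cons -mulrA; congr (_ * _).
rewrite /index_iota subn1 -big_split; apply: eq_bigr => k _.
by rewrite pair_factorE.
Qed.

Lemma z0_real : z 0 = (Re (z 0))%:C.
Proof.
have := zconj 0; rewrite oppr0 => /(congr1 (@Im R)); rewrite Im_conj => h.
apply: complexP => //=; lra.
Qed.

Lemma sum_inv_zero N : \sum_(w <- map z (zints N)) w^-1 =
  ((Re (z 0))^-1 + \sum_(1 <= k < N.+1) - (2 * zero_tilt k))%:C.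
Proof.
rewrite big_map big_cat !big_map /= big_cons rmorphD/= -addrA; congr (_ + _).
  by rewrite {1}z0_real fmorphV.
rewrite /index_iota subn1 -big_split rmorph_sum/=; apply: eq_bigr => k _.
have z0 := zero_neq0 k%:Z; have z1 : (z k%:Z)^* != 0 by rewrite conjc_eq0.
have -> : (z k)^-1 + (z (- k%:Z))^-1 = (z k%:Z + (z k%:Z)^*) / (z k%:Z * (z k%:Z)^*).
  by rewrite zconj; move: (z k) (z k)^* z0 z1 => x y x0 y0; field; rewrite x0 y0.
rewrite addcJ mulC_conj -(rmorph_nat (real_complex R) 2) -rmorphM -fmorphV -rmorphM/=.
congr (_%:C); rewrite /zero_tilt ltr0_norm// mulNr mulrN opprK mulrA.
by [].
Qed.

(** The inverses of conjugate zeros add up to a real number, of modulus [2 *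
    zero_tilt k]. *)
Lemma sum_inv_zero_cvg : exists g : R,
  (\sum_(w <- map z (zints N)) w^-1) @[N --> \oo] --> g%:C.
Proof.
have [l hl] : exists l : R, series zero_tilt n @[n --> \oo] --> l.
  by apply/cvg_ex; exact: zero_tilt_summable.
exists ((Re (z 0))^-1 - 2 * (l - zero_tilt 0)).
apply/cvgn_cmod.
have h : (Re (z 0))^-1 - 2 * (series zero_tilt n.+1 - zero_tilt 0) @[n --> \oo] -->
    (Re (z 0))^-1 - 2 * (l - zero_tilt 0).
  apply: cvgB; first exact: cvg_cst.
  apply: cvgM; first exact: cvg_cst.
  apply: cvgB; last exact: cvg_cst.
  by rewrite (cvg_shiftS (series zero_tilt)).
have /cvgrPdist_lt h' := h.
apply/cvgrPdist_lt => e e0; have [N _ hN] := h' e e0; exists N => // M NM.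
have es : series zero_tilt M.+1 = zero_tilt 0 + \sum_(1 <= k < M.+1) zero_tilt k.
  by rewrite /series/= big_ltn.
have := hN M NM; rewrite es [zero_tilt 0 + _]addrC addrK.
rewrite sum_inv_zero -rmorphB cmod_real sub0r normrN normr_id.
by rewrite sumrN mulr_sumr.
Qed.

(** A zero in the left half-plane is closer to [- x] than to [x]. *)
Lemma factor_ratio_le (w : R[i]) (x : R) : Re w < 0 -> 0 <= x ->
  cmod (1 + x%:C / w) <= cmod (1 - x%:C / w).
Proof.
move=> w0 x0.
have wn : w != 0 by apply: contraTneq w0 => ->; rewrite ltxx.
have e v : 1 + v / w = (w + v) / w by rewrite mulrDl divff.
rewrite -mulNr !e !cmodM ler_wpM2r ?cmod_ge0//.
rewrite -(@ler_pXn2r _ 2)// ?nnegrE ?cmod_ge0// !cmod_sqr !ReD !ImD ReN ImN /=.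
nra.
Qed.

Lemma factor_ratio_ge (w : R[i]) (x C : R) : Re w < 0 -> 0 <= x -> 1 <= C ->
  (C + 1) * (2 * `|Re w| * x) <= (C - 1) * (cmod w ^+ 2 + x ^+ 2) ->
  cmod (1 - x%:C / w) ^+ 2 <= C * cmod (1 + x%:C / w) ^+ 2.
Proof.
move=> w0 x0 C1.
have wn : w != 0 by apply: contraTneq w0 => ->; rewrite ltxx.
have e v : 1 + v / w = (w + v) / w by rewrite mulrDl divff.
move=> h; rewrite -mulNr !e !cmodM !exprMn [leRHS]mulrA.
rewrite ler_wpM2r ?exprn_ge0 ?cmod_ge0//; move: h.
rewrite !cmod_sqr !ReD !ImD ReN ImN /= ltr0_norm//.
move: (Re w) (Im w) w0 => a b w0; nra.
Qed.

Lemma pair_factor_le k (x : R) : 0 <= x ->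
  cmod (pair_factor k (- x)%:C) <= cmod (pair_factor k x%:C).
Proof.
move=> x0; rewrite !pair_factorE !cmodM rmorphN !mulNr !opprK.
by apply: ler_pM; rewrite ?cmod_ge0// factor_ratio_le.
Qed.

Lemma cmod_pair_factor k (x : R) : cmod (pair_factor k x%:C) = cmod (1 - x%:C / z k%:Z) ^+ 2.
Proof.
have conjR : (x%:C : R[i])^* = x%:C.
  by apply: complexP; rewrite ?Re_conj ?Im_conj/= ?oppr0.
have e : 1 - x%:C / (z k%:Z)^* = (1 - x%:C / z k%:Z)^*.
  by rewrite rmorphB/= rmorph1 rmorphM/= fmorphV/= conjR.
by rewrite pair_factorE cmodM zconj e cmod_conj.
Qed.

(** For zeros of small tilt the ratio of the two moduli is [1 + O (tilt * x)]. *)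
Lemma pair_factor_exp k (x : R) : 0 <= x -> `|Re (z k%:Z)| <= cmod (z k%:Z) / 2 ->
  cmod (pair_factor k x%:C) <=
  expR (8 * zero_tilt k * x) * cmod (pair_factor k (- x)%:C).
Proof.
move=> x0 hk; rewrite !cmod_pair_factor rmorphN/= mulNr opprK.
have zp : 0 < cmod (z k%:Z) by rewrite cmod_gt0 zero_neq0.
have t0 : 0 <= 8 * zero_tilt k * x by rewrite mulr_ge0// mulr_ge0// zero_tilt_ge0.
have e0 : 1 <= expR (8 * zero_tilt k * x) by rewrite -[X in X <= _]expR0 ler_expR.
apply: factor_ratio_ge => //.
have := expR_ge1Dx (8 * zero_tilt k * x); set E := expR _ => hE.
have ez : `|Re (z k%:Z)| = zero_tilt k * cmod (z k%:Z) ^+ 2.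
  by rewrite /zero_tilt divfK// expf_neq0// lt0r_neq0.
move: hE hk; rewrite ez.
set t := zero_tilt k; set m := cmod (z k%:Z) => hE hk.
have t00 : 0 <= t by exact: zero_tilt_ge0.
have m0 : 0 < m by [].
have tm : t * m <= 2^-1.
  by rewrite -(ler_pM2r m0) -mulrA -expr2 (mulrC 2^-1).
have q1 : 2 * (t * m ^+ 2) * x <= (m ^+ 2 + x ^+ 2) / 2.
  have h1 : 2 * (t * m ^+ 2) * x = 2 * (t * m) * (m * x) by ring.
  have mx : 0 <= m * x by rewrite mulr_ge0// ltW.
  have h2 : 2 * (t * m) * (m * x) <= m * x by rewrite ler_piMl//; lra.
  rewrite h1; apply: le_trans h2 _; have := sqr_ge0 (m - x); lra.
have q0 : 0 <= t * x * x ^+ 2 by rewrite mulr_ge0 ?sqr_ge0// mulr_ge0.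
have q2 : 0 <= t * x by rewrite mulr_ge0.
have P0 : 0 <= m ^+ 2 + x ^+ 2 by rewrite addr_ge0 ?sqr_ge0.
move: q1; set q := 2 * (t * m ^+ 2) * x => q1.
have eq : q = 2 * (t * x) * m ^+ 2 by rewrite /q; ring.
move: P0 q1; set P := m ^+ 2 + x ^+ 2 => P0 q1.
have k1 : (1 + 8 * t * x) * (P - q) <= E * (P - q) by rewrite ler_wpM2r//; lra.
have k2 : t * x * P <= t * x * (2 * (P - q)) by rewrite ler_wpM2l//; lra.
have k3 : t * x * P = t * x * m ^+ 2 + t * x * x ^+ 2 by rewrite /P mulrDr.
lra.
Qed.

(** When [x] is much larger than the zero, the distances of the zero to [x]
    and to [- x] are comparable. *)
Lemma pair_factor_far k (x : R) : 0 < x -> 4 * cmod (z k%:Z) <= x ->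
  cmod (pair_factor k x%:C) <= 4 * cmod (pair_factor k (- x)%:C).
Proof.
move=> x0 hk; rewrite !cmod_pair_factor rmorphN/= mulNr opprK.
apply: factor_ratio_ge => //; [exact: ltW|by lra|].
have := Re_le_cmod (z k%:Z); have := cmod_ge0 (z k%:Z).
have : 0 <= `|Re (z k%:Z)| by []. 
move: (cmod _) (`|_|) hk => m a hk a0 m0 am; nra.
Qed.

(** The factors up to a fixed [K] cost a constant. The others cost the
    exponential of [8 x] times a tail of the convergent sum of the tilts, and
    [K] is chosen so that this tail is below [e / 8]. *)
Lemma zero_prod_ratio (e : R) : 0 < e -> exists C x0, forall x, x0 <= x ->
  \forall N \near \oo, cmod (zero_prod N x%:C) <=
     C * expR (e * x) * cmod (zero_prod N (- x)%:C).
Proof.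
move=> e0.
have [k0 hk] := zero_near; have [a0 a00 [a1 ha]] := zero_modulus.
have /cauchy_cvgP/cauchy_seriesP := zero_tilt_summable.
have e80 : 0 < e / 8 by rewrite divr_gt0.
move=> /(_ _ e80) [[A B] [[N1 _ hN1] [N2 _ hN2]] hAB].
have [k1 hk1] : exists k1 : nat, forall k, (k1 <= k)%N -> `|Re (z k%:Z)| <= cmod (z k%:Z) / 2.
  have [N hN] : exists N : nat, 4 / a0 ^+ 2 <= N%:R.
    exists (Num.bound (4 / a0 ^+ 2)); apply/ltW/archi_boundP.
    by rewrite divr_ge0// exprn_ge0// ltW.
  exists (maxn k0 N) => k; rewrite geq_max => /andP[kk0 kN].
  have [hr _] := hk _ kk0; have /andP[hz _] := ha k%:Z.
  apply: le_trans hr _; rewrite -(@ler_pXn2r _ 2)// ?nnegrE ?sqrtr_ge0 ?divr_ge0 ?cmod_ge0//.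
  rewrite sqr_sqrtr// expr_div_n.
  have h1 : (a0 * k.+1%:R) ^+ 2 <= cmod (z k%:Z) ^+ 2.
    by rewrite lerXn2r ?nnegrE ?cmod_ge0// mulr_ge0// ltW.
  have h2 : 4 <= a0 ^+ 2 * k%:R.
    by rewrite mulrC -ler_pdivrMr ?exprn_gt0//; apply: le_trans hN _; rewrite ler_nat.
  rewrite ler_pdivlMr ?exprn_gt0//; apply: le_trans h1; rewrite exprMn -(natr1 k).
  have kr0 : 0 <= k%:R :> R by rewrite ler0n.
  have a2 : 0 <= a0 ^+ 2 by exact: sqr_ge0.
  have h3 := ler_wpM2r kr0 h2.
  rewrite (_ : k%:R * 2 ^+ 2 = 4 * k%:R); last by ring.
  apply: (le_trans h3); rewrite -mulrA ler_wpM2l// -expr2 lerXn2r ?nnegrE ?lerDl//.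
pose K := maxn (maxn N1 N2) (maxn k1 1).
have a10 : 0 <= a1.
  have /andP[h1 h2] := ha 0; have := le_trans h1 h2; rewrite /= mulr1 mulr1.
  by apply: le_trans; exact: ltW.
exists (4 * 4 ^+ K), (4 * (a1 * K.+1%:R) + 1) => x hx.
have aK : 0 <= a1 * K.+1%:R by rewrite mulr_ge0.
have x0 : 0 < x by lra.
have zs k : (k <= K)%N -> 4 * cmod (z k%:Z) <= x.
  move=> kK; have /andP[_ h] := ha k%:Z.
  have : a1 * (absz k).+1%:R <= a1 * K.+1%:R by rewrite ler_wpM2l// ler_nat.
  by lra.
exists K => // N KN; rewrite !zero_prodE !cmodM !cmod_prod.
have h0 : cmod (1 - x%:C / z 0) <= 4 * cmod (1 - (- x)%:C / z 0).
  have := pair_factor_far (k := 0) x0 (zs _ (leq0n _)).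
  rewrite !cmod_pair_factor => h.
  rewrite -(@ler_pXn2r _ 2)// ?nnegrE ?mulr_ge0 ?cmod_ge0//.
  apply: le_trans h _; rewrite exprMn ler_wpM2r ?exprn_ge0 ?cmod_ge0//.
  by rewrite -natrX ler_nat.
have K1 : (1 <= K)%N by rewrite !leq_max leqnn !orbT.
have hs : \prod_(1 <= k < K) cmod (pair_factor k x%:C) <=
    4 ^+ K * \prod_(1 <= k < K) cmod (pair_factor k (- x)%:C).
  apply: (@le_trans _ _ (\prod_(1 <= k < K) (4 * cmod (pair_factor k (- x)%:C)))).
    rewrite big_nat [leRHS]big_nat; apply: ler_prod => k /andP[_ kK].
    by rewrite cmod_ge0 pair_factor_far// zs// ltnW.
  rewrite big_split/= prodr_const_nat ler_wpM2r ?prodr_ge0// => [k _|]; first exact: cmod_ge0.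
  by apply: ler_weXn2l; rewrite ?ler1n ?leq_subr.
have hl : \prod_(K <= k < N.+1) cmod (pair_factor k x%:C) <=
    expR (e * x) * \prod_(K <= k < N.+1) cmod (pair_factor k (- x)%:C).
  apply: (@le_trans _ _ (\prod_(K <= k < N.+1) (expR (8 * zero_tilt k * x) * cmod (pair_factor k (- x)%:C)))).
    rewrite big_nat [leRHS]big_nat; apply: ler_prod => k /andP[kK _].
    rewrite cmod_ge0 pair_factor_exp ?(ltW x0)// hk1//.
    by apply: leq_trans kK; rewrite !leq_max leqnn !orbT.
  rewrite big_split/= ler_wpM2r ?prodr_ge0// => [k _|]; first exact: cmod_ge0.
  have -> : \prod_(K <= k < N.+1) expR (8 * zero_tilt k * x) =
      expR (\sum_(K <= k < N.+1) 8 * zero_tilt k * x).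
    by apply/esym; apply: big_morph; [exact: expRD | exact: expR0].
  rewrite ler_expR -mulr_suml -mulr_sumr ler_wpM2r ?(ltW x0)//.
  have hab : (A `*` B) (K, N.+1).
    split => /=; [apply: hN1 => /=|apply: hN2 => /=].
      by rewrite !leq_max leqnn.
    by apply: leq_trans (leqW KN); rewrite !leq_max leqnn orbT.
  have := hAB _ hab; rewrite /= ger0_norm; last by rewrite sumr_ge0// => k _; exact: zero_tilt_ge0.
  by rewrite ltr_pdivlMr// mulrC => /ltW.
rewrite !(@big_cat_nat _ _ _ K 1 N.+1)//= ?leqW//.
have p0 m n : 0 <= \prod_(m <= k < n) cmod (pair_factor k x%:C).
  by rewrite prodr_ge0// => k _; exact: cmod_ge0.
have := ler_pM (cmod_ge0 _) (mulr_ge0 (p0 1%N K) (p0 K N.+1)) h0 (ler_pM (p0 _ _) (p0 _ _) hs hl).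
set y1 := cmod (1 - (- x)%:C / z 0); set y2 := \prod_(1 <= k < K) _; set y3 := \prod_(K <= k < N.+1) _.
by move=> h; apply: le_trans h _; rewrite le_eqVlt; apply/orP; left; apply/eqP; ring.
Qed.

End ZeroAsymptotics.

(** * The exponential factor of the canonical product *)

Section CanonicalProduct.
Context {R : realType}.
Variables (z : int -> R[i]) (alpha beta : R).
Hypothesis alpha0 : alpha < 0.
Hypothesis zneg : forall n, Re (z n) < 0.
Hypothesis zconj : forall n, z (- n) = (z n)^*.
Hypothesis zRe : (fun n : nat => Re (z n%:Z)) =o_\oo
    (fun n : nat => Num.sqrt n%:R : R).
Hypothesis zIm : (fun n : nat => Im (z n%:Z)) =
    (fun n : nat => - 2 * pi * n%:R / alpha + beta) +o_\oo
    (fun _ : nat => 1 : R).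
Variables (c : nat -> R[i]) (B b C1 : R).
Hypotheses (ec : entire c) (c0 : c 0%N = 1) (c1 : Im (c 1%N) = 0).
Hypotheses (B1 : 1 <= B) (b0 : 0 <= b).
Hypothesis growth : forall t, cmod (pser c t) <= B * expR (b * cmod t).
Hypothesis nz : forall w, 0 <= Re w -> pser c w != 0.
Hypothesis ord : forall w, Re w < 0 ->
  exists2 m, order_at (pser c) w m & ([set n | z n = w] #= `I_m)%card.
Hypothesis pos_axis : forall x : R, 0 <= x -> 1 <= cmod (pser c x%:C) <= C1.
Hypothesis neg_axis : forall e : R, 0 < e -> exists x0, forall x : R, x0 <= x ->
  expR ((- alpha - e) * x) <= cmod (pser c (- x)%:C) <= expR ((- alpha + e) * x).

(** The form in which orders are compared with multiplicities in lists. *)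
Lemma order_enum w : exists m, order_at (pser c) w m /\
  exists2 l : seq int, uniq l /\ size l = m & forall k, (k \in l) = (z k == w).
Proof.
have [w0|w0] := ltP (Re w) 0; last first.
  exists 0%N; split.
    exists (pser c); split; [exact: pser_continuous|exact: nz|].
    by apply/near_cmod; exists 1 => // t _; rewrite expr0 mul1r.
  exists [::] => // k; rewrite in_nil; apply/esym/negbTE/eqP => zk.
  by move: w0; rewrite -zk leNgt zneg.
have [m om cm] := ord w0; exists m; split => //.
have fs : finite_set [set n | z n = w] by apply/finite_setP; exists m.
exists (finmap.enum_fset (fset_set [set n | z n = w])).
  by split; [exact: finmap.fset_uniq | exact: card_fset_set].
move=> k; apply/idP/eqP => [|zk].
  by move=> h; have : k \in fset_set [set n | z n = w] by []; rewrite in_fset_set// inE.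
suff : k \in fset_set [set n | z n = w] by [].
by rewrite in_fset_set// inE.
Qed.

(** [hadamard_product] for the zeros enumerated by modulus of the index; the
    exponent is real because both [c 1] and the limit of the sums of inverse
    zeros are. *)
Lemma zero_prod_cvg : exists g : R, forall u,
  zero_prod z N u @[N --> \oo] --> pser c u * cexp (- g%:C * u).
Proof.
have [n hn] := choice order_enum.
have [a0 a00 [a1 ha]] := zero_modulus alpha0 zneg zconj zRe zIm.
have [g0 hg0] := sum_inv_zero_cvg alpha0 zneg zconj zRe zIm.
exists (Re (c 1%N) + g0) => u.
have hg : (fun N => c 1%N + \sum_(w <- map z (zints N)) w^-1) @ \oo --> (Re (c 1%N) + g0)%:C.
  have -> : (Re (c 1%N) + g0)%:C = c 1%N + g0%:C.
    by rewrite rmorphD/=; congr (_ + _); apply: complexP.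
  have h1 : (fun _ : nat => c 1%N) @ \oo --> c 1%N by exact: cvg_cst.
  exact: (@cvgD R[i] R[i] _ \oo _ _ _ _ _ h1 hg0).
have countE N w : count_mem w (map z (zints N)) = size [seq k <- zints N | z k == w].
  by rewrite count_map size_filter.
have a10 : 0 <= a1.
  have /andP[h1 h2] := ha 0; have := le_trans h1 h2; rewrite /= mulr1 mulr1.
  by apply: le_trans; exact: ltW.
apply: (hadamard_product (n := n) (B := B) (b := b) (a0 := a0) (a1 := a1)) => //.
- by move=> w; have [] := hn w.
- move=> N w; have [_ [l [ul <-] hl]] := hn w; rewrite countE.
  apply: uniq_leq_size; first by rewrite filter_uniq// uniq_zints.
  by move=> k; rewrite mem_filter hl => /andP[].
- move=> N; apply/allP => _ /mapP[k _ ->]; exact: zero_neq0.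
- move=> N; apply/allP => _ /mapP[k + ->]; rewrite mem_zints => kN.
  have /andP[_ h] := ha k; apply: le_trans h _.
  by rewrite ler_wpM2l// ler_nat.
move=> N w wN; have [_ [l [ul <-] hl]] := hn w; rewrite countE.
apply/eqP; rewrite eqn_leq; apply/andP; split.
  apply: uniq_leq_size; first by rewrite filter_uniq// uniq_zints.
  by move=> k; rewrite mem_filter hl => /andP[].
apply: uniq_leq_size => // k; rewrite mem_filter hl => /eqP zk; rewrite zk eqxx/= mem_zints.
rewrite -ltnS -(ltr_nat R) -(ltr_pM2l a00); apply: le_lt_trans wN; rewrite -zk.
apply: le_trans (_ : a0 * (absz k).+1%:R <= _); last by have /andP[] := ha k.
by rewrite ler_wpM2l ?(ltW a00)// ler_nat.
Qed.

Lemma expR_rate (A D C x0 : R) :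
  (forall x, x0 <= x -> expR (A * x) <= C * expR (D * x)) -> A <= D.
Proof.
move=> h; rewrite leNgt; apply/negP => DA.
pose x := Num.max x0 (Num.max 0 (C / (A - D))).
have hx := h x (_ : x0 <= x).
have x1 : x0 <= x by rewrite le_max lexx.
have x2 : 0 <= x by rewrite !le_max lexx orbT.
have x3 : C / (A - D) <= x by rewrite !le_max lexx !orbT.
have := hx x1; rewrite -ler_pdivrMr ?expR_gt0// -expRN -expRD -mulNr -mulrDl => h1.
have := le_trans (expR_ge1Dx _) h1.
move: x3; rewrite ler_pdivrMr ?subr_gt0//; lra.
Qed.

(** Let [f x = |pser c x|]. The moduli of the products converge to [f x * exp
    (- g x)]. On the positive axis the products dominate those at [- x]
    ([factor_ratio_le]), which gives [2 g <= alpha]; by [zero_prod_ratio] they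
    do so by at most [exp (e x)] for each [e > 0], which gives [alpha <= 2 g]. *)
Theorem canonical_product u :
  zero_prod z N u @[N --> \oo] --> pser c u * cexp (- alpha%:C * u / 2).
Proof.
have [g hg] := zero_prod_cvg.
suff -> : - alpha%:C * u / 2 = - g%:C * u by exact: hg.
suff -> : alpha = 2 * g.
  by rewrite rmorphM/= rmorph_nat; move: (g%:C) => y; field.
pose f x := cmod (pser c x%:C).

(* The moduli of the products on the real axis. *)
have lim x : cmod (zero_prod z N x%:C) @[N --> \oo] --> f x * expR (- g * x).
  have /cvgn_cmod h := hg x%:C.
  have -> : f x * expR (- g * x) = cmod (pser c x%:C * cexp (- g%:C * x%:C)).
    by rewrite cmodM cmod_cexp /f -rmorphN -rmorphM.
  apply/cvgrPdist_lt => e e0; have [N _ hN] := (cvgrPdist_lt _ _).1 h e e0.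
  exists N => // M NM; have := hN M NM; rewrite /= sub0r normrN ger0_norm ?cmod_ge0//.
  by apply: le_lt_trans; exact: cmod_dist_norm.
have a1 : 2 * g <= alpha.
  apply/ler_addgt0Pr => e e0.
  have [x0 hx] := neg_axis e0.
  suff : - alpha - e + g <= - g by lra.
  apply: (@expR_rate _ _ C1 (Num.max 0 x0)) => x; rewrite ge_max => /andP[x00 /hx /andP[h1 _]].
  have /andP[_ h2] := pos_axis x00.
  have h3 : f (- x) * expR (- g * - x) <= f x * expR (- g * x).
    apply: ler_cvg_to (lim (- x)) (lim x) _; apply: nearW => N.
    rewrite !zero_prodE// !cmodM !cmod_prod; apply: ler_pM; rewrite ?cmod_ge0 ?prodr_ge0//.
    - by move=> k _; exact: cmod_ge0.
    - by rewrite rmorphN/= mulNr opprK factor_ratio_le.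
    - by apply: ler_prod => k _; rewrite cmod_ge0 pair_factor_le.
  rewrite mulrDl expRD.
  apply: le_trans (_ : f (- x) * expR (- g * - x) <= _).
    by rewrite mulrNN ler_wpM2r ?expR_ge0.
  by apply: le_trans h3 _; rewrite ler_wpM2r ?expR_ge0.
have a2 : alpha <= 2 * g.
  apply/ler_addgt0Pr => e e0; have e20 : 0 < e / 2 by rewrite divr_gt0.
  have [x0 hx] := neg_axis e20.
  have [C [x1 hC]] := zero_prod_ratio alpha0 zneg zconj zRe zIm e20.
  suff : - g <= e / 2 + ((- alpha + e / 2) + g) by lra.
  apply: (@expR_rate _ _ `|C| (Num.max 0 (Num.max x0 x1))) => x.
  rewrite !ge_max => /and3P[x00 /hx /andP[_ h1] /hC hN].
  have /andP[h2 _] := pos_axis x00.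
  have h3 : f x * expR (- g * x) <= C * expR (e / 2 * x) * (f (- x) * expR (- g * - x)).
    apply: (ler_cvg_to (lim x) _ hN).
    by apply: cvgM; [exact: cvg_cst | exact: lim].
  apply: le_trans (_ : f x * expR (- g * x) <= _).
    by rewrite ler_peMl ?expR_ge0.
  apply: le_trans h3 _; rewrite (mulrDl (e / 2)) expRD.
  rewrite (mulrDl (- alpha + e / 2)) expRD mulrNN -mulrA.
  have p0 : 0 <= expR (e / 2 * x) * (f (- x) * expR (g * x)).
    exact: (mulr_ge0 (expR_ge0 _) (mulr_ge0 (cmod_ge0 _) (expR_ge0 _))).
  apply: le_trans (ler_wpM2r p0 (ler_norm C)) _.
  exact: (ler_wpM2l (normr_ge0 C) (ler_wpM2l (expR_ge0 _) (ler_wpM2r (expR_ge0 _) h1))).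
by apply/eqP; rewrite eq_le a1 a2.
Qed.

End CanonicalProduct.

(** * Analytic functions *)

Section LocalTheory.
Context {R : realType}.
Implicit Types (f g h : R[i] -> R[i]) (w t : R[i]) (a b : nat -> R[i]) (r K : R).

(** The form in which power series are manipulated: a real radius and an
    explicit bound for the coefficients. The bound holds because the terms of
    a series that converges tend to zero. *)
Lemma analytic_atP f w : analytic_at f w <->
  exists a r K, [/\ 0 < r, forall n, cmod (a n) * r ^+ n <= K &
    forall t, cmod (t - w) <= r / 2 -> f t = pser a (t - w)].
Proof.
split; last first.
  move=> [a [r [K [r0 aK hf]]]]; exists a, (r / 2)%:C; split.
    by rewrite ltcR divr_gt0.
  move=> t; rewrite normE ltcR => /ltW tr; rewrite hf//.
  exact/cvgn_cmod/(pser_cvg r0 aK tr).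
move=> [a [rho [rho0 hf]]].
have er : rho = (Re rho)%:C by rewrite RRe_real// gtr0_real.
have re0 : 0 < Re rho by move: rho0; rewrite er ltcR.
pose r := Re rho / 2; have r0 : 0 < r by rewrite divr_gt0.
have [K aK] : exists K, forall n, cmod (a n) * r ^+ n <= K.
  have hw : `|w + r%:C - w| < rho.
    by rewrite addrAC subrr add0r er normE ltcR cmod_real gtr0_norm// /r; lra.
  have /cvgn_cmod h := hf _ hw; rewrite addrAC subrr add0r in h.
  set s := series _ in h.
  have [M0 _ hM0] := (cvgr_lt _ h) _ ltr01.
  have term n : (M0 <= n)%N -> cmod (a n) * r ^+ n <= 2.
    move=> M0n; have e : a n * r%:C ^+ n = (f (w + r%:C) - s n) - (f (w + r%:C) - s n.+1).
      by rewrite opprB [RHS]addrC subrKA /s /series/= big_nat_recr//= addrAC subrr add0r.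
    have -> : cmod (a n) * r ^+ n = cmod (a n * r%:C ^+ n).
      by rewrite cmodM cmodX cmod_real gtr0_norm.
    rewrite e; apply: le_trans (cmodB _ _) _.
    have := hM0 _ M0n; have := hM0 _ (leqW M0n) => /=; lra.
  exists (2 + \sum_(0 <= n < M0) cmod (a n) * r ^+ n) => n.
  have p0 k : 0 <= cmod (a k) * r ^+ k by rewrite mulr_ge0 ?cmod_ge0 ?exprn_ge0 ?ltW.
  have [/term h1|nM] := leqP M0 n.
    by apply: le_trans h1 _; rewrite lerDl sumr_ge0.
  rewrite (bigD1_seq n)/= ?mem_index_iota ?iota_uniq// addrCA lerDl.
  by rewrite addr_ge0// sumr_ge0.
exists a, r, K; split => // t tr.
apply: (pser_unique r0 aK tr); apply/cvgn_cmod; apply: hf.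
by rewrite er normE ltcR; apply: le_lt_trans tr _; rewrite /r; lra.
Qed.

Lemma analytic_continuous f w : analytic_at f w -> {for w, continuous f}.
Proof.
move=> /analytic_atP[a [r [K [r0 aK hf]]]]; apply/continuous_cmod => e e0.
have K0 : 0 <= K by apply: le_trans (aK 0%N); rewrite mulr_ge0 ?cmod_ge0.
pose L := 8 * K / r; have L0 : 0 <= L by rewrite divr_ge0 ?(ltW r0)// mulr_ge0.
have L10 : 0 < L + 1 by lra.
exists (Num.min (r / 4) (e / (L + 1))); first by rewrite lt_min !divr_gt0.
move=> t; rewrite lt_min => /andP[t1 t2].
have w0 : cmod (w - w) <= r / 4 by rewrite subrr cmod0; lra.
rewrite !hf; [|by rewrite subrr cmod0; lra|by lra].
apply: le_lt_trans (pser_lipschitz r0 aK (ltW t1) w0) _.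
have -> : t - w - (w - w) = t - w by rewrite subrr subr0.
move: t2; rewrite -/L ltr_pdivlMr// => t2; have := cmod_ge0 (t - w); nra.
Qed.

Lemma analytic_near f g w : analytic_at f w -> (\forall t \near w, g t = f t) ->
  analytic_at g w.
Proof.
move=> [a [rho [rho0 hf]]] /near_cmod[d d0 hd].
have er : rho = (Re rho)%:C by rewrite RRe_real// gtr0_real.
have re0 : 0 < Re rho by move: rho0; rewrite er ltcR.
exists a, (Num.min (Re rho) d)%:C; split; first by rewrite ltcR lt_min re0.
move=> t; rewrite normE ltcR lt_min => /andP[t1 t2]; rewrite hd//.
by apply: hf; rewrite er normE ltcR.
Qed.

Lemma analyticB f g w : analytic_at f w -> analytic_at g w ->
  analytic_at (fun t => f t - g t) w.
Proof.
move=> /analytic_atP[a [r [K [r0 aK hf]]]] /analytic_atP[b [s [L [s0 bL hg]]]].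
pose m := Num.min r s; have m0 : 0 < m by rewrite lt_min r0.
have mr : m <= r by rewrite ge_min lexx.
have ms : m <= s by rewrite ge_min lexx orbT.
apply/analytic_atP; exists (fun n => a n - b n), m, (K + L).
have ab n : cmod (a n - b n) * m ^+ n <= K + L.
  apply: le_trans (_ : (cmod (a n) + cmod (b n)) * m ^+ n <= _).
    by rewrite ler_wpM2r ?exprn_ge0 ?(ltW m0)// cmodB.
  rewrite mulrDl; apply: lerD.
    by apply: le_trans (aK n); rewrite ler_wpM2l ?cmod_ge0// lerXn2r ?nnegrE ?(ltW m0) ?(ltW r0).
  by apply: le_trans (bL n); rewrite ler_wpM2l ?cmod_ge0// lerXn2r ?nnegrE ?(ltW m0) ?(ltW s0).
split => // t tm; rewrite hf ?hg; [|by lra|by lra].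
apply: (pser_unique m0 ab tm).
have ta : cmod (t - w) <= r / 2 by lra.
have tb : cmod (t - w) <= s / 2 by lra.
have h : cmod (pser a (t - w) - psum a M (t - w)) +
    cmod (pser b (t - w) - psum b M (t - w)) @[M --> \oo] --> (0 : R).
  by rewrite -[X in _ --> X]addr0; apply: cvgD; [exact: pser_cvg aK ta | exact: pser_cvg bL tb].
apply: (squeeze_cvgr _ (cvg_cst 0) h); near=> M; rewrite cmod_ge0/=.
have -> : psum (fun n => a n - b n) M (t - w) = psum a M (t - w) - psum b M (t - w).
  by rewrite /psum -sumrB; apply: eq_bigr => i _; rewrite mulrBl.
by rewrite subrACA cmodB.
Unshelve. all: by end_near.
Qed.

Lemma analyticXM f w m : analytic_at f w -> analytic_at (fun t => (t - w) ^+ m * f t) w.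
Proof.
move=> [a [rho [rho0 hf]]]; exists (fun n => if (n < m)%N then 0 else a (n - m)%N), rho.
split; first exact: rho0.
move=> t tr.
have h0 : (fun _ : nat => (t - w) ^+ m) @ \oo --> (t - w) ^+ m by exact: cvg_cst.
have h := cvgnM h0 (hf t tr).
rewrite -(cvg_shiftn m).
apply: cvg_trans h; apply: near_eq_cvg; apply: nearW => n /=.
rewrite /series/= (@big_cat_nat _ _ _ m 0 (n + m))//= ?leq_addl//.
have -> : \sum_(0 <= i < m) (if (i < m)%N then 0 else a (i - m)%N) * (t - w) ^+ i = 0.
  by rewrite big_nat big1// => i /andP[_ im]; rewrite im mul0r.
rewrite add0r -{2}(add0n m) big_addn addnK mulr_sumr; apply: eq_bigr => i _.
by rewrite ltnNge leq_addl/= addnK exprD [LHS]mulrC mulrA.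
Qed.

(** The first nonzero coefficient decides. *)
Lemma analytic_zeros f w : analytic_at f w ->
  (\forall t \near w, f t = 0) \/
  exists m g, [/\ analytic_at g w, g w != 0 &
    \forall t \near w, f t = (t - w) ^+ m * g t].
Proof.
move=> /analytic_atP[a [r [K [r0 aK hf]]]].
have [a0|/existsNP[m0 am0]] := pselect (forall n, a n = 0).
  left; apply/near_cmod; exists (r / 2); first by rewrite divr_gt0.
  move=> t /ltW tr; rewrite hf//; apply/esym; apply: (pser_unique r0 aK tr).
  apply/cvgn_cmod; rewrite (_ : (fun M => psum a M (t - w)) = fun=> 0); first exact: cvg_cst.
  by apply/funext => M; rewrite /psum big1// => i _; rewrite a0 mul0r.
right; have ex : exists n, a n != 0 by exists m0; apply/eqP.
have [m am mmin] := ex_minnP ex.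
pose b n := a (n + m)%N.
have bK n : cmod (b n) * r ^+ n <= K / r ^+ m.
  by rewrite ler_pdivlMr ?exprn_gt0// -mulrA -exprD; exact: aK.
exists m, (fun t => pser b (t - w)); split.
- by apply/analytic_atP; exists b, r, (K / r ^+ m).
- by rewrite subrr (pser0 r0 bK).
apply/near_cmod; exists (r / 2); first by rewrite divr_gt0.
move=> t /ltW tr; rewrite hf//; apply/esym; apply: (pser_unique r0 aK tr).
apply/cvgn_cmod; rewrite -(cvg_shiftn m).
have /cvgn_cmod h := pser_cvg r0 bK tr.
have h0 : (fun _ : nat => (t - w) ^+ m) @ \oo --> (t - w) ^+ m by exact: cvg_cst.
have h' := cvgnM h0 h.
apply: cvg_trans h'; apply: near_eq_cvg; apply: nearW => n /=.
rewrite /psum (@big_cat_nat _ _ _ m 0 (n + m))//= ?leq_addl//.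
have -> : \sum_(0 <= i < m) a i * (t - w) ^+ i = 0.
  rewrite big_nat big1// => i /andP[_ im].
  by have [->|/mmin] := eqVneq (a i) 0; [rewrite mul0r | rewrite leqNgt im].
rewrite add0r -{2}(add0n m) big_addn addnK mulr_sumr; apply: eq_bigr => i _.
by rewrite exprD [LHS]mulrC mulrA.
Qed.

(** The equations are triangular in the unknown coefficients. *)
Lemma reciprocal_coefs a : a 0%N != 0 -> exists b, forall n,
  \sum_(0 <= i < n.+1) a i * b (n - i)%N = (n == 0%N)%:R.
Proof.
move=> a0.
pose step (l : seq R[i]) : R[i] :=
  - (a 0%N)^-1 * \sum_(0 <= i < size l) a i.+1 * nth 0 l (size l - i.+1)%N.
pose bs := fix bs n := if n is m.+1 then rcons (bs m) (step (bs m)) else [:: (a 0%N)^-1].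
have sz n : size (bs n) = n.+1 by elim: n => //= n IH; rewrite size_rcons IH.
pose b n := nth 0 (bs n) n.
have bsE n k : (k <= n)%N -> nth 0 (bs n) k = b k.
  elim: n k => [|n IH] k; first by rewrite leqn0 => /eqP ->.
  rewrite leq_eqVlt => /orP[/eqP ->//|]; rewrite ltnS => kn.
  by rewrite /= nth_rcons sz ltnS kn IH.
exists b => -[|n].
  by rewrite big_nat1 subn0 /b/= divff.
have bS : b n.+1 = - (a 0%N)^-1 * \sum_(0 <= i < n.+1) a i.+1 * b (n - i)%N.
  rewrite /b /= nth_rcons sz ltnn eqxx /step sz; congr (_ * _).
  by apply: eq_big_nat => i _; rewrite subSS bsE// leq_subr.
rewrite big_nat_recl// subn0 bS mulNr mulrN mulrA divff// mul1r.
rewrite [X in _ + X](eq_bigr (fun i => a i.+1 * b (n - i)%N)) => [|i _]; last by rewrite subSS.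
by rewrite addNr.
Qed.

Lemma reciprocal_coefs_bound a b r K : 0 < r -> a 0%N != 0 ->
  (forall n, cmod (a n) * r ^+ n <= K) ->
  (forall n, \sum_(0 <= i < n.+1) a i * b (n - i)%N = (n == 0%N)%:R) ->
  exists2 M : R, 0 < M & forall n, cmod (b n) <= (cmod (a 0%N))^-1 * M ^+ n.
Proof.
move=> r0 a0 aK ab.
have K0 : 0 <= K by apply: le_trans (aK 0%N); rewrite mulr_ge0 ?cmod_ge0.
have c0 : 0 < cmod (a 0%N) by rewrite cmod_gt0.
set c := cmod (a 0%N) in c0 *.
pose D := 1 + K / c; have D1 : 1 <= D by rewrite /D lerDl divr_ge0// ltW.
have D0 : 0 < D by exact: lt_le_trans D1.
pose M := 2 * D / r; have M0 : 0 < M by rewrite divr_gt0// mulr_gt0.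
exists M => // n; elim/ltn_ind: n => n IH.
have bn : a 0%N * b n = (n == 0%N)%:R - \sum_(0 <= i < n) a i.+1 * b (n - i.+1)%N.
  by have := ab n; rewrite big_nat_recl// subn0 => <-; rewrite addrK.
rewrite -(ler_pM2l c0) mulrA divff ?lt0r_neq0// mul1r -cmodM bn.
case: n IH {bn} => [|n] IH; first by rewrite big_geq// subr0 cmod1 expr0.
rewrite sub0r cmodN; apply: le_trans (cmod_sum _ _ _) _.
apply: (@le_trans _ _ (\sum_(0 <= i < n.+1) K / c / (2 * D) * M ^+ n.+1 * 2^-1 ^+ i)).
  rewrite big_nat [leRHS]big_nat; apply: ler_sum => i /andP[_ iN].
  have h1 : cmod (a i.+1) <= K / r ^+ i.+1 by rewrite ler_pdivlMr ?exprn_gt0.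
  have h2 := IH (n - i)%N (leq_ltn_trans (leq_subr _ _) (ltnSn _)).
  rewrite subSS cmodM; apply: le_trans (ler_pM (cmod_ge0 _) (cmod_ge0 _) h1 h2) _.
  have -> : M ^+ n.+1 = M ^+ (n - i) * ((2 * D) ^+ i.+1 / r ^+ i.+1).
    by rewrite -expr_div_n -exprD addnS subnK.
  have -> : (2 * D) ^+ i.+1 = 2 ^+ i * D ^+ i * (2 * D) by rewrite exprSr exprMn.
  rewrite [leLHS](_ : _ = K / c * M ^+ (n - i) / r ^+ i.+1 * 1); last first.
    by rewrite mulr1; ring.
  rewrite [leRHS](_ : _ = K / c * M ^+ (n - i) / r ^+ i.+1 * D ^+ i); last first.
    rewrite exprVn; field; rewrite ?expf_neq0 ?lt0r_neq0//.
  rewrite ler_wpM2l ?exprn_ege1// divr_ge0 ?exprn_ge0 ?(ltW r0)//.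
  by rewrite mulr_ge0 ?exprn_ge0 ?(ltW M0)// divr_ge0// ltW.
rewrite -mulr_sumr; set x := K / c / (2 * D) * M ^+ n.+1.
have x0 : 0 <= x.
  by rewrite mulr_ge0 ?exprn_ge0 ?(ltW M0)// divr_ge0 ?(ltW D0)// ?divr_ge0 ?(ltW c0)// mulr_ge0 ?(ltW D0).
apply: le_trans (ler_wpM2l x0 (geo_half_le _)) _.
rewrite /x mulrAC ler_piMl ?exprn_ge0 ?(ltW M0)//.
rewrite mulrAC ler_pdivrMr ?mulr_gt0// mul1r [leRHS]mulrC ler_wpM2r//.
by rewrite /D lerDr.
Qed.

(** One of two indices with sum at least [N] is large; a ratio of at most
    [1/4] leaves room for the summation over the other one. *)
Lemma triangle_tail a b (q K L : R) N t : 0 <= q -> q <= 4^-1 ->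
  (forall n, cmod (a n * t ^+ n) <= K * q ^+ n) ->
  (forall n, cmod (b n * t ^+ n) <= L * q ^+ n) ->
  cmod (\sum_(0 <= i < N) a i * t ^+ i * \sum_(N - i <= j < N) b j * t ^+ j) <=
  2 * K * L / 2 ^+ N.
Proof.
move=> q0 q4 ha hb.
have K0 : 0 <= K by have := le_trans (cmod_ge0 _) (ha 0%N); rewrite expr0 mulr1.
have L0 : 0 <= L by have := le_trans (cmod_ge0 _) (hb 0%N); rewrite expr0 mulr1.
have inner m n : (m <= n)%N -> cmod (\sum_(m <= j < n) b j * t ^+ j) <= 2 * L * q ^+ m.
  move=> mn; apply: le_trans (cmod_sum _ _ _) _.
  have -> : n = (m + (n - m))%N by rewrite subnKC.
  move: (n - m)%N => k; elim: k m {mn} => [|k IH] m.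
    by rewrite addn0 big_geq// !mulr_ge0 ?exprn_ge0.
  rewrite big_ltn; last by rewrite -addSnnS leq_addr.
  rewrite -addSnnS; apply: (le_trans (lerD (hb m) (IH m.+1))).
  rewrite exprS; have : 0 <= L * q ^+ m by rewrite mulr_ge0 ?exprn_ge0.
  by nra.
apply: le_trans (cmod_sum _ _ _) _.
apply: (@le_trans _ _ (\sum_(0 <= i < N) 2 * K * L * q ^+ N)).
  rewrite big_nat [leRHS]big_nat; apply: ler_sum => i /andP[_ iN].
  rewrite cmodM; have h2 := inner (N - i)%N N (leq_subr _ _).
  apply: le_trans (ler_pM (cmod_ge0 _) (cmod_ge0 _) (ha i) h2) _.
  rewrite -[in leRHS](subnKC (ltnW iN)) exprD.
  by rewrite le_eqVlt; apply/orP; left; apply/eqP; ring.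
rewrite sumr_const_nat subn0 -[leLHS]mulr_natr -[leLHS]mulrA ler_wpM2l ?mulr_ge0//.
apply: (@le_trans _ _ (4^-1 ^+ N * N%:R)).
  by rewrite ler_wpM2r// lerXn2r ?nnegrE// (le_trans q0).
rewrite exprVn mulrC ler_pdivrMr ?exprn_gt0//.
have -> : (4 : R) ^+ N = 2 ^+ N * 2 ^+ N by rewrite -exprMn -natrM.
by rewrite mulrA mulVf ?expf_neq0// mul1r -natrX ler_nat ltnW// ltn_expl.
Qed.

(** The formal reciprocal of the power series has coefficients of geometric
    growth, hence converges, and Cauchy products are multiplicative. *)
Lemma analyticV f w : analytic_at f w -> f w != 0 -> analytic_at (fun t => (f t)^-1) w.
Proof.
move=> /analytic_atP[a [r [K [r0 aK hf]]]] fw.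
have fw0 : f w = a 0%N.
  by rewrite hf ?subrr ?(pser0 r0 aK)// cmod0 divr_ge0// ltW.
have a0 : a 0%N != 0 by rewrite -fw0.
have [b ab] := reciprocal_coefs a0.
have [M M0 bM] := reciprocal_coefs_bound r0 a0 aK ab.
pose s : R := Num.min r (M^-1) / 4.
have s0 : 0 < s by rewrite divr_gt0// lt_min r0 invr_gt0.
have sr : 4 * s <= r by rewrite mulrC divfK// ge_min lexx.
have sM : 4 * s <= M^-1 by rewrite mulrC divfK// ge_min lexx orbT.
have bK4 n : cmod (b n) * (4 * s) ^+ n <= (cmod (a 0%N))^-1.
  apply: (@le_trans _ _ ((cmod (a 0%N))^-1 * M ^+ n * (4 * s) ^+ n)).
    by rewrite ler_wpM2r// exprn_ge0// mulr_ge0// ltW.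
  rewrite -mulrA -exprMn ler_piMr ?invr_ge0 ?cmod_ge0// exprn_ile1//.
    exact: (mulr_ge0 (ltW M0) (mulr_ge0 (ler0n _ 4) (ltW s0))).
  by rewrite -ler_pdivlMl// mulr1.
have bK n : cmod (b n) * (2 * s) ^+ n <= (cmod (a 0%N))^-1.
  apply: le_trans (bK4 n); rewrite ler_wpM2l ?cmod_ge0// lerXn2r ?nnegrE//; lra.
have s20 : 0 < 2 * s by rewrite mulr_gt0.
apply/analytic_atP; exists b, (2 * s), (cmod (a 0%N))^-1; split => // t ts.
have ts' : cmod (t - w) <= s by lra.
have tr : cmod (t - w) <= r / 2 by lra.
have h1 := pser_cvg r0 aK tr; have h2 := pser_cvg s20 bK ts.
rewrite hf//; set A := pser a (t - w); set B := pser b (t - w).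
suff AB : A * B = 1.
  have A0 : A != 0 by apply: contra_eq_neq AB => ->; rewrite mul0r eq_sym oner_eq0.
  by apply: (mulfI A0); rewrite divff.
apply: (@cmod_limit_unique _ (fun N => psum a N (t - w) * psum b N (t - w))).
  by apply/cvgn_cmod; apply: cvgnM; apply/cvgn_cmod.
pose C := 2 * K * (cmod (a 0%N))^-1.
have hb : C / 2 ^+ N @[N --> \oo] --> (0 : R) by exact: geo_half_cvg.
apply: (squeeze_cvgr _ (cvg_cst 0) hb); near=> N; rewrite cmod_ge0/= cmodC.
have N0 : (0 < N)%N by near: N; exact: nbhs_infty_gt.
have -> : psum a N (t - w) * psum b N (t - w) - 1 =
  \sum_(0 <= i < N) a i * (t - w) ^+ i * \sum_(N - i <= j < N) b j * (t - w) ^+ j.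
  rewrite -cauchy_product_tail; congr (_ - _).
  rewrite (eq_bigr (fun n => (n == 0%N)%:R * (t - w) ^+ n)) => [|n _]; last first.
    rewrite -ab mulr_suml; apply: eq_big_nat => i /andP[_ iN].
    by rewrite mulrACA -exprD subnKC.
  rewrite big_ltn// eqxx expr0 mulr1 big_nat big1 ?addr0// => i /andP[i0 _].
  by rewrite gtn_eqF// mul0r.
have q0 : 0 <= 4^-1 :> R by [].
apply: (triangle_tail N q0 (lexx _)) => n.
  apply: le_trans (cmod_coef_le n (t - w) r0 aK) _.
  have K0 : 0 <= K by apply: le_trans (aK 0%N); rewrite mulr_ge0 ?cmod_ge0.
  rewrite ler_wpM2l// lerXn2r ?nnegrE ?divr_ge0 ?cmod_ge0 ?(ltW r0)//.
  by rewrite ler_pdivrMr//; lra.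
have s40 : 0 < 4 * s by rewrite mulr_gt0.
apply: le_trans (cmod_coef_le n (t - w) s40 bK4) _.
rewrite ler_wpM2l ?invr_ge0 ?cmod_ge0// lerXn2r ?nnegrE ?divr_ge0 ?cmod_ge0 ?(ltW s40)//.
by rewrite ler_pdivrMr//; lra.
Unshelve. all: by end_near.
Qed.

End LocalTheory.

(** * Meromorphic reciprocals of entire functions *)

Section Meromorphic.
Context {R : realType}.
Implicit Types (psi L : R[i] -> R[i]) (w t : R[i]).

Lemma inverse_eq_aux (F : fieldType) (x y u v : F) : u != 0 -> v != 0 ->
  (x / u * (y * v) == 1) = (y * x - u / v == 0).
Proof.
move=> u0 v0; have uv : (u / v)^-1 != 0 by rewrite invr_eq0 mulf_neq0// invr_eq0.
rewrite subr_eq0 -[RHS](inj_eq (mulIf uv)) divff; last by rewrite -invr_eq0.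
by congr (_ == 1); field; rewrite u0 v0.
Qed.

(** After multiplication by the denominators, [psi * L - 1] becomes an
    analytic function, which vanishes identically or has isolated zeros. *)
Lemma inverse_dichotomy psi L w : analytic_at psi w \/ pole psi w ->
  analytic_at L w -> ~ (\forall t \near w, L t = 0) ->
  (\forall t \near w^', psi t * L t = 1) \/
  (\forall t \near w^', psi t * L t != 1).
Proof.
move=> psiw Lw Lnz.
have [k [h [hw hpsi]]] : exists k h, analytic_at h w /\
    \forall t \near w^', psi t = h t / (t - w) ^+ k.
  case: psiw => [pw|[k [h [_ hw _ he]]]]; last by exists k, h.
  exists 0%N, psi; split => //; apply/near_punctured_cmod; exists 1 => // t _ _.
  by rewrite expr0 divr1.
have [//|[m [l [lw l0 hl]]]] := analytic_zeros Lw.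
pose D t := (t - w) ^+ m * h t - (t - w) ^+ k * (l t)^-1.
have Dw : analytic_at D w.
  apply: analyticB; first exact: analyticXM.
  by apply: analyticXM; exact: analyticV.
have /continuous_cmod lc := analytic_continuous lw.
have lp : 0 < cmod (l w) by rewrite cmod_gt0.
have [d0 d00 hd0] := lc _ lp.
have [d1 d10 hd1] := (near_punctured_cmod _ _).1 hpsi.
have [d2 d20 hd2] := (near_cmod _ _).1 hl.
pose d := Num.min d0 (Num.min d1 d2).
have dp : 0 < d by rewrite !lt_min d00 d10.
have key t : t != w -> cmod (t - w) < d -> (psi t * L t == 1) = (D t == 0).
  move=> tw; rewrite !lt_min => /and3P[t0 t1 t2].
  have tw0 : t - w != 0 by rewrite subr_eq0.
  have lt0 : l t != 0.
    apply/eqP => lt; have := hd0 _ t0; rewrite lt sub0r cmodN ltxx//.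
  have kn : (t - w) ^+ k != 0 by rewrite expf_neq0.
  by rewrite hd1// hd2//; exact: inverse_eq_aux.
clearbody d; have [D0|[j [g [gw g0 hg]]]] := analytic_zeros Dw.
  left; have [d3 d30 hd3] := (near_cmod _ _).1 D0.
  apply/near_punctured_cmod; exists (Num.min d d3); first by rewrite lt_min dp.
  move=> t tw; rewrite lt_min => /andP[td t3]; apply/eqP.
  by rewrite key// hd3.
right; have [d3 d30 hd3] := (near_cmod _ _).1 hg.
have /continuous_cmod gc := analytic_continuous gw.
have gp : 0 < cmod (g w) by rewrite cmod_gt0.
have [d4 d40 hd4] := gc _ gp.
apply/near_punctured_cmod; exists (Num.min d (Num.min d3 d4)).
  by rewrite !lt_min dp d30.
move=> t tw; rewrite !lt_min => /and3P[td t3 t4].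
have tw0 : t - w != 0 by rewrite subr_eq0.
rewrite key// hd3// mulf_neq0 ?expf_neq0//; apply/eqP => gt.
by have := hd4 _ t4; rewrite gt sub0r cmodN ltxx.
Qed.

(** Walk from [w] to the right along a horizontal line. The identity holds
    once the right half-plane is reached; at the supremum of the points where
    it fails around the point, [inverse_dichotomy] is contradicted. *)
Lemma inverse_continuation psi L : meromorphic psi ->
  (forall w, analytic_at L w) -> (forall w, ~ (\forall t \near w, L t = 0)) ->
  (forall w, 0 < Re w -> psi w * L w = 1) ->
  forall w, L w != 0 -> psi w = (L w)^-1.
Proof.
move=> mpsi aL Lnz Lpos w Lw.
pose Q v := \forall t \near v^', psi t * L t = 1.
have Qpos v : 0 < Re v -> Q v.
  move=> v0; apply/near_punctured_cmod; exists (Re v) => // t _ tv; apply: Lpos.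
  have := Re_le_cmod (t - v); rewrite ReD ReN ler_norml => /andP[h _]; lra.
(* At each point the identity holds all around or nowhere around. *)
have dich v : Q v \/ \forall t \near v^', psi t * L t != 1.
  exact: inverse_dichotomy.
have Qw : Q w.
  apply: contrapT => nQ.
  pose E := [set s : R | 0 <= s /\ ~ Q (w + s%:C)].
  have w00 : w + 0%:C = w by rewrite rmorph0 addr0.
  have E0 : E 0 by split; [exact: lexx | rewrite w00].
  have Eub : ubound E (`|Re w| + 1).
    move=> s [s0 nQs]; rewrite leNgt; apply/negP => hs; apply: nQs; apply: Qpos.
    rewrite ReD /=; have := ler_norm (- Re w); rewrite normrN; lra.
  have hsE : has_sup E by split; [exists 0|exists (`|Re w| + 1)].
  pose s := sup E.
  have sE x : E x -> x <= s by move=> Ex; apply: ub_le_sup => //; case: hsE.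
  have s0 : 0 <= s by exact: sE.
  have far (x : R) : s < x -> Q (w + x%:C).
    move=> sx; apply: contrapT => nQx.
    have : E x by split => //; apply: le_trans s0 _; exact: ltW.
    by move=> /sE; rewrite leNgt sx.
  have dist (x : R) : cmod (w + x%:C - (w + s%:C)) = `|x - s|.
    by rewrite opprD addrACA subrr add0r -rmorphB cmod_real.
  (* If the identity holds around the supremum, it holds around the nearby
     points of [E]; if it fails around the supremum, it fails at nearby points
     to its right. *)
  case: (dich (w + s%:C)) => /near_punctured_cmod[d d0 hd].

    have [x Ex sx] := sup_adherent d0 hsE.
    have xs := sE _ Ex; case: Ex => x0 nQx; apply: nQx.
    have xd : `|x - s| < d by rewrite distrC ger0_norm ?subr_ge0// -/s in sx *; lra.
    have [->|xns] := eqVneq x s; first by apply/near_punctured_cmod; exists d.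
    have xs0 : 0 < `|x - s| by rewrite normr_gt0 subr_eq0.
    apply/near_punctured_cmod; exists (Num.min `|x - s| (d - `|x - s|)).
      by rewrite lt_min xs0 subr_gt0.
    move=> t _; rewrite lt_min => /andP[t1 t2]; apply: hd.
      by apply: contraTneq t1 => ->; rewrite -leNgt cmodC dist.
    rewrite -(subrKA (w + x%:C)); apply: le_lt_trans (cmodD _ _) _.
    by rewrite dist; lra.
  have sx : s < s + d / 2 by rewrite ltrDl divr_gt0.
  have /near_punctured_cmod[e e0 he] := far _ sx.
  pose y := s + d / 2 + Num.min e (d / 2) / 2.
  have m0 : 0 < Num.min e (d / 2) by rewrite lt_min e0 divr_gt0.
  have me : Num.min e (d / 2) <= e by rewrite ge_min lexx.
  have md : Num.min e (d / 2) <= d / 2 by rewrite ge_min lexx orbT.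
  have yn (x : R) : x < y -> w + y%:C != w + x%:C.
    by move=> xy; rewrite (inj_eq (addrI _)) (inj_eq (@complexI R)) gt_eqF.
  have h1 : psi (w + y%:C) * L (w + y%:C) = 1.
    apply: he; first by apply: yn; rewrite /y ltrDl divr_gt0.
    rewrite opprD addrACA subrr add0r -rmorphB cmod_real /y addrAC subrr add0r.
    by rewrite gtr0_norm ?divr_gt0//; lra.
  have h2 : psi (w + y%:C) * L (w + y%:C) != 1.
    apply: hd; first by apply: yn; rewrite /y; lra.
    by rewrite dist /y gtr0_norm; lra.
  by move: h2; rewrite h1 eqxx.
have Lc := analytic_continuous (aL w).
have Vc := ccontV Lc Lw.
have /continuous_cmod Lc' := Lc.
have Lp : 0 < cmod (L w) by rewrite cmod_gt0.
have [d0 d00 hd0] := Lc' _ Lp.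
have [d1 d10 hd1] := (near_punctured_cmod _ _).1 Qw.
have inv t : t != w -> cmod (t - w) < d0 -> cmod (t - w) < d1 -> psi t = (L t)^-1.
  move=> tw t0 t1; have Lt : L t != 0.
    by apply/eqP => lt; have := hd0 _ t0; rewrite lt sub0r cmodN ltxx.
  by apply: (mulIf Lt); rewrite hd1// mulVf.
case: (mpsi w) => [pw|[k [g [k0 gw g0 hg]]]].
  apply: (continuous_punctured_eq (analytic_continuous pw) Vc).
  apply/near_punctured_cmod; exists (Num.min d0 d1); first by rewrite lt_min d00.
  by move=> t tw; rewrite lt_min => /andP[t0 t1]; exact: inv.
exfalso; move: g0; apply/negP; rewrite negbK; apply/eqP.
have [d2 d20 hd2] := (near_punctured_cmod _ _).1 hg.
have -> : g w = (w - w) ^+ k * (L w)^-1.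
  have hc : {for w, continuous (fun t => (t - w) ^+ k * (L t)^-1)}.
    by apply: ccontM Vc; apply: ccontX; exact: ccont_shift.
  apply: (@continuous_punctured_eq _ g (fun t => (t - w) ^+ k * (L t)^-1) w
    (analytic_continuous gw) hc).
  apply/near_punctured_cmod; exists (Num.min d0 (Num.min d1 d2)).
    by rewrite !lt_min d00 d10.
  move=> t tw; rewrite !lt_min => /and3P[t0 t1 t2].
  have tw0 : t - w != 0 by rewrite subr_eq0.
  by rewrite -(inv t)// hd2// mulrC divfK// expf_neq0.
by rewrite subrr expr0n gtn_eqF// mul0r.
Qed.

(** A zero of finite order of [L] is a pole of the reciprocal. *)
Lemma meromorphicV L : (forall w, analytic_at L w) ->
  (forall w, ~ (\forall t \near w, L t = 0)) -> meromorphic (fun t => (L t)^-1).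
Proof.
move=> aL Lnz w; have [/Lnz[]|[m [g [gw g0 hg]]]] := analytic_zeros (aL w).
have gV := analyticV gw g0.
case: m hg => [|m] hg.
  left; apply: analytic_near gV _; have [d d0 hd] := (near_cmod _ _).1 hg.
  by apply/near_cmod; exists d => // t /hd ->; rewrite expr0 mul1r.
right; exists m.+1, (fun t => (g t)^-1); split => //; first by rewrite invr_eq0.
have [d d0 hd] := (near_cmod _ _).1 hg.
by apply/near_punctured_cmod; exists d => // t _ /hd ->; rewrite invfM mulrC.
Qed.

End Meromorphic.

(** * Expectations of real random variables *)

Section Expectation.
Context d (T : measurableType d) (R : realType) (P : probability T R).
Implicit Types (h g : T -> R).

Definition mean h : R := Rintegral P setT h.

Definition finite_mean h := P.-integrable setT (EFin \o h).

Lemma finite_mean_dom h g : measurable_fun setT h -> (forall t, `|h t| <= g t) ->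
  finite_mean g -> finite_mean h.
Proof.
move=> mh hg ig; apply: (le_integrable measurableT _ _ ig).
  exact/measurable_EFinP.
move=> t _ /=; rewrite lee_fin; apply: (le_trans (hg t)); exact: ler_norm.
Qed.

Lemma finite_mean_cst (M : R) : finite_mean (fun=> M).
Proof. exact: finite_measure_integrable_cst. Qed.

Lemma finite_mean_bnd h (M : R) : measurable_fun setT h -> (forall t, `|h t| <= M) ->
  finite_mean h.
Proof. by move=> mh hM; exact: finite_mean_dom mh hM (finite_mean_cst M). Qed.

Lemma mean_cst (M : R) : mean (fun=> M) = M.
Proof.
rewrite /mean (Rintegral_cst P measurableT M).
have -> : fine (P setT) = 1 by rewrite -[RHS]/(fine 1%E); congr fine; exact: (probability_setT P).
by rewrite mulr1.
Qed.

Lemma meanD h g : finite_mean h -> finite_mean g -> mean (fun t => h t + g t) = mean h + mean g.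
Proof. by move=> ih ig; rewrite /mean RintegralD. Qed.

Lemma meanB h g : finite_mean h -> finite_mean g -> mean (fun t => h t - g t) = mean h - mean g.
Proof. by move=> ih ig; rewrite /mean RintegralB. Qed.

Lemma meanZ h (a : R) : finite_mean h -> mean (fun t => a * h t) = a * mean h.
Proof. by move=> ih; rewrite /mean RintegralZl. Qed.

Lemma finite_meanZ h (a : R) : finite_mean h -> finite_mean (fun t => a * h t).
Proof. by move=> ih; exact: (integrableZl measurableT a ih). Qed.

Lemma finite_meanD h g : finite_mean h -> finite_mean g -> finite_mean (fun t => h t + g t).
Proof. by move=> ih ig; exact: (integrableD measurableT ih ig). Qed.

Lemma finite_meanB h g : finite_mean h -> finite_mean g -> finite_mean (fun t => h t - g t).
Proof. by move=> ih ig; exact: (integrableB measurableT ih ig). Qed.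

Lemma mean_le h g : finite_mean h -> finite_mean g -> (forall t, h t <= g t) -> mean h <= mean g.
Proof. by move=> ih ig hg; apply: le_Rintegral. Qed.

Lemma mean_ge0 h : (forall t, 0 <= h t) -> 0 <= mean h.
Proof. by move=> h0; apply: Rintegral_ge0. Qed.

Lemma mean_norm h g : finite_mean h -> finite_mean g -> (forall t, `|h t| <= g t) ->
  `|mean h| <= mean g.
Proof.
move=> ih ig hg; apply: (le_trans (le_normr_Rintegral measurableT ih)).
apply: mean_le => //; apply: finite_mean_dom ig => //.
  by apply: measurableT_comp => //; apply/measurable_EFinP; case/integrableP: ih.
by move=> t; rewrite normr_id.
Qed.

Lemma mean_bnd h (M : R) : measurable_fun setT h -> (forall t, `|h t| <= M) ->
  `|mean h| <= M.
Proof.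
by move=> mh hM; rewrite -(mean_cst M); apply: mean_norm => //; [exact: finite_mean_bnd hM|exact: finite_mean_cst].
Qed.

Lemma EFin_mean h : finite_mean h -> (mean h)%:E = (\int[P]_t (h t)%:E)%E.
Proof. by move=> ih; rewrite /mean /Rintegral fineK // integrable_fin_num. Qed.

End Expectation.

(** * Expectations of functions of independent variables *)

Section Independence.
Context d (T : measurableType d) (R : realType) (P : probability T R).
Implicit Types (X Y : T -> R).
Local Notation E := (mean P).

Lemma measurable_section (h : R * R -> R) : measurable_fun setT h ->
  forall y : R, measurable_fun setT (fun x => h (x, y)).
Proof. by move=> mh y; exact: (measurableT_comp mh (measurable_pair2 y)). Qed.

Lemma independent_rvC X Y : independent_rv P X Y -> independent_rv P Y X.
Proof. by move=> XY A B mA mB; rewrite setIC XY // muleC. Qed.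

(** The joint law of independent variables is the product of their laws. The
    domination by a function of [Y] alone covers bounded functions as well as
    exponentials of [Y - X] with [X >= 0]. *)
Lemma independent_fubini X Y (h : R * R -> R) (G : R -> R) :
  measurable_fun setT X -> measurable_fun setT Y -> measurable_fun setT h ->
  measurable_fun setT G -> independent_rv P X Y -> finite_mean P (G \o Y) ->
  (forall x y, `|h (x, y)| <= G y) ->
  E (fun t => h (X t, Y t)) = E (fun t => E (fun t' => h (X t', Y t))).
Proof.
move=> mX mY mh mG XY iG hG.
pose Xm : {mfun T >-> R} := HB.pack X (isMeasurableFun.Build _ _ _ _ X mX).
pose Ym : {mfun T >-> R} := HB.pack Y (isMeasurableFun.Build _ _ _ _ Y mY).
have mXY : measurable_fun setT (fun t => (X t, Y t)) by exact: measurable_fun_pair.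
pose Z : {mfun T >-> (R * R)%type} :=
  HB.pack (fun t => (X t, Y t)) (isMeasurableFun.Build _ _ _ _ _ mXY).
have law : forall A : set (R * R), measurable A ->
    (distribution P Xm \x distribution P Ym)%E A = distribution P Z A.
  by apply: product_measure_unique => A B mA mB; exact: XY.
have iY y : finite_mean P (fun t => h (X t, y)).
  apply: (@finite_mean_bnd _ _ _ _ _ (G y)) => //.
  exact: (measurableT_comp (measurable_section mh y) mX).
have iXY : finite_mean P (fun t => h (X t, Y t)).
  apply: (finite_mean_dom _ _ iG) => [|t /=]; last exact: hG.
  exact: (measurableT_comp mh mXY).
have mh' : measurable_fun setT (EFin \o h) by exact/measurable_EFinP.
have mGE : measurable_fun setT (EFin \o G) by exact/measurable_EFinP.
have iP : (distribution P Xm \x distribution P Ym)%E.-integrable setT (EFin \o h).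
  apply/integrable21ltyP => //.
  apply: (@le_lt_trans _ _ (\int[distribution P Ym]_y `|(EFin \o G) y|)%E).
    apply: ge0_le_integral => //.
    - by move=> y _; exact: integral_ge0.
    - apply: (@measurable_fun_fubini_tonelli_G _ _ _ _ _ (distribution P Xm) (abse \o (EFin \o h))) => //=.
      exact: measurableT_comp.
    - by apply: measurableT_comp.
    - move=> y _.
      apply: (@le_trans _ _ (\int[distribution P Xm]_x (`|G y|)%:E)%E).
        apply: ge0_le_integral => //=.
        + by apply/measurable_EFinP; apply: measurableT_comp => //; exact: measurable_section.
        + move=> x _; rewrite lee_fin; apply: (le_trans (hG x y)); exact: ler_norm.
      rewrite integral_cst //.
      have hP : distribution P Xm [set: R] = 1%E := probability_setT (distribution P Xm).
      by rewrite [X in (_ * X)%E]hP mule1.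
  rewrite ge0_integral_distribution //; last by apply: measurableT_comp.
  by case/integrableP: iG.
rewrite {1}/mean /Rintegral -[in LHS](integral_distribution (X := Z) (f := EFin \o h)) //.
rewrite -(eq_measure_integral (distribution P Z) (m1 := (distribution P Xm \x distribution P Ym)%E)); last first.
  by move=> A mA _; exact: law.
have GE : fubini_G (distribution P Xm) (EFin \o h) =
    (fun y => (E (fun t => h (X t, y)))%:E).
  apply/funext => y; rewrite EFin_mean; last exact: iY.
  rewrite /fubini_G (integral_distribution (X := Xm) (f := fun x => (EFin \o h) (x, y))) //; last first.
    exact: iY.
  apply/measurable_EFinP; exact: measurable_section.
have mGY : measurable_fun setT (fun y => E (fun t => h (X t, y))).
  have := measurable_fubini_G iP; rewrite GE => hm.
  by apply: (measurable_EFinP _ _).1; exact: hm.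
rewrite -integral21_prod_meas1 // GE.
rewrite (integral_distribution (X := Ym) (f := fun y => (E (fun t => h (X t, y)))%:E)) //.
  exact/measurable_EFinP.
apply: (finite_mean_dom _ _ iG); first exact: measurableT_comp mGY mY.
move=> t /=; apply: mean_bnd => // t'.
exact: (measurableT_comp (measurable_section mh (Y t)) mX).
Qed.
End Independence.

(** * Bounded measurable functions *)

Section BoundedMeasurable.
Context d (T : measurableType d) (R : realType) (P : probability T R).
Implicit Types (f g : R -> R) (X : T -> R).
Local Notation E := (mean P).

Definition bounded_mf f := measurable_fun setT f /\ exists M : R, forall x, `|f x| <= M.

Lemma bounded_mf_cst (c : R) : bounded_mf (fun=> c).
Proof. by split; [exact: measurable_cst|exists `|c| => x]. Qed.

Lemma bounded_mfD f g : bounded_mf f -> bounded_mf g -> bounded_mf (fun x => f x + g x).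
Proof.
move=> [mf [M hM]] [mg [N hN]]; split; first exact: measurable_funD.
exists (M + N) => x; apply: (le_trans (ler_normD _ _)); exact: lerD.
Qed.

Lemma bounded_mfM f g : bounded_mf f -> bounded_mf g -> bounded_mf (fun x => f x * g x).
Proof.
move=> [mf [M hM]] [mg [N hN]]; split; first exact: measurable_funM.
by exists (M * N) => x; rewrite normrM ler_pM.
Qed.

Lemma bounded_mfN f : bounded_mf f -> bounded_mf (fun x => - f x).
Proof.
move=> [mf [M hM]]; split; first exact: measurableT_comp.
by exists M => x; rewrite normrN.
Qed.

Lemma bounded_mfB f g : bounded_mf f -> bounded_mf g -> bounded_mf (fun x => f x - g x).
Proof. by move=> hf hg; apply: bounded_mfD => //; exact: bounded_mfN. Qed.

Lemma bounded_mfZ (c : R) f : bounded_mf f -> bounded_mf (fun x => c * f x).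
Proof. by move=> hf; apply: bounded_mfM => //; exact: bounded_mf_cst. Qed.

Lemma bounded_mf_comp f (g : R -> R) : bounded_mf f -> measurable_fun setT g -> bounded_mf (f \o g).
Proof.
move=> [mf [M hM]] mg; split; first exact: measurableT_comp.
by exists M => x; exact: hM.
Qed.

Lemma bounded_mf_shift f (s : R) : bounded_mf f -> bounded_mf (fun x => f (s + x)).
Proof.
by move=> hf; apply: (@bounded_mf_comp f (fun x => s + x)) => //; exact: measurable_funD.
Qed.

Lemma bounded_mf_finite_mean f X : bounded_mf f -> measurable_fun setT X ->
  finite_mean P (fun t => f (X t)).
Proof.
move=> [mf [M hM]] mX; apply: (@finite_mean_bnd _ _ _ _ _ M) => //.
exact: measurableT_comp mf mX.
Qed.

(** Adding the constant [M] makes the integrand nonnegative. *)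
Lemma measurable_mean X (h : R * R -> R) (M : R) : measurable_fun setT X ->
  measurable_fun setT h -> (forall z, `|h z| <= M) ->
  measurable_fun setT (fun y => E (fun t => h (X t, y))).
Proof.
move=> mX mh hM.
have mXh : measurable_fun setT (fun z : T * R => h (X z.1, z.2) + M).
  apply: measurable_funD => //.
  apply: (measurableT_comp mh); apply: measurable_fun_pair => //.
  exact: (measurableT_comp mX).
have mhX y : measurable_fun setT (fun t => h (X t, y)).
  exact: (measurableT_comp (measurable_section mh y) mX).
have hE y : E (fun t => h (X t, y)) = E (fun t => h (X t, y) + M) - M.
  rewrite meanD; [|exact: finite_mean_bnd|exact: finite_mean_cst].
  by rewrite mean_cst addrK.
have -> : (fun y => E (fun t => h (X t, y))) = (fun y => E (fun t => h (X t, y) + M) - M).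
  by apply/funext => y; exact: hE.
apply: measurable_funB => //; apply: (measurable_EFinP _ _).1.
have -> : EFin \o (fun y => E (fun t => h (X t, y) + M)) =
    fubini_G P (EFin \o (fun z : T * R => h (X z.1, z.2) + M)).
  apply/funext => y /=; rewrite EFin_mean //.
  by apply: finite_meanD; [exact: finite_mean_bnd|exact: finite_mean_cst].
apply: measurable_fun_fubini_tonelli_G => //=.
  exact/measurable_EFinP.
by move=> z /=; rewrite lee_fin -lerBlDr sub0r; have := hM (X z.1, z.2); rewrite ler_norml => /andP[].
Qed.

Lemma bounded_mf_mean X (h : R * R -> R) (M : R) : measurable_fun setT X ->
  measurable_fun setT h -> (forall z, `|h z| <= M) ->
  bounded_mf (fun y => E (fun t => h (X t, y))).
Proof.
move=> mX mh hM; split; first exact: measurable_mean hM.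
exists M => y; apply: mean_bnd => //.
exact: (measurableT_comp (measurable_section mh y) mX).
Qed.

Lemma measurable_add2 : measurable_fun setT (fun z : R * R => z.2 + z.1).
Proof. exact: measurable_funD. Qed.

Lemma bounded_mf_mean_shift f X : bounded_mf f -> measurable_fun setT X ->
  bounded_mf (fun y => E (fun t => f (y + X t))).
Proof.
move=> [mf [M hM]] mX.
apply: (@bounded_mf_mean X (fun z => f (z.2 + z.1)) M) => //.
exact: (measurableT_comp mf measurable_add2).
Qed.

Lemma bounded_fubini X Y (h : R * R -> R) (M : R) :
  measurable_fun setT X -> measurable_fun setT Y -> measurable_fun setT h ->
  independent_rv P X Y -> (forall z, `|h z| <= M) ->
  E (fun t => h (X t, Y t)) = E (fun t => E (fun t' => h (X t', Y t))).
Proof.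
move=> mX mY mh XY hM; apply: (independent_fubini (G := fun=> M)) => //.
exact: finite_mean_cst.
Qed.

(** Both sides are integrals with respect to the common law. *)
Lemma equal_in_law_mean X Y f : measurable_fun setT X -> measurable_fun setT Y ->
  equal_in_law P X Y -> bounded_mf f -> E (fun t => f (X t)) = E (fun t => f (Y t)).
Proof.
move=> mX mY XY bf; have mf := bf.1.
pose Xm : {mfun T >-> R} := HB.pack X (isMeasurableFun.Build _ _ _ _ X mX).
pose Ym : {mfun T >-> R} := HB.pack Y (isMeasurableFun.Build _ _ _ _ Y mY).
have mfE : measurable_fun setT (EFin \o f) by exact/measurable_EFinP.
rewrite /mean /Rintegral.
rewrite -[in LHS](integral_distribution (X := Xm) (f := EFin \o f)) //; last exact: bounded_mf_finite_mean.
rewrite -[in RHS](integral_distribution (X := Ym) (f := EFin \o f)) //; last exact: bounded_mf_finite_mean.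
congr fine; apply: eq_measure_integral => A mA _; exact: XY.
Qed.

End BoundedMeasurable.

(** The form in which the identities for finitely many steps pass to the
    limit. *)
Lemma limit_identity (R : realType) (u v w : nat -> R) (A B c K : R) :
  u @ \oo --> A -> v @ \oo --> (0 : R) -> w @ \oo --> B ->
  (forall n, u n + v n - c * w n = K) -> K = A - c * B.
Proof.
move=> hu hv hw hK.
have h4 := cvgB (cvgD hu hv) (cvgMr (a := c) hw).
have h5 : (fun _ : nat => K) @ \oo --> K by exact: cvg_cst.
have e : (u + v - (fun n => c * w n)) = (fun _ : nat => K) by apply/funext => n; exact: hK.
rewrite e in h4; rewrite -(addr0 A).
by apply: (cvg_unique _ h5) => //; exact: h4.
Qed.

Lemma wiener_hopf_algebra (R : realType) (A B C K K1 K2 p S f0 : R) :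
  A + f0 = B + C -> A = 1 * K1 + (-1 * K + K2) + p * S -> B = K1 + p * f0 ->
  p * S + f0 + K2 = p * f0 + C + K.
Proof. by move=> h0 h1 h2; lra. Qed.

(** * Ladder heights of a random walk with negative drift *)

Section Ladder.
Context d (T : measurableType d) (R : realType) (P : probability T R).
Variables (U : T -> R) (a s q : R).
Hypothesis mU : measurable_fun setT U.
Hypothesis Ua : forall t, U t <= a.
Hypothesis a0 : 0 < a.
Hypothesis s0 : 0 < s.
Hypothesis q1 : q < 1.
Hypothesis chernoff : mean P (fun t => expR (s * U t)) <= q.
Implicit Types (f g : R -> R).
Local Notation E := (mean P).

Definition lower f x : R := if x <= 0 then f x else 0.
Definition upper f x : R := if x <= 0 then 0 else f x.

Lemma bounded_mf_lower f : bounded_mf f -> bounded_mf (lower f).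
Proof.
move=> [mf [M hM]]; split.
  by apply: measurable_fun_if => //; [exact: measurable_fun_ler|exact: measurable_funTS].
exists M => x; rewrite /lower; case: ifP => // _.
by rewrite normr0; apply: le_trans (hM x).
Qed.

Lemma bounded_mf_upper f : bounded_mf f -> bounded_mf (upper f).
Proof.
move=> [mf [M hM]]; split.
  by apply: measurable_fun_if => //; [exact: measurable_fun_ler|exact: measurable_funTS].
exists M => x; rewrite /upper; case: ifP => // _.
by rewrite normr0; apply: le_trans (hM x).
Qed.

Definition step f x : R := E (fun t => f (x + U t)).

Lemma bounded_mf_step f : bounded_mf f -> bounded_mf (step f).
Proof. by move=> hf; exact: bounded_mf_mean_shift. Qed.

Lemma finite_mean_step f x : bounded_mf f -> finite_mean P (fun t => f (x + U t)).
Proof. by move=> hf; apply: (@bounded_mf_finite_mean _ _ _ _ (fun y => f (x + y))) => //; exact: bounded_mf_shift. Qed.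

Lemma step_lin (c : R) f g x : bounded_mf f -> bounded_mf g ->
  step (fun y => c * f y + g y) x = c * step f x + step g x.
Proof.
move=> hf hg; rewrite /step meanD; [|apply: finite_meanZ; exact: finite_mean_step|exact: finite_mean_step].
by rewrite meanZ //; exact: finite_mean_step.
Qed.

Lemma step_le f g x : bounded_mf f -> bounded_mf g -> (forall y, y <= x + a -> f y <= g y) ->
  step f x <= step g x.
Proof.
move=> hf hg fg; apply: mean_le; [exact: finite_mean_step|exact: finite_mean_step|].
by move=> t; apply: fg; rewrite lerD2l.
Qed.

(** [descend n f] is the expectation of [f] at the [n]-th position of the
    random walk with increments [U] started at [0], restricted to the event
    that the positions [1] to [n] are nonpositive. *)
Fixpoint descend n f : R :=
  if n is n'.+1 then descend n' (step (lower f)) else f 0.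

Lemma bounded_mf_stepl f : bounded_mf f -> bounded_mf (step (lower f)).
Proof. by move=> hf; apply: bounded_mf_step; exact: bounded_mf_lower. Qed.

Lemma bounded_mf_stepu f : bounded_mf f -> bounded_mf (step (upper f)).
Proof. by move=> hf; apply: bounded_mf_step; exact: bounded_mf_upper. Qed.

Lemma bounded_mf_lin (c : R) f g : bounded_mf f -> bounded_mf g -> bounded_mf (fun y => c * f y + g y).
Proof. by move=> hf hg; apply: bounded_mfD => //; exact: bounded_mfZ. Qed.

Lemma descend_le n f g : bounded_mf f -> bounded_mf g -> (forall y, y <= 0 -> f y <= g y) ->
  descend n f <= descend n g.
Proof.
elim: n f g => [|n IH] f g hf hg fg /=; first exact: fg.
apply: IH; [exact: bounded_mf_stepl|exact: bounded_mf_stepl|] => y y0.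
apply: step_le; [exact: bounded_mf_lower|exact: bounded_mf_lower|] => x _.
by rewrite /lower; case: ifP => // x0; exact: fg.
Qed.

Lemma descend_eq n f g : bounded_mf f -> bounded_mf g -> (forall y, y <= 0 -> f y = g y) ->
  descend n f = descend n g.
Proof.
move=> hf hg fg; apply/eqP; rewrite eq_le.
by apply/andP; split; apply: descend_le => // y y0; rewrite fg.
Qed.

Lemma descend_lin n (c : R) f g : bounded_mf f -> bounded_mf g ->
  descend n (fun y => c * f y + g y) = c * descend n f + descend n g.
Proof.
elim: n f g => [|n IH] f g hf hg //=.
rewrite -(IH (step (lower f)) (step (lower g))); [|exact: bounded_mf_stepl|exact: bounded_mf_stepl].
congr descend; apply/funext => x; rewrite -step_lin; [|exact: bounded_mf_lower|exact: bounded_mf_lower].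
congr step; apply/funext => y; rewrite /lower; case: ifP => // _.
by rewrite mulr0 addr0.
Qed.

Lemma step_split f x : bounded_mf f -> step f x = step (lower f) x + step (upper f) x.
Proof.
move=> hf; have := @step_lin 1 (lower f) (upper f) x (bounded_mf_lower hf) (bounded_mf_upper hf).
rewrite mul1r => <-; congr step; apply/funext => y.
by rewrite /lower /upper; case: ifP => _; rewrite mul1r ?addr0 ?add0r.
Qed.

(** The expectation of [f] at the [n + 1]-th position of the walk, on the
    event that this position is the first positive one. *)
Definition ladder n f : R := descend n (step (upper f)).

Lemma ladder_le n f g : bounded_mf f -> bounded_mf g ->
  (forall y, 0 < y <= a -> f y <= g y) -> ladder n f <= ladder n g.
Proof.
move=> hf hg fg; apply: descend_le; [exact: bounded_mf_stepu|exact: bounded_mf_stepu|].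
move=> x x0; apply: step_le; [exact: bounded_mf_upper|exact: bounded_mf_upper|].
move=> y yxa; rewrite /upper; case: ifP => //.
move/negbT; rewrite -ltNge => y0; apply: fg; rewrite y0 /=.
by apply: (le_trans yxa); rewrite gerDr.
Qed.

Lemma ladder_lin n (c : R) f g : bounded_mf f -> bounded_mf g ->
  ladder n (fun y => c * f y + g y) = c * ladder n f + ladder n g.
Proof.
move=> hf hg; rewrite /ladder -descend_lin; [|exact: bounded_mf_stepu|exact: bounded_mf_stepu].
congr descend; apply/funext => x; rewrite -step_lin; [|exact: bounded_mf_upper|exact: bounded_mf_upper].
congr step; apply/funext => y; rewrite /upper; case: ifP => // _.
by rewrite mulr0 addr0.
Qed.

(** After [n] nonpositive positions, the next one is nonpositive or is the
    first positive one. *)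
Lemma descend_step n f : bounded_mf f ->
  descend n (step f) = descend n.+1 f + ladder n f.
Proof.
move=> hf /=; rewrite -[descend n (step (lower f))]mul1r /ladder.
rewrite -descend_lin; [|exact: bounded_mf_stepl|exact: bounded_mf_stepu].
congr descend; apply/funext => x; rewrite mul1r; exact: step_split.
Qed.

(** On the half-line up to [a], where the walk lives until it becomes
    positive, this is the exponential [expR (s * x)]; the truncation makes it
    bounded. *)
Definition tilt x : R := expR (s * Num.min x a).

Lemma bounded_mf_tilt : bounded_mf tilt.
Proof.
split.
  apply: measurableT_comp; first exact: measurable_expR.
  by apply: measurable_funM => //; exact: measurable_minr.
exists (expR (s * a)) => x; rewrite ger0_norm ?expR_ge0 // ler_expR ler_pM2l //.
by rewrite ge_min lexx orbT.
Qed.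

Lemma step_tilt x : x <= 0 -> step tilt x <= q * tilt x.
Proof.
move=> x0; rewrite /step.
have iU : finite_mean P (fun t => expR (s * U t)).
  apply: (@finite_mean_bnd _ _ _ _ _ (expR (s * a))).
    apply: measurableT_comp; first exact: measurable_expR.
    exact: measurable_funM.
  by move=> t; rewrite ger0_norm ?expR_ge0 // ler_expR ler_pM2l.
have tx : tilt x = expR (s * x).
  by rewrite /tilt; congr (expR (s * _)); apply/min_idPl; exact: le_trans x0 (ltW a0).
rewrite mulrC; apply: (@le_trans _ _ (tilt x * E (fun t => expR (s * U t)))); last first.
  by rewrite ler_pM2l // tx expR_gt0.
rewrite -meanZ //; apply: mean_le; [exact: (finite_mean_step _ bounded_mf_tilt)|exact: finite_meanZ|].
move=> t; rewrite tx -expRD -mulrDr ler_expR ler_pM2l //.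
by rewrite ge_min lexx.
Qed.

Lemma q_ge0 : 0 <= q.
Proof. by apply: le_trans chernoff; apply: mean_ge0 => t; exact: expR_ge0. Qed.

Lemma descend0 n : descend n (fun=> 0) = 0.
Proof.
elim: n => //= n IH; rewrite -[RHS]IH; congr descend; apply/funext => x.
rewrite /step -[RHS](mean_cst P 0); congr mean; apply/funext => t.
by rewrite /lower; case: ifP.
Qed.

Lemma ladder0 n : ladder n (fun=> 0) = 0.
Proof.
rewrite -[RHS](descend0 n); congr descend; apply/funext => x.
rewrite /step -[RHS](mean_cst P 0); congr mean; apply/funext => t.
by rewrite /upper; case: ifP.
Qed.

Lemma descend_geo n f : bounded_mf f -> (forall x, x <= 0 -> step f x <= q * f x) ->
  descend n (step f) <= q * descend n f.
Proof.
move=> hf fq.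
have c0 : bounded_mf (fun=> 0 : R) := bounded_mf_cst 0.
have -> : q * descend n f = descend n (fun y => q * f y + 0).
  by rewrite descend_lin // descend0 addr0.
apply: descend_le => //; [exact: bounded_mf_step|exact: bounded_mf_lin|].
by move=> y y0; rewrite addr0; exact: fq.
Qed.

Lemma descend_ge0 n f : bounded_mf f -> (forall x, x <= 0 -> 0 <= f x) -> 0 <= descend n f.
Proof.
by move=> hf f0; rewrite -(descend0 n); apply: descend_le => //; exact: bounded_mf_cst.
Qed.

Lemma ladder_ge0 n f : bounded_mf f -> (forall x, 0 < x <= a -> 0 <= f x) -> 0 <= ladder n f.
Proof.
move=> hf f0; have c0 : bounded_mf (fun=> 0 : R) := bounded_mf_cst 0.
by rewrite -(ladder0 n); apply: ladder_le.
Qed.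

(** The tilted mass is multiplied by at most [q] at each step. *)
Lemma descend_tilt n : descend n tilt <= q ^+ n.
Proof.
elim: n => [|n IH].
  rewrite /= expr0 /tilt -[leRHS]expR0 ler_expR.
  have -> : Num.min 0 a = 0 by apply/min_idPl; exact: ltW.
  by rewrite mulr0.
have h1 := descend_step n bounded_mf_tilt.
have h2 := descend_geo n bounded_mf_tilt step_tilt.
have h3 : 0 <= ladder n tilt by apply: ladder_ge0 => //; [exact: bounded_mf_tilt|move=> x _; exact: expR_ge0].
have h4 : q * descend n tilt <= q * q ^+ n by apply: ler_wpM2l => //; exact: q_ge0.
rewrite exprS; lra.
Qed.

(** At each step the tilted mass of the walk is multiplied by at most [q] and
    then split between the surviving part and the ladder height, so the ladder
    heights get in total at most the mass [q] of the first step. *)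
Lemma ladder_tilt N : \sum_(0 <= n < N) ladder n tilt <= q.
Proof.
have h n : ladder n tilt + descend n.+1 tilt <= q * descend n tilt.
  have h1 := descend_step n bounded_mf_tilt.
  have h2 := descend_geo n bounded_mf_tilt step_tilt; lra.
have d0 n : 0 <= descend n tilt.
  by apply: descend_ge0 => [|x _]; [exact: bounded_mf_tilt|exact: expR_ge0].
have q0 := q_ge0.
suff hs n : \sum_(0 <= k < n.+1) ladder k tilt + descend n.+1 tilt <= q.
  case: N => [|n]; first by rewrite big_geq.
  by have := hs n; have := d0 n.+1; lra.
elim: n => [|n IH].
  rewrite big_nat1; apply: (le_trans (h 0%N)).
  by rewrite -[leRHS]mulr1; apply: ler_wpM2l => //; have := descend_tilt 0; rewrite expr0.
rewrite big_nat_recr // -addrA; apply: le_trans IH; apply: lerD; first by [].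
apply: (le_trans (h n.+1)); rewrite -[leRHS]mul1r; apply: ler_wpM2r; [exact: d0|exact: ltW].
Qed.

(** For a function harmonic for the walk on the nonpositive half-line the sum
    telescopes; both constants and [shifted f] are harmonic. *)
Lemma ladder_sum N f : bounded_mf f -> (forall x, x <= 0 -> step f x = f x) ->
  \sum_(0 <= n < N) ladder n f = f 0 - descend N f.
Proof.
move=> hf fE; elim: N => [|N IH]; first by rewrite big_geq //= subrr.
rewrite big_nat_recr //= -/(descend N.+1 f) IH.
have := descend_step N hf.
have -> : descend N (step f) = descend N f by apply: descend_eq => //; exact: bounded_mf_step.
move=> /= ->; rewrite -/(descend N.+1 f).
by rewrite opprD addrA addrNK.
Qed.

Lemma cvg_ladder1 : cvgn (series (fun n => ladder n (fun=> 1))).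
Proof.
have c1 : bounded_mf (fun=> 1 : R) := bounded_mf_cst 1.
apply: nondecreasing_is_cvgn.
  apply/nondecreasing_seqP => n; rewrite /series /= big_nat_recr //= lerDl.
  exact: ladder_ge0.
exists 1 => _ [n _ <-]; rewrite /series /= ladder_sum //; last first.
  by move=> x _; exact: mean_cst.
by rewrite gerBl; apply: descend_ge0.
Qed.

Lemma cvg_ladder f : bounded_mf f -> cvgn (series (fun n => ladder n f)).
Proof.
move=> hf; have [_ [M hM]] := hf.
have M0 : 0 <= M := le_trans (normr_ge0 _) (hM 0).
have c1 : bounded_mf (fun=> 1 : R) := bounded_mf_cst 1.
have c0 : bounded_mf (fun=> 0 : R) := bounded_mf_cst 0.
have lZ n (c : R) : ladder n (fun=> c) = c * ladder n (fun=> 1).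
  rewrite -[RHS]addr0 -(ladder0 n) -ladder_lin //.
  by congr ladder; apply/funext => x; rewrite mulr1 addr0.
apply: normed_cvg; apply: (@series_le_cvg _ _ (fun n => M * ladder n (fun=> 1))).
- by move=> n; exact: normr_ge0.
- by move=> n; apply: mulr_ge0 => //; exact: ladder_ge0.
- move=> n; rewrite ler_norml -mulNr -!lZ; apply/andP; split; apply: ladder_le => //;
    try exact: bounded_mf_cst.
  + by move=> y _; have := hM y; rewrite ler_norml => /andP[].
  + by move=> y _; have := hM y; rewrite ler_norml => /andP[].
- have -> : series (fun n => M * ladder n (fun=> 1)) = (fun n => M * series (fun n => ladder n (fun=> 1)) n).
    by apply/funext => n; rewrite /series /= mulr_sumr.
  by apply: is_cvgMr; exact: cvg_ladder1.
Qed.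

(** The law of the first positive position, as a functional. *)
Definition ladder_law f : R := limn (series (fun n => ladder n f)).

Lemma ladder_law_lin (c : R) f g : bounded_mf f -> bounded_mf g ->
  ladder_law (fun y => c * f y + g y) = c * ladder_law f + ladder_law g.
Proof.
move=> hf hg; apply: cvg_lim => //.
have -> : series (fun n => ladder n (fun y => c * f y + g y)) =
    (fun n => c * series (fun n => ladder n f) n + series (fun n => ladder n g) n).
  apply/funext => n; rewrite /series /= mulr_sumr -big_split /=.
  by apply: eq_bigr => k _; exact: ladder_lin.
apply: cvgD; last exact: cvg_ladder.
by apply: cvgMr; exact: cvg_ladder.
Qed.

Lemma ladder_law_le f g : bounded_mf f -> bounded_mf g ->
  (forall y, 0 < y <= a -> f y <= g y) -> ladder_law f <= ladder_law g.
Proof.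
move=> hf hg fg; apply: ler_lim; [exact: cvg_ladder|exact: cvg_ladder|].
apply: nearW => n; rewrite /series /=; apply: ler_sum => k _; exact: ladder_le.
Qed.

(** The tilt is at least [1] on positive positions. This strict inequality is
    where the negative drift enters: with positive probability the walk never
    becomes positive. *)
Lemma ladder_law1 : ladder_law (fun=> 1) <= q.
Proof.
apply: (@le_trans _ _ (ladder_law tilt)).
  apply: ladder_law_le; [exact: bounded_mf_cst|exact: bounded_mf_tilt|].
  move=> y /andP[y0 ya]; rewrite /tilt -expR0 ler_expR; apply: mulr_ge0; first exact: ltW.
  by rewrite le_min !ltW.
apply: limr_le; first by apply: cvg_ladder; exact: bounded_mf_tilt.
by apply: nearW => n; exact: ladder_tilt.
Qed.

Variable V : T -> R.
Hypothesis mV : measurable_fun setT V.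
Hypothesis V0 : forall t, 0 <= V t.
Hypothesis VU : independent_rv P V U.
Hypothesis stat : equal_in_law P V (fun t => Num.max (V t + U t) 0).

Lemma measurable_pos (x : R) : measurable_fun setT (fun v : R => Num.max (x + v) 0).
Proof. by apply: measurable_maxr => //; exact: measurable_funD. Qed.

(** [E f((x + V)^+)]; at [x = 0] this is [E f(V)]. *)
Definition shifted f x : R := E (fun t => f (Num.max (x + V t) 0)).

Lemma bounded_mf_shifted f : bounded_mf f -> bounded_mf (shifted f).
Proof.
move=> [mf [M hM]].
apply: (@bounded_mf_mean _ _ _ P V (fun z => f (Num.max (z.2 + z.1) 0)) M) => //.
apply: (measurableT_comp mf); apply: measurable_maxr => //.
exact: measurable_add2.
Qed.

Lemma measurable_max_VU : measurable_fun setT (fun t => Num.max (V t + U t) 0).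
Proof. by apply: measurable_maxr => //; exact: measurable_funD. Qed.

(** For [x <= 0] the outer positive part absorbs the inner one in [(x + (V +
    U)^+)^+], so that stationarity yields [(x + U + V)^+]. *)
Lemma shifted_step f x : bounded_mf f -> x <= 0 -> step (shifted f) x = shifted f x.
Proof.
move=> hf x0; have [mf [M hM]] := hf.
have hfx : bounded_mf (fun v => f (Num.max (x + v) 0)).
  by apply: (@bounded_mf_comp _ f (fun v => Num.max (x + v) 0)) => //; exact: measurable_pos.
rewrite {2}/shifted (equal_in_law_mean mV measurable_max_VU stat hfx).
have -> : (fun t => f (Num.max (x + Num.max (V t + U t) 0) 0)) =
    (fun t => f (Num.max (x + U t + V t) 0)).
  apply/funext => t; congr f; rewrite addr_maxr addr0 -maxA.
  have -> : Num.max x 0 = 0 by apply/max_idPr.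
  by rewrite [V t + _]addrC addrA.
rewrite (bounded_fubini (h := fun z => f (Num.max (x + z.2 + z.1) 0)) (M := M)) //.
apply: (measurableT_comp mf); apply: measurable_maxr => //.
apply: measurable_funD => //; exact: measurable_funD.
Qed.

Lemma tail_V (e : R) : 0 < e -> exists2 c : R, 0 <= c &
  E (\1_[set t | c < V t]) <= e.
Proof.
move=> e0.
pose Vm : {mfun T >-> R} := HB.pack V (isMeasurableFun.Build _ _ _ _ V mV).
have := @cvg_ccdfy0 _ _ _ P Vm (fun y => (y < e%:E)%E).
have e0' : (0 < e%:E)%E by rewrite lte_fin.
move=> /(_ (open_ereal_lt' e0')) [c0 [_ hc]].
exists (Num.max c0 0 + 1).
  by apply: addr_ge0 => //; rewrite le_max lexx orbT.
have {}hc := hc (Num.max c0 0 + 1) _.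
have mA : measurable [set t | Num.max c0 0 + 1 < V t].
  rewrite -[X in measurable X]setTI; exact: measurable_fun_ltr.
rewrite -lee_fin EFin_mean; last first.
  by apply: (@finite_mean_bnd _ _ _ _ _ 1) => // t; rewrite indicE ger0_norm // lern1; case: (_ \in _).
rewrite integral_indic // setIT; apply: ltW.
have hlt : c0 < Num.max c0 0 + 1.
  by apply: (@le_lt_trans _ _ (Num.max c0 0)); [rewrite le_max lexx|rewrite ltrDl].
apply: le_lt_trans (hc hlt); rewrite /ccdf /distribution /pushforward.
rewrite (_ : [set t | _] = Vm @^-1` `](Num.max c0 0 + 1), +oo[%classic); first exact: lexx.
by apply/seteqP; split => t /=; rewrite in_itv /= andbT.
Qed.

Lemma descend_cst n (c : R) : descend n (fun=> c) = c * descend n (fun=> 1).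
Proof.
rewrite -[RHS]addr0 -(descend0 n) -descend_lin; [|exact: bounded_mf_cst|exact: bounded_mf_cst].
by congr descend; apply/funext => x; rewrite mulr1 addr0.
Qed.

Lemma descend1_le n : descend n (fun=> 1) <= 1.
Proof.
rewrite -subr_ge0 -(@ladder_sum n (fun=> 1) (bounded_mf_cst 1)); last by move=> x _; exact: mean_cst.
apply: sumr_ge0 => k _; apply: ladder_ge0 => //; exact: bounded_mf_cst.
Qed.

(** [f((x + V)^+)] differs from [f 0] only if [V > - x]: either [V] exceeds
    the level [c], or [x > - c] and the tilt is at least [expR (- s c)]. *)
Lemma shifted_near f (M c dl x : R) : bounded_mf f -> (forall y, `|f y| <= M) ->
  E (\1_[set t | c < V t]) <= dl -> x <= 0 ->
  `|shifted f x - f 0| <= 2 * M * (dl + expR (s * c) * tilt x).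
Proof.
move=> hf hM hc x0; have mf := hf.1.
have M0 : 0 <= M := le_trans (normr_ge0 _) (hM 0).
have i1 : finite_mean P (fun t => f (Num.max (x + V t) 0)).
  apply: (@bounded_mf_finite_mean _ _ _ _ (fun v => f (Num.max (x + v) 0))) => //.
  by apply: (@bounded_mf_comp _ f (fun v => Num.max (x + v) 0)) => //; exact: measurable_pos.
rewrite /shifted -[f 0 in X in `|X|](mean_cst P) -meanB //; last exact: finite_mean_cst.
have mA : measurable [set t | c < V t].
  rewrite -[X in measurable X]setTI; exact: measurable_fun_ltr.
have i2 : finite_mean P (\1_[set t | c < V t] : T -> R).
  by apply: (@finite_mean_bnd _ _ _ _ _ 1) => // t; rewrite indicE ger0_norm // lern1; case: (_ \in _).
have i3 : finite_mean P (fun t => 2 * M * (\1_[set t | c < V t] t + expR (s * c) * tilt x)).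
  by apply: finite_meanZ; apply: finite_meanD => //; exact: finite_mean_cst.
apply: (@le_trans _ _ (E (fun t => 2 * M * (\1_[set t | c < V t] t + expR (s * c) * tilt x)))).
  apply: mean_norm => //; first by apply: finite_meanB => //; exact: finite_mean_cst.
  move=> t.
  have hb : `|f (Num.max (x + V t) 0) - f 0| <= 2 * M.
    apply: (le_trans (ler_normB _ _)); rewrite mulr_natl mulr2n; exact: lerD.
  have ht : 0 <= expR (s * c) * tilt x by apply: mulr_ge0; exact: expR_ge0.
  have h2M : 0 <= 2 * M by apply: mulr_ge0.
  have [cV|Vc] := ltP c (V t).
    rewrite indicE mem_set //=; apply: (le_trans hb); rewrite -[leLHS]mulr1.
    by apply: ler_wpM2l => //; rewrite lerDl.
  rewrite indicE memNset /=; last by apply/negP; rewrite -leNgt.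
  rewrite add0r; have [xV|Vx] := leP (x + V t) 0.
    by rewrite subrr normr0; apply: mulr_ge0.
  have hb' : `|f (x + V t) - f 0| <= 2 * M by move: hb; rewrite max_l // ltW.
  apply: (le_trans hb'); rewrite -[leLHS]mulr1; apply: ler_wpM2l => //.
  rewrite /tilt -expRD -expR0 ler_expR -mulrDr; apply: mulr_ge0; first exact: ltW.
  have -> : Num.min x a = x by apply/min_idPl; exact: le_trans x0 (ltW a0).
  lra.
rewrite meanZ; last by apply: finite_meanD => //; exact: finite_mean_cst.
rewrite meanD //; last exact: finite_mean_cst.
rewrite mean_cst; apply: ler_wpM2l; first exact: mulr_ge0.
exact: lerD.
Qed.

Lemma descend_limit_bound f (M c dl : R) n : bounded_mf f -> (forall y, `|f y| <= M) ->
  0 <= dl -> E (\1_[set t | c < V t]) <= dl ->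
  `|descend n (shifted f) - f 0 * descend n (fun=> 1)| <= 2 * M * (dl + expR (s * c) * q ^+ n).
Proof.
move=> hf hM dl0 hc; have hs := bounded_mf_shifted hf; have ht := bounded_mf_tilt.
have M0 : 0 <= M := le_trans (normr_ge0 _) (hM 0).
(* The majorant of [shifted_near], whose descent is explicit. *)
pose b x := 2 * M * (dl + expR (s * c) * tilt x).
have hb : bounded_mf b by apply: bounded_mfZ; apply: bounded_mfD; [exact: bounded_mf_cst|exact: bounded_mfZ].
have eb : descend n b <= 2 * M * (dl + expR (s * c) * q ^+ n).
  have -> : descend n b = 2 * M * (dl * descend n (fun=> 1) + expR (s * c) * descend n tilt).
    have -> : b = (fun x => (2 * M * expR (s * c)) * tilt x + 2 * M * dl).
      by apply/funext => x; rewrite /b; ring.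
    by rewrite descend_lin //; [rewrite descend_cst; ring|exact: bounded_mf_cst].
  apply: ler_wpM2l; first exact: mulr_ge0.
  apply: lerD; last by apply: ler_wpM2l; [exact: expR_ge0|exact: descend_tilt].
  by rewrite -[leRHS]mulr1; apply: ler_wpM2l => //; exact: descend1_le.
apply: le_trans eb.
have -> : descend n (shifted f) - f 0 * descend n (fun=> 1) = descend n (fun x => shifted f x - f 0).
  have -> : (fun x => shifted f x - f 0) = (fun x => 1 * shifted f x + - f 0).
    by apply/funext => x; rewrite mul1r.
  rewrite (@descend_lin n 1 (shifted f) (fun=> - f 0)) //; last exact: bounded_mf_cst.
  by rewrite (descend_cst n (- f 0)) mulNr mul1r.
have hd : bounded_mf (fun x => shifted f x - f 0) by apply: bounded_mfB => //; exact: bounded_mf_cst.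
have hn x : x <= 0 -> `|shifted f x - f 0| <= b x by exact: shifted_near.
rewrite ler_norml; apply/andP; split.
  have -> : - descend n b = descend n (fun x => - 1 * b x + 0).
    rewrite (@descend_lin n (-1) b (fun=> 0)) //; last exact: bounded_mf_cst.
    by rewrite descend0 mulN1r addr0.
  apply: descend_le => // [|x x0]; first by apply: bounded_mf_lin => //; exact: bounded_mf_cst.
  by rewrite mulN1r addr0; have := hn x x0; rewrite ler_norml => /andP[].
by apply: descend_le => // x x0; have := hn x x0; rewrite ler_norml => /andP[].
Qed.

(** A walk that is still nonpositive after many steps is far below [0], where
    [shifted f] is close to [f 0]. *)
Lemma descend_limit f : bounded_mf f ->
  (descend n (shifted f) - f 0 * descend n (fun=> 1)) @[n --> \oo] --> (0 : R).
Proof.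
move=> hf; have [_ [M' hM']] := hf.
pose M : R := M' + 1.
have hM y : `|f y| <= M by apply: (le_trans (hM' y)); rewrite lerDl.
have M0 : 0 < M by apply: (@le_lt_trans _ _ M'); [exact: le_trans (normr_ge0 _) (hM' 0)|rewrite ltrDl].
apply/cvgr0Pnorm_le => e e0.
pose dl : R := e / (4 * M).
have dl0 : 0 < dl by apply: divr_gt0 => //; apply: mulr_gt0.
have [c c0 hc] := tail_V dl0.
have q0 := q_ge0.
have hq : (fun n => q ^+ n) @ \oo --> (0 : R) by apply: cvg_expr; rewrite ger0_norm.
have K0 : 0 < e / (4 * M * expR (s * c)).
  by apply: divr_gt0 => //; apply: mulr_gt0; [apply: mulr_gt0|exact: expR_gt0].
have /cvgr0Pnorm_le /(_ _ K0) := hq.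
apply: filterS => n hn.
apply: (le_trans (descend_limit_bound n hf hM (ltW dl0) hc)).
have hn' : q ^+ n <= e / (4 * M * expR (s * c)) by apply: le_trans hn; exact: ler_norm.
have X0 := expR_gt0 (s * c).
apply: (@le_trans _ _ (2 * M * (dl + expR (s * c) * (e / (4 * M * expR (s * c)))))).
  apply: ler_wpM2l; first by apply: mulr_ge0 => //; exact: ltW.
  by rewrite lerD2l; apply: ler_wpM2l => //; exact: ltW.
rewrite /dl le_eqVlt; apply/orP; left; apply/eqP.
by field; rewrite !lt0r_neq0.
Qed.

(** For positive [x] the positive part does nothing. *)
Lemma upper_shifted f : upper (shifted f) = upper (fun x => E (fun t => f (x + V t))).
Proof.
apply/funext => x; rewrite /upper; case: ifP => // /negbT; rewrite -ltNge => x0.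
congr mean; apply/funext => t; congr f; apply/max_idPl.
by apply: addr_ge0; [exact: ltW|exact: V0].
Qed.

(** [shifted f] is harmonic, so its value at [0] is the sum of the
    contributions of the ladder heights and of the limit of [descend]; taking
    [f = 1] identifies the weight of the latter. *)
Lemma wiener_hopf f : bounded_mf f ->
  E (fun t => f (V t)) = ladder_law (fun x => E (fun t => f (x + V t)))
    + (1 - ladder_law (fun=> 1)) * f 0.
Proof.
move=> hf; have c1 : bounded_mf (fun=> 1 : R) := bounded_mf_cst 1.
have hs := bounded_mf_shifted hf.
have V_shifted : E (fun t => f (V t)) = shifted f 0.
  by rewrite /shifted; congr mean; apply/funext => t; rewrite add0r; congr f; apply/esym/max_idPl.
have lE : (fun n => ladder n (fun x => E (fun t => f (x + V t)))) = (fun n => ladder n (shifted f)).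
  by apply/funext => n; rewrite /ladder upper_shifted.
have h1 : series (fun n => ladder n (shifted f)) @ \oo --> ladder_law (fun x => E (fun t => f (x + V t))).
  have -> : ladder_law (fun x => E (fun t => f (x + V t))) = ladder_law (shifted f) by rewrite /ladder_law; congr (limn (series _)); exact: lE.
  exact: (cvg_ladder hs).
have h2 : series (fun n => ladder n (fun=> 1)) @ \oo --> ladder_law (fun=> 1).
  by apply: cvg_ladder.
have h3 := descend_limit hf.
suff h : shifted f 0 - f 0 = ladder_law (fun x => E (fun t => f (x + V t))) - f 0 * ladder_law (fun=> 1).
  by rewrite V_shifted -(subrK (f 0) (shifted f 0)) h mulrBl mul1r -addrA [- _ + _]addrC [f 0 * _]mulrC.
apply: (limit_identity h1 h3 h2) => n; rewrite /series /=.
have e1 := @ladder_sum n _ c1 (fun x _ => mean_cst P 1).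
have e2 := @ladder_sum n _ hs (fun x => @shifted_step f x hf).
rewrite e1 e2; ring.
Qed.

(** A number and [0] are together the positive and negative parts of the
    number; the positive part of [V + U] has the law of [V]. *)
Lemma mean_VU_split f (x : R) : bounded_mf f ->
  E (fun t => f (x + (V t + U t))) + f x =
  E (fun t => f (x + V t)) + E (fun t => f (x + Num.min (V t + U t) 0)).
Proof.
move=> hf; have hfx : bounded_mf (fun v => f (x + v)) by exact: bounded_mf_shift.
have mVU : measurable_fun setT (fun t => V t + U t) by exact: measurable_funD.
have mmin : measurable_fun setT (fun t => Num.min (V t + U t) 0) by exact: measurable_minr.
have i1 := bounded_mf_finite_mean P hfx mVU.
have i2 := bounded_mf_finite_mean P hfx measurable_max_VU.
have i3 := bounded_mf_finite_mean P hfx mmin.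
rewrite (equal_in_law_mean mV measurable_max_VU stat hfx).
rewrite -(meanD i2 i3) -[f x in LHS](mean_cst P) -(meanD i1); last exact: finite_mean_cst.
congr mean; apply/funext => t; have [h|h] := leP (V t + U t) 0.
  by rewrite addr0 addrC.
by rewrite addr0.
Qed.

Lemma mean_VU f : bounded_mf f -> E (fun t => f (V t + U t)) = E (fun t => step f (V t)).
Proof.
move=> [mf [M hM]].
rewrite (bounded_fubini (P := P) (X := U) (Y := V) (h := fun z => f (z.2 + z.1)) (M := M)) //.
- exact: (measurableT_comp mf (@measurable_add2 R)).
- exact: independent_rvC.
Qed.

(** [wiener_hopf] for [f] and for [v |-> E f(v + U)], combined with
    [mean_VU_split] at [0] and at each ladder height. *)
Lemma wiener_hopf_factor f : bounded_mf f ->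
  (1 - ladder_law (fun=> 1)) * E (fun t => f (U t)) + f 0
    + ladder_law (fun x => E (fun t => f (x + Num.min (V t + U t) 0))) =
  (1 - ladder_law (fun=> 1)) * f 0 + E (fun t => f (Num.min (V t + U t) 0))
    + ladder_law f.
Proof.
move=> hf.
have mVU : measurable_fun setT (fun t => V t + U t) by exact: measurable_funD.
have mmin : measurable_fun setT (fun t => Num.min (V t + U t) 0) by exact: measurable_minr.
have h0 : E (fun t => f (V t + U t)) + f 0 = E (fun t => f (V t)) + E (fun t => f (Num.min (V t + U t) 0)).
  have := mean_VU_split 0 hf.
  have e0 (X : T -> R) : E (fun t => f (0 + X t)) = E (fun t => f (X t)).
    by congr mean; apply/funext => t; rewrite add0r.
  by rewrite (e0 (fun t => V t + U t)) (e0 V) (e0 (fun t => Num.min (V t + U t) 0)).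
have h1 := wiener_hopf (bounded_mf_step hf).
rewrite -(mean_VU hf) in h1.
have b1 : bounded_mf (fun x => E (fun t => f (x + V t))) by exact: bounded_mf_mean_shift.
have b2 : bounded_mf (fun x => E (fun t => f (x + Num.min (V t + U t) 0))) by exact: bounded_mf_mean_shift.
have h2 : (fun x => E (fun t => step f (x + V t))) =
   (fun x => 1 * E (fun t => f (x + V t)) + (-1 * f x + E (fun t => f (x + Num.min (V t + U t) 0)))).
  apply/funext => x; have hx := mean_VU_split x hf.
  have hs := mean_VU (bounded_mf_shift x hf).
  have -> : E (fun t => step f (x + V t)) = E (fun t => f (x + (V t + U t))).
    rewrite hs; congr mean; apply/funext => t; rewrite /step; congr mean; apply/funext => t'.
    by rewrite addrA.
  lra.
rewrite h2 ladder_law_lin // in h1; last by apply: bounded_mf_lin.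
rewrite ladder_law_lin // in h1.
have h3 := wiener_hopf hf.
have h4 : step f 0 = E (fun t => f (U t)).
  by rewrite /step; congr mean; apply/funext => t; rewrite add0r.
rewrite h4 in h1; exact: (wiener_hopf_algebra h0 h1 h3).
Qed.

End Ladder.

(** * Transform of a functional on a bounded interval *)

Section Complexify.
Context (R : realType).
Implicit Types (phi psi : R -> R[i]).

Definition bounded_cmf phi := bounded_mf (fun x => Re (phi x)) /\ bounded_mf (fun x => Im (phi x)).

Lemma bounded_cmf_cst (c : R[i]) : bounded_cmf (fun=> c).
Proof. by split; exact: bounded_mf_cst. Qed.

Lemma bounded_cmfD phi psi : bounded_cmf phi -> bounded_cmf psi -> bounded_cmf (fun x => phi x + psi x).
Proof.
move=> [h1 h2] [h3 h4]; split.
  by under eq_fun do rewrite ReD; exact: bounded_mfD.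
by under eq_fun do rewrite ImD; exact: bounded_mfD.
Qed.

Lemma bounded_cmfM phi psi : bounded_cmf phi -> bounded_cmf psi -> bounded_cmf (fun x => phi x * psi x).
Proof.
move=> [h1 h2] [h3 h4]; split.
  by under eq_fun do rewrite ReM; apply: bounded_mfB; exact: bounded_mfM.
by under eq_fun do rewrite ImM; apply: bounded_mfD; exact: bounded_mfM.
Qed.

Lemma bounded_cmfN phi : bounded_cmf phi -> bounded_cmf (fun x => - phi x).
Proof.
move=> [h1 h2]; split.
  by under eq_fun do rewrite ReN; exact: bounded_mfN.
by under eq_fun do rewrite ImN; exact: bounded_mfN.
Qed.

Lemma bounded_cmfX phi n : bounded_cmf phi -> bounded_cmf (fun x => phi x ^+ n).
Proof.
move=> h; elim: n => [|n IH].
  by under eq_fun do rewrite expr0; exact: bounded_cmf_cst.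
by under eq_fun do rewrite exprS; exact: bounded_cmfM.
Qed.

Lemma bounded_cmf_real f : bounded_mf f -> bounded_cmf (fun x => (f x)%:C).
Proof. by move=> hf; split => //=; exact: bounded_mf_cst. Qed.

Lemma bounded_cmf_sum (M : nat) (F : nat -> R -> R[i]) : (forall n, bounded_cmf (F n)) ->
  bounded_cmf (fun x => \sum_(0 <= n < M) F n x).
Proof.
move=> h; elim: M => [|M IH].
  by under eq_fun do rewrite big_geq //; exact: bounded_cmf_cst.
by under eq_fun do rewrite big_nat_recr //=; exact: bounded_cmfD.
Qed.

Lemma Re_Nmulr (th : R[i]) (x : R) : Re (- th * x%:C) = - Re th * x.
Proof. by rewrite ReM /= mulr0 subr0 ReN. Qed.

Lemma Im_Nmulr (th : R[i]) (x : R) : Im (- th * x%:C) = - Im th * x.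
Proof. by rewrite ImM /= mulr0 add0r ImN. Qed.

Lemma measurable_cexp d (T : measurableType d) (th : R[i]) (g : T -> R) : measurable_fun setT g ->
  measurable_fun setT (fun x => Re (cexp (- th * (g x)%:C))) /\
  measurable_fun setT (fun x => Im (cexp (- th * (g x)%:C))).
Proof.
move=> mg; rewrite /cexp /=.
have m1 : measurable_fun setT (fun x => expR (Re (- th * (g x)%:C))).
  under eq_fun do rewrite Re_Nmulr.
  by apply: measurableT_comp; [exact: measurable_expR|exact: measurable_funM].
have m2 : measurable_fun setT (fun x => Im (- th * (g x)%:C)).
  by under eq_fun do rewrite Im_Nmulr; exact: measurable_funM.
have mcos : measurable_fun setT (@cos R).
  by apply: continuous_measurable_fun; exact: continuous_cos.
have msin : measurable_fun setT (@sin R).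
  by apply: continuous_measurable_fun; exact: continuous_sin.
by split; apply: measurable_funM => //; exact: measurableT_comp.
Qed.

Lemma bounded_cmf_cexp (th : R[i]) (g : R -> R) (N : R) : measurable_fun setT g ->
  (forall x, - Re th * g x <= N) -> bounded_cmf (fun x => cexp (- th * (g x)%:C)).
Proof.
move=> mg hN; have [m1 m2] := measurable_cexp th mg.
have h x : cmod (cexp (- th * (g x)%:C)) <= expR N by rewrite cmod_cexp Re_Nmulr ler_expR.
split; split => //; exists (expR N) => x.
  by apply: le_trans (h x); exact: Re_le_cmod.
by apply: le_trans (h x); exact: Im_le_cmod.
Qed.

Variables (K : (R -> R) -> R) (a : R).
Hypothesis a0 : 0 < a.
Hypothesis Klin : forall (c : R) f g, bounded_mf f -> bounded_mf g ->
  K (fun y => c * f y + g y) = c * K f + K g.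
Hypothesis Kle : forall f g, bounded_mf f -> bounded_mf g ->
  (forall y, 0 < y <= a -> f y <= g y) -> K f <= K g.

Lemma K_eq f g : bounded_mf f -> bounded_mf g -> (forall y, 0 < y <= a -> f y = g y) -> K f = K g.
Proof.
move=> hf hg fg; apply/eqP; rewrite eq_le.
by apply/andP; split; apply: Kle => // y hy; rewrite fg.
Qed.

Lemma K_cst (c : R) : K (fun=> c) = c * K (fun=> 1).
Proof.
have c1 : bounded_mf (fun=> 1 : R) := bounded_mf_cst 1.
have c0 : bounded_mf (fun=> 0 : R) := bounded_mf_cst 0.
have e0 : K (fun=> 0) = 0.
  have := Klin 1 c0 c0; under [X in K X = _]eq_fun do rewrite mulr0 addr0.
  by rewrite mul1r => /esym; rewrite -[RHS]addr0 => /addrI.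
rewrite -[RHS]addr0 -e0 -Klin //; congr K; apply/funext => x.
by rewrite mulr1 addr0.
Qed.

Lemma K1_ge0 : 0 <= K (fun=> 1).
Proof.
rewrite -(mul0r (K (fun=> 1))) -K_cst; apply: Kle; [exact: bounded_mf_cst|exact: bounded_mf_cst|by []].
Qed.

(** The complex-linear extension of a positive functional [K], carried by [(0,
    a]], that is only given on real functions. *)
Definition cextend phi : R[i] := K (fun x => Re (phi x)) +i* K (fun x => Im (phi x)).

Lemma cextend_eq phi psi : bounded_cmf phi -> bounded_cmf psi ->
  (forall y, 0 < y <= a -> phi y = psi y) -> cextend phi = cextend psi.
Proof.
move=> [h1 h2] [h3 h4] h; rewrite /cextend.
by congr (_ +i* _); apply: K_eq => // y hy; rewrite h.
Qed.

Lemma cextend_lin (c : R[i]) phi psi : bounded_cmf phi -> bounded_cmf psi ->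
  cextend (fun y => c * phi y + psi y) = c * cextend phi + cextend psi.
Proof.
move=> [h1 h2] [h3 h4]; apply: complexP.
  rewrite ReD ReM /=.
  have -> : (fun x => Re (c * phi x + psi x)) =
     (fun x => Re c * Re (phi x) + ((- Im c) * Im (phi x) + Re (psi x))).
    by apply/funext => x; rewrite ReD ReM mulNr addrA.
  by rewrite !Klin //; [rewrite mulNr addrA|exact: bounded_mf_lin].
rewrite ImD ImM /=.
have -> : (fun x => Im (c * phi x + psi x)) =
   (fun x => Re c * Im (phi x) + (Im c * Re (phi x) + Im (psi x))).
  by apply/funext => x; rewrite ImD ImM addrA.
by rewrite !Klin //; [rewrite addrA|exact: bounded_mf_lin].
Qed.

(** The factor [2] comes from bounding real and imaginary parts separately. *)
Lemma cextend_bound phi (M : R) : bounded_cmf phi -> (forall y, 0 < y <= a -> cmod (phi y) <= M) ->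
  cmod (cextend phi) <= 2 * M * K (fun=> 1).
Proof.
move=> [h1 h2] hM.
have hb f : bounded_mf f -> (forall y, 0 < y <= a -> `|f y| <= M) -> `|K f| <= M * K (fun=> 1).
  move=> hf hfM; rewrite ler_norml -mulNr -!K_cst; apply/andP; split; apply: Kle => //;
    try exact: bounded_mf_cst.
    by move=> y /hfM; rewrite ler_norml => /andP[].
  by move=> y /hfM; rewrite ler_norml => /andP[].
apply: (le_trans (cmod_le_ReIm _)) => /=.
have -> : 2 * M * K (fun=> 1) = M * K (fun=> 1) + M * K (fun=> 1) by ring.
apply: lerD; apply: hb => // y hy; apply: le_trans (hM y hy); [exact: Re_le_cmod|exact: Im_le_cmod].
Qed.

Lemma cextendZ (c : R[i]) phi : bounded_cmf phi -> cextend (fun y => c * phi y) = c * cextend phi.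
Proof.
move=> h; have c0 : bounded_cmf (fun=> 0 : R[i]) := bounded_cmf_cst 0.
have e0 : cextend (fun=> 0) = 0 by rewrite /cextend /= K_cst mul0r.
rewrite -[RHS]addr0 -[X in _ = _ + X]e0 -cextend_lin //.
by congr cextend; apply/funext => x; rewrite addr0.
Qed.

Lemma cextend_sum (M : nat) (c : nat -> R[i]) (F : nat -> R -> R[i]) : (forall n, bounded_cmf (F n)) ->
  cextend (fun x => \sum_(0 <= n < M) c n * F n x) = \sum_(0 <= n < M) c n * cextend (F n).
Proof.
move=> h; have c0 : bounded_cmf (fun=> 0 : R[i]) := bounded_cmf_cst 0.
elim: M => [|M IH].
  rewrite big_geq // /cextend; under [X in K X +i* _]eq_fun do rewrite big_geq //.
  by under [X in _ +i* K X]eq_fun do rewrite big_geq //; rewrite /= K_cst mul0r.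
rewrite big_nat_recr //= -IH addrC -cextend_lin //; last first.
  by apply: bounded_cmf_sum => n; apply: bounded_cmfM => //; exact: bounded_cmf_cst.
by congr cextend; apply/funext => x; rewrite big_nat_recr //= addrC.
Qed.

Hypothesis K1 : K (fun=> 1) < 1.

(** Replaces the argument by its projection to [[0, a]], which makes
    exponentials bounded without changing them where [K] looks. *)
Definition clamp (y : R) : R := Num.max 0 (Num.min y a).

Lemma clamp_ge0 y : 0 <= clamp y. Proof. by rewrite le_max lexx. Qed.

Lemma clamp_le y : clamp y <= a.
Proof. by rewrite ge_max (ltW a0) ge_min lexx orbT. Qed.

Lemma clamp_id y : 0 < y <= a -> clamp y = y.
Proof. by move=> /andP[y0 ya]; rewrite /clamp (min_idPl ya); apply/max_idPr; exact: ltW. Qed.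

Lemma bounded_mf_clamp : bounded_mf clamp.
Proof.
split; last by exists a => y; rewrite ger0_norm ?clamp_ge0 // clamp_le.
by apply: measurable_maxr => //; exact: measurable_minr.
Qed.

Lemma clamp_exp_le (th : R[i]) y : - Re th * clamp y <= cmod th * a.
Proof.
apply: (@le_trans _ _ (cmod th * clamp y)); last first.
  by apply: ler_wpM2l; [exact: cmod_ge0|exact: clamp_le].
apply: ler_wpM2r; first exact: clamp_ge0.
by apply: le_trans (Re_le_cmod th); rewrite -normrN; exact: ler_norm.
Qed.

Lemma bounded_cmf_expclamp (th : R[i]) : bounded_cmf (fun y => cexp (- th * (clamp y)%:C)).
Proof. by apply: (bounded_cmf_cexp (N := cmod th * a)); [exact: bounded_mf_clamp.1|exact: clamp_exp_le]. Qed.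

Definition ladder_transform (th : R[i]) := cextend (fun y => cexp (- th * (clamp y)%:C)).

(** The weight that [K] misses; for [ladder_law], the probability that the
    walk never becomes positive. *)
Definition escape : R := 1 - K (fun=> 1).

Lemma escape_gt0 : 0 < escape. Proof. by rewrite subr_gt0. Qed.

(** Up to normalisation this is the Wiener-Hopf factor of the right
    half-plane; it is the reciprocal of the transform of [V]. *)
Definition rfactor (th : R[i]) : R[i] := (1 - ladder_transform th) / escape%:C.

Definition tilted_power (w : R[i]) (n : nat) (y : R) : R[i] :=
  cexp (- w * (clamp y)%:C) * (- (clamp y)%:C) ^+ n.

Lemma bounded_cmf_tilted_power w n : bounded_cmf (tilted_power w n).
Proof.
apply: bounded_cmfM; first exact: bounded_cmf_expclamp.
by apply: bounded_cmfX; apply: bounded_cmfN; apply: bounded_cmf_real; exact: bounded_mf_clamp.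
Qed.

(** Taylor coefficients of [rfactor] at [w]. *)
Definition rfactor_coef (w : R[i]) (n : nat) : R[i] :=
  ((n == 0%N)%:R - cextend (tilted_power w n) / n`!%:R) / escape%:C.

Lemma cmod_tilted_power w n y : cmod (tilted_power w n y) <= expR (cmod w * a) * a ^+ n.
Proof.
rewrite /tilted_power cmodM cmodX cmodN cmod_real ger0_norm ?clamp_ge0 // cmod_cexp Re_Nmulr.
apply: ler_pM; [exact: expR_ge0|by apply: exprn_ge0; exact: clamp_ge0|by rewrite ler_expR; exact: clamp_exp_le|].
by apply: lerXn2r; rewrite ?nnegrE ?clamp_ge0 ?(ltW a0) // clamp_le.
Qed.

Lemma exp_term_le (x : R) n : 0 <= x -> x ^+ n / n`!%:R <= expR x.
Proof.
move=> x0; apply: le_trans (exp_sum_le n.+1 x0).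
rewrite /exp_sum big_nat_recr //= lerDr; apply: sumr_ge0 => i _.
by apply: divr_ge0; [exact: exprn_ge0|exact: ler0n].
Qed.

Lemma entire_rfactor_coef w : entire (rfactor_coef w).
Proof.
move=> r r0; exists ((1 + 2 * expR (cmod w * a) * K (fun=> 1) * expR (a * r)) / escape) => n.
have pp := escape_gt0; have k0 := K1_ge0.
rewrite /rfactor_coef cmodM cmodV cmod_real (gtr0_norm pp) mulrAC; apply: ler_wpM2r.
  by rewrite invr_ge0 ltW.
apply: (@le_trans _ _ ((cmod ((n == 0%N)%:R : R[i]) + cmod (cextend (tilted_power w n) / n`!%:R)) * r ^+ n)).
  by apply: ler_wpM2r; [exact: exprn_ge0 (ltW r0)|exact: cmodB].
rewrite mulrDl; apply: lerD.
  case: n => [|n]; first by rewrite eqxx expr0 mulr1 cmod1.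
  by rewrite /= cmod0 mul0r.
rewrite cmodM cmodV cmod_nat.
have hk := cextend_bound (bounded_cmf_tilted_power w n) (fun y _ => cmod_tilted_power w n y).
have f0 : (0 : R) < n`!%:R by rewrite ltr0n fact_gt0.
apply: (@le_trans _ _ (2 * (expR (cmod w * a) * a ^+ n) * K (fun=> 1) / n`!%:R * r ^+ n)).
  apply: ler_wpM2r; first exact: exprn_ge0 (ltW r0).
  by apply: ler_wpM2r => //; rewrite invr_ge0 ltW.
have -> : 2 * (expR (cmod w * a) * a ^+ n) * K (fun=> 1) / n`!%:R * r ^+ n =
  2 * expR (cmod w * a) * K (fun=> 1) * ((a * r) ^+ n / n`!%:R).
  by rewrite exprMn; ring.
apply: ler_wpM2l; last by apply: exp_term_le; apply: mulr_ge0; exact: ltW.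
by apply: mulr_ge0 => //; apply: mulr_ge0 => //; exact: expR_ge0.
Qed.

Lemma exp_term_cvg0 (x : R) : x ^+ n / n`!%:R @[n --> \oo] --> (0 : R).
Proof. exact: (cvg_series_cvg_0 (is_cvg_series_exp_coeff x)). Qed.

Lemma rfactor_sub w u M : (0 < M)%N -> rfactor (w + u) - psum (rfactor_coef w) M u =
  - (cextend (fun y => cexp (- w * (clamp y)%:C) * (cexp (- u * (clamp y)%:C) - exp_sum M (- u * (clamp y)%:C)))) / escape%:C.
Proof.
move=> M0.
have -> : psum (rfactor_coef w) M u = (1 - \sum_(0 <= n < M) (u ^+ n / n`!%:R) * cextend (tilted_power w n)) / escape%:C.
  rewrite /psum /rfactor_coef.
  under eq_bigr => n _ do rewrite mulrAC mulrBl.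
  rewrite -mulr_suml sumrB; congr ((_ - _) / _).
    case: M M0 => // M _; rewrite big_nat_recl //= mul1r expr0 big1 ?addr0 // => n _.
    by rewrite mul0r.
  apply: eq_bigr => n _; ring.
rewrite /rfactor -mulrBl; congr (_ / _).
have cD : bounded_cmf (fun y => cexp (- w * (clamp y)%:C) *
     (cexp (- u * (clamp y)%:C) - exp_sum M (- u * (clamp y)%:C))).
  apply: bounded_cmfM; first exact: bounded_cmf_expclamp.
  apply: bounded_cmfD; first exact: bounded_cmf_expclamp.
  apply: bounded_cmfN; apply: bounded_cmf_sum => n; apply: bounded_cmfM; last exact: bounded_cmf_cst.
  apply: bounded_cmfX; apply: bounded_cmfM; first exact: bounded_cmf_cst.
  by apply: bounded_cmf_real; exact: bounded_mf_clamp.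
have cS : bounded_cmf (fun y => \sum_(0 <= n < M) (u ^+ n / n`!%:R) * tilted_power w n y).
  by apply: bounded_cmf_sum => n; apply: bounded_cmfM; [exact: bounded_cmf_cst|exact: bounded_cmf_tilted_power].
rewrite -cextend_sum; last by move=> n; exact: bounded_cmf_tilted_power.
suff -> : ladder_transform (w + u) = 1 * cextend (fun y => cexp (- w * (clamp y)%:C) *
     (cexp (- u * (clamp y)%:C) - exp_sum M (- u * (clamp y)%:C)))
   + cextend (fun y => \sum_(0 <= n < M) (u ^+ n / n`!%:R) * tilted_power w n y).
  have e (D S : R[i]) : 1 - (1 * D + S) - (1 - S) = - D by ring.
  exact: e.
rewrite -(cextend_lin 1 cD cS); congr cextend; apply/funext => y.
rewrite mul1r mulrBr -cexpD opprD mulrDl.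
have -> : \sum_(0 <= n < M) u ^+ n / n`!%:R * tilted_power w n y =
   cexp (- w * (clamp y)%:C) * exp_sum M (- u * (clamp y)%:C).
  rewrite /exp_sum mulr_sumr; apply: eq_bigr => n _.
  by rewrite /tilted_power mulrCA mulrAC -exprMn mulrN -mulNr.
by rewrite subrK.
Qed.

(** The exponential series converges uniformly on [[0, a]], and [K] is
    continuous for uniform convergence there ([cextend_bound]). *)
Lemma rfactor_pser w u : rfactor (w + u) = pser (rfactor_coef w) u.
Proof.
apply: entire_pser_unique; first exact: entire_rfactor_coef.
have pp := escape_gt0; have k0 := K1_ge0.
pose C : R := 2 * expR (cmod w * a) * expR (cmod u * a) * K (fun=> 1) / escape.
have hC : C * ((cmod u * a) ^+ n / n`!%:R) @[n --> \oo] --> (0 : R).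
  by rewrite -[X in _ --> X](mulr0 C); apply: cvgMr; exact: exp_term_cvg0.
apply: (squeeze_cvgr _ (cvg_cst (0 : R)) hC).
exists 1%N => // M /= M0; rewrite cmod_ge0 /= rfactor_sub // cmodM cmodN cmodV cmod_real (gtr0_norm pp).
rewrite /C [leRHS]mulrAC; apply: ler_wpM2r; first by rewrite invr_ge0 ltW.
pose B : R := expR (cmod w * a) * ((cmod u * a) ^+ M / M`!%:R * expR (cmod u * a)).
apply: (@le_trans _ _ (2 * B * K (fun=> 1))); last first.
  by rewrite le_eqVlt; apply/orP; left; apply/eqP; rewrite /B; ring.
apply: cextend_bound.
  apply: bounded_cmfM; first exact: bounded_cmf_expclamp.
  apply: bounded_cmfD; first exact: bounded_cmf_expclamp.
  apply: bounded_cmfN; apply: bounded_cmf_sum => n; apply: bounded_cmfM; last exact: bounded_cmf_cst.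
  apply: bounded_cmfX; apply: bounded_cmfM; first exact: bounded_cmf_cst.
  by apply: bounded_cmf_real; exact: bounded_mf_clamp.
move=> y _; rewrite cmodM; apply: ler_pM; [exact: cmod_ge0|exact: cmod_ge0| |].
  by rewrite cmod_cexp Re_Nmulr ler_expR; exact: clamp_exp_le.
apply: (le_trans (cexp_taylor _ _)).
have hu : cmod (- u * (clamp y)%:C) <= cmod u * a.
  rewrite cmodM cmodN cmod_real (ger0_norm (clamp_ge0 y)).
  by apply: ler_wpM2l; [exact: cmod_ge0|exact: clamp_le].
apply: ler_pM; [|exact: expR_ge0| |by rewrite ler_expR].
  by apply: divr_ge0; [apply: exprn_ge0; exact: cmod_ge0|exact: ler0n].
apply: ler_wpM2r; first by rewrite invr_ge0 ler0n.
by apply: lerXn2r => //; rewrite nnegrE; [exact: cmod_ge0|exact: le_trans (cmod_ge0 _) hu].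
Qed.

Lemma rfactor_pser0 u : rfactor u = pser (rfactor_coef 0) u.
Proof. by rewrite -rfactor_pser add0r. Qed.

Lemma analytic_rfactor w : analytic_at rfactor w.
Proof.
have [B hB] := @entire_rfactor_coef w 1 ltr01.
apply/analytic_atP; exists (rfactor_coef w), 1, B; split => // t _.
by rewrite -rfactor_pser addrC subrK.
Qed.

Lemma coefL00 : rfactor_coef 0 0%N = 1.
Proof.
have pp := escape_gt0.
have -> : rfactor_coef 0 0%N = (escape%:C) / escape%:C.
  rewrite /rfactor_coef /= fact0 divr1; congr (_ / _).
  have -> : tilted_power 0 0 = (fun=> 1).
    by apply/funext => y; rewrite /tilted_power expr0 mulr1 oppr0 mul0r cexp0.
  by rewrite /cextend /= [K (fun=> 0)]K_cst mul0r /escape rmorphB /=.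
by rewrite divff // fmorph_eq0 lt0r_neq0.
Qed.

Lemma Im_coefL01 : Im (rfactor_coef 0 1%N) = 0.
Proof.
have hm : tilted_power 0 1 = (fun y => (- clamp y)%:C).
  by apply/funext => y; rewrite /tilted_power expr1 oppr0 mul0r cexp0 mul1r rmorphN.
have hk : Im (cextend (tilted_power 0 1)) = 0 by rewrite hm /cextend /= [K (fun=> 0)]K_cst mul0r.
have -> : rfactor_coef 0 1 = - cextend (tilted_power 0 1) * (escape^-1)%:C.
  by rewrite /rfactor_coef sub0r (_ : (1`!)%:R = 1 :> R[i]) // divr1 fmorphV.
by rewrite ImM ImN hk oppr0 mulr0 mul0r addr0.
Qed.

Lemma rfactor_growth t : cmod (rfactor t) <= (1 + 2 * K (fun=> 1)) / escape * expR (a * cmod t).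
Proof.
have pp := escape_gt0; have k0 := K1_ge0.
rewrite /rfactor cmodM cmodV cmod_real (gtr0_norm pp) [leRHS]mulrAC.
apply: ler_wpM2r; first by rewrite invr_ge0 ltW.
apply: (le_trans (cmodB _ _)); rewrite cmod1 mulrDl mul1r; apply: lerD.
  rewrite -expR0 ler_expR; apply: mulr_ge0; [exact: ltW|exact: cmod_ge0].
apply: (le_trans (cextend_bound (M := expR (a * cmod t)) (bounded_cmf_expclamp t) _)).
  by move=> y _; rewrite cmod_cexp Re_Nmulr ler_expR mulrC [leRHS]mulrC mulrC; exact: clamp_exp_le.
by rewrite le_eqVlt; apply/orP; left; apply/eqP; ring.
Qed.

Lemma rfactor_pos_bound (x : R) : 0 <= x -> cmod (rfactor x%:C) <= (1 + 2 * K (fun=> 1)) / escape.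
Proof.
move=> x0; have pp := escape_gt0; have k0 := K1_ge0.
rewrite /rfactor cmodM cmodV cmod_real (gtr0_norm pp).
apply: ler_wpM2r; first by rewrite invr_ge0 ltW.
apply: (le_trans (cmodB _ _)); rewrite cmod1; apply: lerD => //.
rewrite -[X in X * _]mulr1; apply: cextend_bound; first exact: bounded_cmf_expclamp.
move=> y _; rewrite cmod_cexp Re_Nmulr /= -expR0 ler_expR mulNr oppr_le0.
by apply: mulr_ge0 => //; exact: clamp_ge0.
Qed.

Lemma growth_const_ge1 : 1 <= (1 + 2 * K (fun=> 1)) / escape.
Proof.
have pp := escape_gt0; have k0 := K1_ge0.
by rewrite ler_pdivlMr // mul1r /escape; lra.
Qed.

End Complexify.

(** * Wiener-Hopf identities for transforms *)

Section ComplexExpectation.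
Context d (T : measurableType d) (R : realType) (P : probability T R).
Implicit Types (f g : T -> R[i]).

Definition cmean f : R[i] := mean P (fun t => Re (f t)) +i* mean P (fun t => Im (f t)).

Definition finite_cmean f := finite_mean P (fun t => Re (f t)) /\ finite_mean P (fun t => Im (f t)).

Lemma cmeanE f : cexpectation P f = cmean f.
Proof. by rewrite /cexpectation unlock. Qed.

Lemma cmeanZ (c : R[i]) f : finite_cmean f -> cmean (fun t => c * f t) = c * cmean f.
Proof.
move=> [h1 h2]; apply: complexP; rewrite ?ReM ?ImM /=.
  have -> : (fun t => Re (c * f t)) = (fun t => Re c * Re (f t) - Im c * Im (f t)).
    by apply/funext => t; rewrite ReM.
  by rewrite meanB; [rewrite !meanZ|exact: finite_meanZ|exact: finite_meanZ].
have -> : (fun t => Im (c * f t)) = (fun t => Re c * Im (f t) + Im c * Re (f t)).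
  by apply/funext => t; rewrite ImM.
by rewrite meanD; [rewrite !meanZ|exact: finite_meanZ|exact: finite_meanZ].
Qed.

Lemma finite_cmean_bounded_cmf (phi : R -> R[i]) (X : T -> R) : bounded_cmf phi -> measurable_fun setT X ->
  finite_cmean (fun t => phi (X t)).
Proof. by move=> [h1 h2] mX; split; [exact: (bounded_mf_finite_mean P h1 mX)|exact: (bounded_mf_finite_mean P h2 mX)]. Qed.

Lemma finite_cmean_exp (th : R[i]) (X : T -> R) : measurable_fun setT X ->
  finite_mean P (fun t => expR (- Re th * X t)) -> finite_cmean (fun t => cexp (- th * (X t)%:C)).
Proof.
move=> mX iX; have [m1 m2] := measurable_cexp th mX.
have h t : cmod (cexp (- th * (X t)%:C)) <= expR (- Re th * X t) by rewrite cmod_cexp Re_Nmulr.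
split; [apply: (finite_mean_dom m1 _ iX) => t|apply: (finite_mean_dom m2 _ iX) => t].
  exact: le_trans (Re_le_cmod _) (h t).
exact: le_trans (Im_le_cmod _) (h t).
Qed.

Lemma bounded_cmf_cmean (phi : R -> R[i]) (X : T -> R) : bounded_cmf phi -> measurable_fun setT X ->
  bounded_cmf (fun y => cmean (fun t => phi (y + X t))).
Proof. by move=> [h1 h2] mX; split; [exact: (bounded_mf_mean_shift P h1 mX)|exact: (bounded_mf_mean_shift P h2 mX)]. Qed.

Variables (U V : T -> R) (a : R) (K : (R -> R) -> R).
Hypothesis mU : measurable_fun setT U.
Hypothesis mV : measurable_fun setT V.
Hypothesis V0 : forall t, 0 <= V t.
Hypothesis Ua : forall t, U t <= a.
Hypothesis a0 : 0 < a.
Hypothesis Klin : forall (c : R) (f g : R -> R), bounded_mf f -> bounded_mf g ->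
  K (fun y => c * f y + g y) = c * K f + K g.
Hypothesis Kle : forall f g : R -> R, bounded_mf f -> bounded_mf g ->
  (forall y, 0 < y <= a -> f y <= g y) -> K f <= K g.
Hypothesis K1 : K (fun=> 1) < 1.
Hypothesis KV : forall f : R -> R, bounded_mf f -> mean P (fun t => f (V t)) =
  K (fun x => mean P (fun t => f (x + V t))) + (1 - K (fun=> 1)) * f 0.

(** Minus the idle time before an arrival. *)
Definition idle t : R := Num.min (V t + U t) 0.
Hypothesis KU : forall f : R -> R, bounded_mf f ->
  (1 - K (fun=> 1)) * mean P (fun t => f (U t)) + f 0
    + K (fun x => mean P (fun t => f (x + idle t))) =
  (1 - K (fun=> 1)) * f 0 + mean P (fun t => f (idle t)) + K f.

Local Notation escape := (escape K).

Lemma measurable_idle : measurable_fun setT idle.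
Proof. by apply: measurable_minr => //; exact: measurable_funD. Qed.

Lemma idle_le0 t : idle t <= 0.
Proof. by rewrite ge_min lexx orbT. Qed.

Lemma Re_pmul (c : R) (w : R[i]) : Re (c%:C * w) = c * Re w.
Proof. by rewrite ReM /= mul0r subr0. Qed.

Lemma Im_pmul (c : R) (w : R[i]) : Im (c%:C * w) = c * Im w.
Proof. by rewrite ImM /= mul0r addr0. Qed.

Lemma cextend_V (phi : R -> R[i]) : bounded_cmf phi -> cmean (fun t => phi (V t)) =
  cextend K (fun x => cmean (fun t => phi (x + V t))) + escape%:C * phi 0.
Proof.
move=> [h1 h2]; apply: complexP.
  by rewrite ReD Re_pmul; exact: (KV h1).
by rewrite ImD Im_pmul; exact: (KV h2).
Qed.

Lemma cextend_U (phi : R -> R[i]) : bounded_cmf phi ->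
  escape%:C * cmean (fun t => phi (U t)) + phi 0 + cextend K (fun x => cmean (fun t => phi (x + idle t))) =
  escape%:C * phi 0 + cmean (fun t => phi (idle t)) + cextend K phi.
Proof.
move=> [h1 h2]; apply: complexP.
  by rewrite !ReD !Re_pmul; exact: (KU h1).
by rewrite !ImD !Im_pmul; exact: (KU h2).
Qed.

(** [cextend_V] for an exponential: [exp (- th (x + V))] is a product. *)
Lemma laplace_rfactor (th : R[i]) : 0 <= Re th ->
  cmean (fun t => cexp (- th * (V t)%:C)) * rfactor K a th = 1.
Proof.
(* Bounded everywhere, and an exponential on the values of [V]. *)
move=> th0; pose phi (x : R) : R[i] := cexp (- th * (Num.max x 0)%:C).
have pp : escape != 0 by apply: lt0r_neq0; exact: escape_gt0.
have cphi : bounded_cmf phi.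
  apply: (bounded_cmf_cexp (N := 0)); first exact: measurable_maxr.
  by move=> x; rewrite mulNr oppr_le0; apply: mulr_ge0 => //; rewrite le_max lexx orbT.
have cV : bounded_cmf (fun y => cmean (fun t => phi (y + V t))) by exact: bounded_cmf_cmean.
have iV : finite_cmean (fun t => phi (V t)) by exact: finite_cmean_bounded_cmf.
have phiV t : phi (V t) = cexp (- th * (V t)%:C).
  by rewrite /phi max_l.
have e1 : cmean (fun t => phi (V t)) = cmean (fun t => cexp (- th * (V t)%:C)).
  by congr cmean; apply/funext => t; exact: phiV.
have h := cextend_V cphi.
have e2 : cextend K (fun x => cmean (fun t => phi (x + V t))) = cmean (fun t => phi (V t)) * ladder_transform K a th.
  rewrite /ladder_transform -(cextendZ Klin); last exact: bounded_cmf_expclamp.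
  apply: (cextend_eq Kle cV); first by apply: bounded_cmfM; [exact: bounded_cmf_cst|exact: bounded_cmf_expclamp].
  move=> y hy; rewrite (clamp_id hy) mulrC -(cmeanZ _ iV); congr cmean; apply/funext => t.
  have /andP[y0 _] := hy.
  rewrite phiV /phi max_l; last by apply: addr_ge0 => //; exact: ltW.
  by rewrite -cexpD rmorphD /= mulrDr.
have p00 : phi 0 = 1 by rewrite /phi maxxx mulr0 cexp0.
rewrite e2 e1 p00 in h.
have alg (F : fieldType) (p v k : F) : p != 0 -> v = v * k + p * 1 -> v * ((1 - k) / p) = 1.
  by move=> hp hh; rewrite mulrA mulrBr mulr1 {1}hh addrAC subrr add0r mulr1 divff.
by apply: alg h; rewrite fmorph_eq0.
Qed.

(** [cextend_U] for an exponential. The truncation at [a] makes it bounded;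
    none of the arguments [U], [idle] and [x + idle], [x <= a], exceeds [a]. *)
Lemma F_rfactor (th : R[i]) : Re th < 0 ->
  cmean (fun t => cexp (- th * (U t)%:C)) - 1 =
  rfactor K a th * (cmean (fun t => cexp (- th * (idle t)%:C)) - 1).
Proof.
move=> th0; pose phi (x : R) : R[i] := cexp (- th * (Num.min x a)%:C).
have pp : escape != 0 by apply: lt0r_neq0; exact: escape_gt0.
have cphi : bounded_cmf phi.
  apply: (bounded_cmf_cexp (N := - Re th * a)); first exact: measurable_minr.
  move=> x; apply: ler_wpM2l; first by rewrite oppr_ge0 ltW.
  by rewrite ge_min lexx orbT.
have mW := measurable_idle.
have cW : bounded_cmf (fun y => cmean (fun t => phi (y + idle t))) by exact: bounded_cmf_cmean.
have iW : finite_cmean (fun t => phi (idle t)) by exact: finite_cmean_bounded_cmf.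
have phia x : x <= a -> phi x = cexp (- th * x%:C) by move=> xa; rewrite /phi min_l.
have Wa t : idle t <= a by apply: le_trans (idle_le0 t) (ltW a0).
have eW : cmean (fun t => phi (idle t)) = cmean (fun t => cexp (- th * (idle t)%:C)).
  by congr cmean; apply/funext => t; exact: phia.
have eU : cmean (fun t => phi (U t)) = cmean (fun t => cexp (- th * (U t)%:C)).
  by congr cmean; apply/funext => t; exact: phia.
have h := cextend_U cphi.
have e2 : cextend K (fun x => cmean (fun t => phi (x + idle t))) =
    cmean (fun t => phi (idle t)) * ladder_transform K a th.
  rewrite /ladder_transform -(cextendZ Klin); last exact: bounded_cmf_expclamp.
  apply: (cextend_eq Kle cW); first by apply: bounded_cmfM; [exact: bounded_cmf_cst|exact: bounded_cmf_expclamp].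
  move=> y hy; rewrite (clamp_id hy) mulrC -(cmeanZ _ iW); congr cmean; apply/funext => t.
  have /andP[y0 ya] := hy.
  rewrite !phia //; first by rewrite -cexpD rmorphD /= mulrDr.
  by apply: le_trans ya; rewrite gerDl; exact: idle_le0.
have e3 : cextend K phi = ladder_transform K a th.
  apply: (cextend_eq Kle cphi); first exact: bounded_cmf_expclamp.
  by move=> y hy; rewrite (clamp_id hy) phia //; case/andP: hy.
have p00 : phi 0 = 1 by rewrite phia ?(ltW a0) // mulr0 cexp0.
rewrite e2 e3 eW eU p00 in h.
have alg (F : fieldType) (p u w k : F) : p != 0 ->
    p * u + 1 + w * k = p * 1 + w + k -> u - 1 = (1 - k) / p * (w - 1).
  move=> hp hh; have e : p * u = p * 1 + w + k - w * k - 1.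
    by rewrite -hh; ring.
  apply: (mulfI hp); rewrite mulrBr e; field; exact: hp.
by apply: alg h; rewrite fmorph_eq0.
Qed.

End ComplexExpectation.

(** * Transform of a nonpositive variable *)

Section NegativeVariable.
Context d (T : measurableType d) (R : realType) (P : probability T R).
Variable W : T -> R.
Hypothesis mW : measurable_fun setT W.
Hypothesis W0 : forall t, W t <= 0.
Local Notation E := (mean P).

(** For [s > 0] it is positive unless [W] vanishes almost surely. *)
Definition defect (s : R) : R := 1 - E (fun t => expR (s * W t)).

Lemma finite_mean_expW (s : R) : 0 <= s -> finite_mean P (fun t => expR (s * W t)).
Proof.
move=> s0; apply: (@finite_mean_bnd _ _ _ _ _ 1).
  by apply: measurableT_comp; [exact: measurable_expR|exact: measurable_funM].
move=> t; rewrite ger0_norm ?expR_ge0 // -expR0 ler_expR.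
by apply: mulr_ge0_le0.
Qed.

Lemma defectE (s : R) : 0 <= s -> defect s = E (fun t => 1 - expR (s * W t)).
Proof. by move=> s0; rewrite meanB; [rewrite mean_cst|exact: finite_mean_cst|exact: finite_mean_expW]. Qed.

Lemma finite_mean_defect (s : R) : 0 <= s -> finite_mean P (fun t => 1 - expR (s * W t)).
Proof. by move=> s0; apply: finite_meanB; [exact: finite_mean_cst|exact: finite_mean_expW]. Qed.

Lemma defect_ge0 (s : R) : 0 <= s -> 0 <= defect s.
Proof.
move=> s0; rewrite defectE //; apply: mean_ge0 => t; rewrite subr_ge0 -expR0 ler_expR.
exact: mulr_ge0_le0.
Qed.

Lemma defect_le1 (s : R) : defect s <= 1.
Proof. by rewrite gerBl; apply: mean_ge0 => t; exact: expR_ge0. Qed.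

Lemma defect_mono (s s' : R) : 0 <= s -> s <= s' -> defect s <= defect s'.
Proof.
move=> s0 ss'; rewrite lerD2l lerN2; apply: mean_le; [|exact: finite_mean_expW|].
  by apply: finite_mean_expW; exact: le_trans ss'.
by move=> t; rewrite ler_expR ler_wnM2r.
Qed.

Lemma bernoulli_one_sub (x : R) n : 0 <= x <= 1 -> 1 - x ^+ n <= n%:R * (1 - x).
Proof.
move=> /andP[x0 x1]; elim: n => [|n IH]; first by rewrite expr0 subrr mul0r.
have xn : x ^+ n <= 1 by exact: exprn_ile1.
have h : 1 - x ^+ n.+1 = (1 - x) + x * (1 - x ^+ n) by rewrite exprS; ring.
rewrite h -[n.+1]add1n natrD mulrDl mul1r lerD2l.
apply: le_trans IH; rewrite -[leRHS]mul1r; apply: ler_wpM2r => //.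
by rewrite subr_ge0.
Qed.

Lemma defect_mul (s : R) n : 0 <= s -> defect (n%:R * s) <= n%:R * defect s.
Proof.
move=> s0; have ns0 : 0 <= n%:R * s by apply: mulr_ge0 => //; exact: ler0n.
rewrite !defectE // -meanZ; last exact: finite_mean_defect.
apply: mean_le; [exact: finite_mean_defect|by apply: finite_meanZ; exact: finite_mean_defect|].
move=> t; rewrite -mulrA expRM_natl; apply: bernoulli_one_sub.
rewrite expR_ge0 /= -expR0 ler_expR; exact: mulr_ge0_le0.
Qed.

(** [defect (n s) <= n * defect s] reduces the claim to large [s], where
    [defect] is at least [defect 1]. *)
Lemma defect_gt0 (s : R) : 0 < defect 1 -> 0 < s -> 0 < defect s.
Proof.
move=> d1 s0; have [n hn] : exists n : nat, 1 <= n%:R * s.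
  exists (Num.bound s^-1); rewrite -ler_pdivrMr // mul1r ltW //.
  by apply: archi_boundP; rewrite invr_ge0 ltW.
have h : 0 < n%:R * defect s.
  apply: lt_le_trans (defect_mul n (ltW s0)).
  by apply: lt_le_trans d1 _; exact: defect_mono.
have := defect_ge0 (ltW s0); rewrite le_eqVlt => /orP[/eqP e|//].
by move: h; rewrite -e mulr0 ltxx.
Qed.

Lemma finite_cmean_W (th : R[i]) : Re th <= 0 -> finite_cmean P (fun t => cexp (- th * (W t)%:C)).
Proof. by move=> h; apply: finite_cmean_exp => //; apply: finite_mean_expW; rewrite oppr_ge0. Qed.

Lemma cmean_W_real (x : R) :
  cmean P (fun t => cexp (- x%:C * (W t)%:C)) = (E (fun t => expR (- x * W t)))%:C.
Proof.
have h t : cexp (- x%:C * (W t)%:C) = (expR (- x * W t))%:C.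
  by rewrite -rmorphN -rmorphM cexp_real.
rewrite /cmean; congr (_ +i* _); first by congr mean; apply/funext => t; rewrite h.
by rewrite -[RHS](mean_cst P); congr mean; apply/funext => t; rewrite h.
Qed.

Definition lfactor (th : R[i]) := cmean P (fun t => cexp (- th * (W t)%:C)) - 1.

Lemma lfactor_real (x : R) : lfactor (- x)%:C = (- defect x)%:C.
Proof.
rewrite /lfactor cmean_W_real opprK /defect opprB rmorphB /=.
by congr (_ - _).
Qed.

(** Its real part is at most [- defect (- Re th)]. *)
Lemma lfactor_neq0 (th : R[i]) : 0 < defect 1 -> Re th < 0 -> lfactor th != 0.
Proof.
move=> d1 th0; have s0 : 0 < - Re th by rewrite oppr_gt0.
have hd := defect_gt0 d1 s0.
apply/eqP => h; suff : Re (lfactor th) <= - defect (- Re th).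
  by rewrite h /= lerNr oppr0 leNgt hd.
rewrite /lfactor /defect ReD ReN /= opprB lerD2r; apply: mean_le.
- by case: (finite_cmean_W (ltW th0)).
- exact: finite_mean_expW (ltW s0).
- move=> t; have h1 := Re_le_cmod (cexp (- th * (W t)%:C)).
  by rewrite cmod_cexp Re_Nmulr in h1; exact: le_trans (ler_norm _) h1.
Qed.

(** [|exp (- u x) - 1| <= |u x| exp |u x|], and half of the decay of [exp (-
    th x)] absorbs the growth of the exponential, the other half the factor
    [|x|]. *)
Lemma exp_lipschitz (th u : R[i]) (x : R) : Re th < 0 -> x <= 0 ->
  cmod u <= - Re th / 2 ->
  cmod (cexp (- (th + u) * x%:C) - cexp (- th * x%:C)) <= cmod u * (2 / - Re th).
Proof.
move=> th0 x0 hu; have s0 : 0 < - Re th by rewrite oppr_gt0.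
have -> : cexp (- (th + u) * x%:C) - cexp (- th * x%:C) =
    cexp (- th * x%:C) * (cexp (- u * x%:C) - 1).
  by rewrite opprD mulrDl cexpD mulrBr mulr1.
rewrite cmodM cmod_cexp Re_Nmulr.
have h := cexp_taylor 1 (- u * x%:C).
have e1 : exp_sum 1 (- u * x%:C) = 1 by rewrite /exp_sum big_nat1 expr0 divr1.
rewrite e1 expr1 (_ : 1`!%:R = 1 :> R) // divr1 cmodM cmodN cmod_real (ler0_norm x0) in h.
set y := - x in h; have y0 : 0 <= y by rewrite oppr_ge0.
have ey : - Re th * x = - (- Re th * y) by rewrite /y; ring.
rewrite ey; set s := - Re th in hu s0 *.
apply: (@le_trans _ _ (expR (- (s * y)) * (cmod u * y * expR (cmod u * y)))).
  by apply: ler_wpM2l => //; exact: expR_ge0.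
apply: (@le_trans _ _ (expR (- (s * y)) * (cmod u * y * expR (s / 2 * y)))).
  apply: ler_wpM2l; first exact: expR_ge0.
  apply: ler_wpM2l; first by apply: mulr_ge0 => //; exact: cmod_ge0.
  by rewrite ler_expR; apply: ler_wpM2r.
have -> : expR (- (s * y)) * (cmod u * y * expR (s / 2 * y)) = cmod u * (y * expR (- (s / 2 * y))).
  have -> : - (s / 2 * y) = - (s * y) + s / 2 * y by field.
  by rewrite expRD; ring.
apply: ler_wpM2l; first exact: cmod_ge0.
rewrite expRN ler_pdivrMr ?expR_gt0 //.
have := expR_ge1Dx (s / 2 * y) => h2.
apply: (@le_trans _ _ (2 / s * (1 + s / 2 * y))).
  have -> : 2 / s * (1 + s / 2 * y) = 2 / s + y by field; rewrite lt0r_neq0.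
  by rewrite lerDr divr_ge0 // ltW.
by apply: ler_wpM2l => //; rewrite divr_ge0 // ltW.
Qed.

Lemma lfactor_continuous (th : R[i]) : Re th < 0 -> {for th, continuous lfactor}.
Proof.
move=> th0; have s0 : 0 < - Re th by rewrite oppr_gt0.
apply/continuous_cmod => e e0.
pose C : R := 2 * (2 / - Re th); have C0 : 0 < C by rewrite !mulr_gt0 // invr_gt0.
exists (Num.min (- Re th / 2) (e / C)); first by rewrite lt_min !divr_gt0.
move=> t; rewrite lt_min => /andP[t1 t2].
have eu : t = th + (t - th) by rewrite addrC subrK.
set u := t - th in t1 t2 eu.
have ht0 : Re t <= 0.
  by rewrite eu ReD; have := Re_le_cmod u; rewrite ler_norml => /andP[_ h]; lra.
have [i1 i2] := finite_cmean_W ht0; have [i3 i4] := finite_cmean_W (ltW th0).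
have hb x : cmod (cexp (- t * (W x)%:C) - cexp (- th * (W x)%:C)) <= cmod u * (2 / - Re th).
  by rewrite eu; apply: exp_lipschitz => //; exact: ltW.
apply: (@le_lt_trans _ _ (cmod u * C)); last by rewrite -ltr_pdivlMr.
have -> : lfactor t - lfactor th = cmean P (fun x => cexp (- t * (W x)%:C)) - cmean P (fun x => cexp (- th * (W x)%:C)).
  by rewrite /lfactor opprB addrA subrK.
apply: (le_trans (cmod_le_ReIm _)); rewrite ReD ImD ReN ImN /=.
have -> : cmod u * C = cmod u * (2 / - Re th) + cmod u * (2 / - Re th) by rewrite /C; ring.
rewrite -!meanB //; apply: lerD.
  rewrite -[leRHS](mean_cst P); apply: mean_norm; [exact: finite_meanB|exact: finite_mean_cst|] => x.
  by apply: le_trans (hb x); apply: le_trans (Re_le_cmod _); rewrite ReD ReN.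
rewrite -[leRHS](mean_cst P); apply: mean_norm; [exact: finite_meanB|exact: finite_mean_cst|] => x.
by apply: le_trans (hb x); apply: le_trans (Im_le_cmod _); rewrite ImD ImN.
Qed.

End NegativeVariable.

(** * The increment of the queue *)

(** [e x <= exp (e x)]. *)
Lemma finite_mean_of_exp d (T : measurableType d) (R : realType) (P : probability T R)
    (X : T -> R) (e : R) : measurable_fun setT X -> (forall t, 0 <= X t) -> 0 < e ->
  finite_mean P (fun t => expR (e * X t)) -> finite_mean P X.
Proof.
move=> mX X0 e0 iXe.
apply: (finite_mean_dom mX _ (finite_meanZ e^-1 iXe)) => t; rewrite ger0_norm // mulrC ler_pdivlMr // mulrC.
by apply: le_trans (expR_ge1Dx _); rewrite lerDr.
Qed.

Section Increment.
Context d (T : measurableType d) (R : realType) (P : probability T R).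
Variables X Y : T -> R.
Hypothesis mX : measurable_fun setT X.
Hypothesis mY : measurable_fun setT Y.
Hypothesis X0 : forall t, 0 <= X t.
Hypothesis XY : independent_rv P X Y.
Local Notation E := (mean P).

Lemma finite_mean_exp_sub (s : R) : 0 <= s -> finite_mean P (fun t => expR (s * Y t)) ->
  finite_mean P (fun t => expR (s * (Y t - X t))).
Proof.
move=> s0 iY; apply: (finite_mean_dom _ _ iY).
  apply: measurableT_comp; first exact: measurable_expR.
  by apply: measurable_funM => //; exact: measurable_funB.
move=> t; rewrite ger0_norm ?expR_ge0 // ler_expR; apply: ler_wpM2l => //.
by rewrite gerBl.
Qed.

Lemma cmean_sub (th : R[i]) : Re th <= 0 -> finite_mean P (fun t => expR (- Re th * Y t)) ->
  cmean P (fun t => cexp (- th * (Y t - X t)%:C)) =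
  cmean P (fun t => cexp (- th * (Y t)%:C)) * cmean P (fun t => cexp (- - th * (X t)%:C)).
Proof.
move=> th0 iY; have s0 : 0 <= - Re th by rewrite oppr_ge0.
(* Only for nonnegative arguments is the exponential of [y - x] dominated by
   that of [y]; the truncation does not change [X]. *)
pose g (z : R * R) : R := z.2 - Num.max z.1 0.
have mg : measurable_fun setT g.
  by apply: measurable_funB => //; exact: measurable_maxr.
have [mR mI] := measurable_cexp th mg.
pose G (y : R) := expR (- Re th * y).
have mG : measurable_fun setT G.
  by apply: measurableT_comp; [exact: measurable_expR|exact: measurable_funM].
have hG x y : cmod (cexp (- th * (g (x, y))%:C)) <= G y.
  rewrite cmod_cexp Re_Nmulr ler_expR; apply: ler_wpM2l => //.
  by rewrite gerBl le_max lexx orbT.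
have fR := independent_fubini mX mY mR mG XY iY
  (fun x y => le_trans (Re_le_cmod _) (hG x y)).
have fI := independent_fubini mX mY mI mG XY iY
  (fun x y => le_trans (Im_le_cmod _) (hG x y)).
have gE t t' : g (X t, Y t') = Y t' - X t by rewrite /g /= max_l.
have iX : finite_cmean P (fun t => cexp (- - th * (X t)%:C)).
  apply: finite_cmean_exp => //; apply: (@finite_mean_bnd _ _ _ _ _ 1).
    by apply: measurableT_comp; [exact: measurable_expR|exact: measurable_funM].
  move=> t; rewrite ger0_norm ?expR_ge0 // -expR0 ler_expR ReN opprK.
  by apply: mulr_le0_ge0.
have iYc : finite_cmean P (fun t => cexp (- th * (Y t)%:C)) by exact: finite_cmean_exp.
rewrite mulrC -(cmeanZ _ iYc).
have e1 t : cmean P (fun t' => cexp (- th * (g (X t', Y t))%:C)) =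
    cmean P (fun t' => cexp (- - th * (X t')%:C)) * cexp (- th * (Y t)%:C).
  rewrite mulrC -(cmeanZ _ iX); congr cmean; apply/funext => t'.
  by rewrite -cexpD gE rmorphB /= mulrBr !mulNr opprK.
have e2 : cmean P (fun t => cexp (- th * (Y t - X t)%:C)) =
    cmean P (fun t => cexp (- th * (g (X t, Y t))%:C)).
  by congr cmean; apply/funext => t; rewrite gE.
rewrite e2; apply: complexP.
  by rewrite [LHS]fR; congr mean; apply/funext => t; rewrite -e1.
by rewrite [LHS]fI; congr mean; apply/funext => t; rewrite -e1.
Qed.

Lemma queueF_cmean (th : R[i]) : Re th <= 0 -> finite_mean P (fun t => expR (- Re th * Y t)) ->
  queueF P X Y th = cmean P (fun t => cexp (- th * (Y t - X t)%:C)) - 1.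
Proof. by move=> h1 h2; rewrite cmean_sub // /queueF /laplace !cmeanE. Qed.

(** Markov's inequality for [exp (x (Y - X))] bounds the probability by [2 exp
    (- (b - c) x)] for every large [x]. *)
Lemma tail_null (c b x0 : R) : 0 <= c -> c < b ->
  (forall s, 0 <= s -> finite_mean P (fun t => expR (s * Y t))) ->
  (forall x, x0 <= x -> E (fun t => expR (x * (Y t - X t))) <= 1 + expR (c * x)) ->
  P [set t | b < Y t - X t] = 0%E.
Proof.
move=> c0 cb iY hx.
have mA : measurable [set t | b < Y t - X t].
  rewrite -[X in measurable X]setTI; apply: measurable_fun_ltr => //.
  exact: measurable_funB.
have i1 : finite_mean P (\1_[set t | b < Y t - X t] : T -> R).
  by apply: (@finite_mean_bnd _ _ _ _ _ 1) => // t; rewrite indicE ger0_norm // lern1; case: (_ \in _).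
have eA : (E (\1_[set t | b < Y t - X t]))%:E = P [set t | b < Y t - X t].
  by rewrite EFin_mean // integral_indic // setIT.
rewrite -eA; congr (_%:E); apply/eqP; rewrite eq_le; apply/andP; split; last first.
  by apply: mean_ge0 => t; rewrite indicE.
have hb x : 0 <= x -> x0 <= x -> E (\1_[set t | b < Y t - X t]) <= 2 * expR (- ((b - c) * x)).
  move=> xx0 xx; apply: (@le_trans _ _ (E (fun t => expR (- (b * x)) * expR (x * (Y t - X t))))).
    apply: mean_le => //; first by apply: finite_meanZ; apply: finite_mean_exp_sub => //; exact: iY.
    move=> t; rewrite indicE; case: (boolP (t \in _)) => ht; last by rewrite mulr_ge0 ?expR_ge0.
    move: ht; rewrite inE /= => ht; rewrite -expRD -[leLHS]/(1 : R) -expR0 ler_expR.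
    have -> : - (b * x) + x * (Y t - X t) = x * (Y t - X t - b) by ring.
    by apply: mulr_ge0 => //; rewrite subr_ge0 ltW.
  rewrite meanZ; last by apply: finite_mean_exp_sub => //; exact: iY.
  apply: (@le_trans _ _ (expR (- (b * x)) * (1 + expR (c * x)))).
    by apply: ler_wpM2l; [exact: expR_ge0|exact: hx].
  have e1 : 1 <= expR (c * x) by rewrite -expR0 ler_expR mulr_ge0.
  apply: (@le_trans _ _ (expR (- (b * x)) * (2 * expR (c * x)))).
    by apply: ler_wpM2l; [exact: expR_ge0|lra].
  by rewrite mulrCA -expRD (_ : - (b * x) + c * x = - ((b - c) * x)); [|ring].
have bc : 0 < b - c by rewrite subr_gt0.
apply/ler_addgt0Pr => e e0; rewrite add0r.
pose x := Num.max 0 (Num.max x0 (2 / (e * (b - c)))).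
have h1 : 0 <= x by rewrite le_max lexx.
have h2 : x0 <= x by rewrite /x !le_max lexx orbT.
apply: (le_trans (hb x h1 h2)).
have h3 : 2 / (e * (b - c)) <= x by rewrite /x !le_max lexx !orbT.
rewrite expRN ler_pdivrMr ?expR_gt0 //.
have h4 := expR_ge1Dx ((b - c) * x).
have h5 : 2 <= e * ((b - c) * x).
  by rewrite mulrA mulrC -ler_pdivrMr // mulr_gt0.
apply: (le_trans h5); apply: ler_wpM2l; first exact: ltW.
by apply: le_trans h4; rewrite lerDr.
Qed.

(** From [exp (- y) >= 1 - y]. *)
Lemma exp_quadratic (y : R) : y <= 1 / 2 -> expR y <= 1 + y + 2 * y ^+ 2.
Proof.
move=> hy; have h := expR_ge1Dx (- y).
have h1 : 0 < 1 - y by lra.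
rewrite -[y in expR y]opprK expRN.
apply: (@le_trans _ _ (1 - y)^-1).
  by rewrite lef_pV2 // posrE // expR_gt0.
rewrite -[leLHS]mul1r ler_pdivrMr //.
have -> : (1 + y + 2 * y ^+ 2) * (1 - y) = 1 + y ^+ 2 * (1 - 2 * y) by ring.
by rewrite lerDl mulr_ge0 // ?sqr_ge0 //; lra.
Qed.

Lemma sqr_le_exp (y : R) : 0 <= y -> y ^+ 2 <= 4 * expR y.
Proof.
move=> y0; have h := expR_ge1Dx (y / 2).
have -> : expR y = expR (y / 2) ^+ 2 by rewrite expr2 -expRD -splitr.
have h2 : (y / 2) ^+ 2 <= expR (y / 2) ^+ 2.
  by apply: lerXn2r; rewrite ?nnegrE ?expR_ge0 //; lra.
by move: h2; rewrite exprMn; lra.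
Qed.

(** To second order, [E exp (s U) <= 1 + s E U + 2 s^2 E U^2], where [E U < 0]
    and [E U^2] is finite: [U] is bounded above by [b] and below by [- X], and
    [X] has an exponential moment. *)
Lemma chernoff_bound (b e : R) : 0 < b -> 0 < e -> (forall t, 0 <= Y t) ->
  finite_mean P (fun t => expR (e * X t)) -> finite_mean P (fun t => expR (1 * Y t)) ->
  E Y < E X ->
  exists s q : R, [/\ 0 < s, q < 1 & E (fun t => expR (s * Num.min (Y t - X t) b)) <= q].
Proof.
move=> b0 e0 Y0 iXe iYe YX; pose U t := Num.min (Y t - X t) b.
have mU : measurable_fun setT U by apply: measurable_minr => //; exact: measurable_funB.
have iX : finite_mean P X := finite_mean_of_exp mX X0 e0 iXe.
have iX2 : finite_mean P (fun t => X t ^+ 2).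
  apply: (finite_mean_dom _ _ (finite_meanZ (4 / e ^+ 2) iXe)); first exact: measurable_funX.
  move=> t; rewrite ger0_norm ?sqr_ge0 // mulrAC ler_pdivlMr ?exprn_gt0 //.
  by rewrite -exprMn [X t * e]mulrC; apply: sqr_le_exp; apply: mulr_ge0 => //; exact: ltW.
have iY : finite_mean P Y := finite_mean_of_exp mY Y0 ltr01 iYe.
have U2 t : U t ^+ 2 <= b ^+ 2 + X t ^+ 2.
  have hl : - X t <= U t by rewrite le_min; apply/andP; split; have := X0 t; have := Y0 t; lra.
  have hu : U t <= b by rewrite ge_min lexx orbT.
  have [u0|u0] := leP 0 (U t).
    have : U t ^+ 2 <= b ^+ 2 by apply: lerXn2r; rewrite ?nnegrE // ltW.
    by have := sqr_ge0 (X t); lra.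
  have : (- U t) ^+ 2 <= X t ^+ 2 by apply: lerXn2r; rewrite ?nnegrE //; lra.
  by rewrite sqrrN; have := sqr_ge0 b; lra.
have iU2 : finite_mean P (fun t => U t ^+ 2).
  apply: (finite_mean_dom (measurable_funX _ mU) (g := fun t => b ^+ 2 + X t ^+ 2)).
    by move=> t; rewrite ger0_norm ?sqr_ge0.
  by apply: finite_meanD => //; exact: finite_mean_cst.
have iU : finite_mean P U.
  apply: (finite_mean_dom mU (g := fun t => b + X t)); last by apply: finite_meanD => //; exact: finite_mean_cst.
  move=> t; rewrite ler_norml; apply/andP; split.
    by rewrite le_min; apply/andP; split; have := X0 t; have := Y0 t; lra.
  by apply: (@le_trans _ _ b); [rewrite ge_min lexx orbT|rewrite lerDl].
have m1 : E U < 0.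
  apply: (@le_lt_trans _ _ (E (fun t => Y t - X t))).
    by apply: mean_le => //; [exact: finite_meanB|move=> t; rewrite ge_min lexx].
  by rewrite meanB // subr_lt0.
set u1 := E U in m1; set u2 := E (fun t => U t ^+ 2).
have m2 : 0 <= u2 by apply: mean_ge0 => t; exact: sqr_ge0.
(* The first bound makes [s * U <= 1 / 2], the second makes the quadratic term
   at most half of the linear one. *)
pose s := Num.min (1 / (2 * b)) (- u1 / (4 * (u2 + 1))).
have s0 : 0 < s by rewrite lt_min; apply/andP; split; apply: divr_gt0 => //; lra.
have s1 : s * b <= 1 / 2.
  have : s <= 1 / (2 * b) by rewrite ge_min lexx.
  by rewrite ler_pdivlMr ?mulr_gt0 //; lra.
have s2 : s * (4 * (u2 + 1)) <= - u1.
  have : s <= - u1 / (4 * (u2 + 1)) by rewrite ge_min lexx orbT.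
  by rewrite ler_pdivlMr //; lra.
exists s, (1 + s * u1 + 2 * s ^+ 2 * u2); split => //.
  have : s * (s * (4 * (u2 + 1))) <= s * - u1 by apply: ler_wpM2l => //; exact: ltW.
  have : 0 < s * - u1 by apply: mulr_gt0 => //; lra.
  have : 0 < s ^+ 2 by apply: exprn_gt0.
  by move=> h1 h2 h3; nra.
have i3 : finite_mean P (fun t => s * U t) by exact: finite_meanZ.
have i4 : finite_mean P (fun t => (2 * s ^+ 2) * U t ^+ 2) by exact: finite_meanZ.
have -> : 1 + s * u1 + 2 * s ^+ 2 * u2 = E (fun t => 1 + s * U t + (2 * s ^+ 2) * U t ^+ 2).
  rewrite meanD //; last by apply: finite_meanD => //; exact: finite_mean_cst.
  by rewrite meanD //; [rewrite mean_cst !meanZ|exact: finite_mean_cst].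
have hsU t : s * U t <= 1 / 2.
  by apply: le_trans s1; apply: ler_wpM2l; [exact: ltW|rewrite ge_min lexx orbT].
apply: mean_le.
- apply: (@finite_mean_bnd _ _ _ _ _ (expR (1 / 2))).
    by apply: measurableT_comp; [exact: measurable_expR|exact: measurable_funM].
  by move=> t; rewrite ger0_norm ?expR_ge0 // ler_expR; exact: hsU.
- by apply: finite_meanD => //; apply: finite_meanD => //; exact: finite_mean_cst.
- move=> t; apply: (le_trans (exp_quadratic (hsU t))); rewrite exprMn.
  by rewrite mulrA.
Qed.

End Increment.

(** * The Wiener-Hopf pair of the queue *)

Section NullSets.
Context d (T : measurableType d) (R : realType) (P : probability T R).
Variable N : set T.
Hypothesis mN : measurable N.
Hypothesis N0 : P N = 0%E.

Lemma measure_eq_off_null (A B : set T) : measurable A -> measurable B ->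
  (forall t, ~ N t -> (A t <-> B t)) -> P A = P B.
Proof.
move=> mA mB AB.
have h (C D : set T) : measurable C -> measurable D ->
    (forall t, ~ N t -> C t -> D t) -> (P C <= P D)%E.
  move=> mC mD CD; apply: (@le_trans _ _ (P (D `|` N))).
    apply: le_measure; rewrite ?inE //; first exact: measurableU.
    by move=> t Ct; have [Nt|Nt] := pselect (N t); [right|left; exact: CD].
  apply: (le_trans (measureU2 P mD mN)).
  by rewrite [X in (_ + X)%E]N0 adde0.
apply/eqP; rewrite eq_le; apply/andP; split; apply: h => // t Nt; first by case: (AB t Nt).
by case: (AB t Nt).
Qed.

Lemma mean_eq_off_null (f g : T -> R) : measurable_fun setT f -> measurable_fun setT g ->
  (forall t, ~ N t -> f t = g t) -> mean P f = mean P g.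
Proof.
move=> mf mg fg; rewrite /mean /Rintegral; congr fine; apply: ae_eq_integral => //.
- exact/measurable_EFinP.
- exact/measurable_EFinP.
- exists N; split => // t /= h; apply: contrapT => Nt; apply: h => _.
  by rewrite fg.
Qed.

End NullSets.

(** [L] is the reciprocal of the transform [psi], and [H] the Wiener-Hopf
    factor of the left half-plane. *)
Record wiener_hopf_pair (R : realType) (F psi : R[i] -> R[i]) (b : R)
    (L H : R[i] -> R[i]) : Prop := WienerHopfPair {
  wh_entire : exists c, [/\ entire c, c 0%N = 1, Im (c 1%N) = 0 & forall u, L u = pser c u];
  wh_analytic : forall w, analytic_at L w;
  wh_growth : exists2 B : R, 1 <= B & forall u, cmod (L u) <= B * expR (b * cmod u);
  wh_right : forall w, 0 <= Re w -> psi w * L w = 1;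
  wh_left : forall w, Re w < 0 -> F w = L w * H w;
  wh_H : forall w, Re w < 0 -> {for w, continuous H} /\ H w != 0;
  wh_H_real : exists2 h : R, 0 < h & forall x : R, 1 <= x -> h <= cmod (H (- x)%:C) <= 1;
  wh_L_pos : exists C : R, forall x : R, 0 <= x -> cmod (L x%:C) <= C }.

Section Factorization.
Context d (T : measurableType d) (R : realType) (P : probability T R).
Variables (X Y V : T -> R) (b e : R).
Hypothesis mX : measurable_fun setT X.
Hypothesis mY : measurable_fun setT Y.
Hypothesis mV : measurable_fun setT V.
Hypothesis X0 : forall t, 0 <= X t.
Hypothesis Y0 : forall t, 0 <= Y t.
Hypothesis XY : independent_rv P X Y.
Hypothesis YX : mean P Y < mean P X.
Hypothesis e0 : 0 < e.
Hypothesis iX : finite_mean P (fun t => expR (e * X t)).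
Hypothesis iY : forall s, 0 <= s -> finite_mean P (fun t => expR (s * Y t)).
Hypothesis V0 : forall t, 0 <= V t.
Hypothesis VU : independent_rv P V (Y \- X).
Hypothesis stat : equal_in_law P V (fun t => Num.max (V t + (Y t - X t)) 0).
Hypothesis b0 : 0 < b.
Hypothesis bnull : P [set t | b < Y t - X t] = 0%E.
Hypothesis Fn0 : exists n : nat, queueF P X Y (- n.+1%:R)%:C != 0.

Let U t := Num.min (Y t - X t) b.

Let mYX : measurable_fun setT (fun t => Y t - X t).
Proof. exact: measurable_funB. Qed.

Let mU : measurable_fun setT U.
Proof. exact: measurable_minr. Qed.

Let mN : measurable [set t | b < Y t - X t].
Proof. by rewrite -[X in measurable X]setTI; exact: measurable_fun_ltr. Qed.

Let UE t : ~ [set t | b < Y t - X t] t -> U t = Y t - X t.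
Proof. by move=> /= /negP; rewrite -leNgt => h; rewrite /U min_l. Qed.

Let VU' : independent_rv P V U.
Proof.
move=> A B mA mB.
have h (f : T -> R) (C : set R) : measurable_fun setT f -> measurable C -> measurable (f @^-1` C).
  by move=> mf mC; rewrite -[X in measurable X]setTI; exact: mf.
have -> : P (U @^-1` B) = P ((Y \- X) @^-1` B).
  apply: (measure_eq_off_null mN bnull); [exact: h|exact: h|].
  by move=> t Nt /=; rewrite UE.
rewrite -VU //; apply: (measure_eq_off_null mN bnull).
- by apply: measurableI; exact: h.
- by apply: measurableI; exact: h.
- by move=> t Nt /=; rewrite UE.
Qed.

Let stat' : equal_in_law P V (fun t => Num.max (V t + U t) 0).
Proof.
move=> A mA; rewrite stat //.
have h (f : T -> R) : measurable_fun setT f -> measurable ((fun t => Num.max (V t + f t) 0) @^-1` A).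
  move=> mf; rewrite -[X in measurable X]setTI.
  have m : measurable_fun setT (fun t => Num.max (V t + f t) 0).
    by apply: measurable_maxr => //; exact: measurable_funD.
  exact: m.
apply: (measure_eq_off_null mN bnull); [exact: (h _ mYX)|exact: h|].
by move=> t Nt /=; rewrite UE.
Qed.

Let queueFE (th : R[i]) : Re th <= 0 ->
  queueF P X Y th = cmean P (fun t => cexp (- th * (U t)%:C)) - 1.
Proof.
move=> th0; rewrite (queueF_cmean mX mY X0 XY th0); last by apply: iY; rewrite oppr_ge0.
have [m1 m2] := measurable_cexp th mYX; have [m3 m4] := measurable_cexp th mU.
congr (_ - 1); rewrite /cmean; congr (_ +i* _); apply: (mean_eq_off_null mN bnull) => // t Nt.
  by rewrite UE.
by rewrite UE.
Qed.

(** [Y - X] is replaced by its truncation at [b], which changes it on a null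
    set only. The defect of the idle time is positive, for otherwise [F] would
    vanish at all negative integers. *)
Lemma wiener_hopf_exists : exists L H,
  wiener_hopf_pair (queueF P X Y) (laplace P V) b L H.
Proof.
have iY1 := iY ler01.
have [s [q [s0 q1 hq]]] := chernoff_bound mX mY X0 b0 e0 Y0 iX iY1 YX.
have Ub t : U t <= b by rewrite /U ge_min lexx orbT.
pose K := ladder_law P U.
have hq' : mean P (fun t => expR (s * U t)) <= q by exact: hq.
have Klin := ladder_law_lin P mU Ub.
have Kle := ladder_law_le P mU Ub.
have K1 : K (fun=> 1) < 1.
  exact: (le_lt_trans (ladder_law1 mU Ub b0 s0 q1 hq') q1).
have KV := wiener_hopf mU Ub b0 s0 q1 hq' mV V0 VU' stat'.
have KU := wiener_hopf_factor mU Ub b0 s0 q1 hq' mV V0 VU' stat'.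
pose W := idle U V.
have mW : measurable_fun setT W by exact: measurable_idle.
have W0 t : W t <= 0 by exact: idle_le0.
have left w : Re w < 0 -> queueF P X Y w = rfactor K b w * lfactor P W w.
  by move=> w0; rewrite queueFE ?ltW //; exact: (F_rfactor mU mV Ub b0 Klin Kle K1 KU).
have d1 : 0 < defect P W 1.
  have [n hn] := Fn0; rewrite lt_neqAle (defect_ge0 P mW W0 ler01) andbT eq_sym.
  apply: contraNneq hn => dW.
  have n0 : Re ((- n.+1%:R : R)%:C) < 0 by rewrite /= oppr_lt0 ltr0n.
  rewrite left // lfactor_real.
  have hd : defect P W n.+1%:R <= 0.
    by have := defect_mul P mW W0 n.+1 ler01; rewrite mulr1 dW mulr0.
  have -> : defect P W n.+1%:R = 0.
    by apply/eqP; rewrite eq_le hd /=; apply: defect_ge0 => //; exact: ler0n.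
  by rewrite oppr0 mulr0.
exists (rfactor K b), (lfactor P W); split.
- exists (rfactor_coef K b 0); split.
  + exact: (entire_rfactor_coef b0 Klin Kle K1).
  + exact: (coefL00 b Klin K1).
  + exact: (Im_coefL01 b Klin).
  + exact: (rfactor_pser0 b0 Klin Kle K1).
- exact: (analytic_rfactor b0 Klin Kle K1).
- exists ((1 + 2 * K (fun=> 1)) / escape K).
    exact: (growth_const_ge1 Klin Kle K1).
  exact: (rfactor_growth b0 Klin Kle K1).
- move=> w w0; rewrite /laplace cmeanE.
  exact: (laplace_rfactor mV V0 b0 Klin Kle K1 KV).
- exact: left.
- move=> w w0; split; [exact: lfactor_continuous|exact: lfactor_neq0].
- exists (defect P W 1) => // x x1; rewrite lfactor_real cmod_real normrN.
  have x0 : 0 <= x by apply: le_trans x1.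
  rewrite ger0_norm; last exact: defect_ge0.
  by rewrite defect_le1 andbT; exact: defect_mono.
- exists ((1 + 2 * K (fun=> 1)) / escape K).
  exact: (rfactor_pos_bound b0 Klin Kle K1).
Qed.

End Factorization.

(** [H] has neither zeros nor poles in the left half-plane. *)
Lemma order_at_quotient (R : realType) (F L H : R[i] -> R[i]) (w : R[i]) (m : nat) :
  Re w < 0 -> (forall t, Re t < 0 -> F t = L t * H t) ->
  {for w, continuous H} -> (forall t, Re t < 0 -> H t != 0) ->
  zero_of_order F w m -> order_at L w m.
Proof.
move=> w0 FLH cH H0 [g [ag gw hg]].
exists (fun t => g t * (H t)^-1); split.
- by apply: ccontM; [exact: analytic_continuous|apply: ccontV => //; exact: H0].
- by rewrite mulf_neq0 // invr_eq0 H0.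
- have [e e0 he] := (near_cmod w _).1 hg.
  apply/near_cmod; exists (Num.min e (- Re w)); first by rewrite lt_min e0 oppr_gt0.
  move=> t; rewrite lt_min => /andP[t1 t2].
  have t0 : Re t < 0.
    have -> : t = w + (t - w) by rewrite addrC subrK.
    by rewrite ReD; have := Re_le_cmod (t - w); rewrite ler_norml => /andP[_ h]; lra.
  have h1 := he t t1; rewrite FLH // in h1.
  by rewrite mulrA -h1 mulfK // H0.
Qed.

(** The cofactor would vanish at [w] by continuity. *)
Lemma order_at_not_locally0 (R : realType) (L : R[i] -> R[i]) (w : R[i]) (m : nat) :
  order_at L w m -> ~ (\forall t \near w, L t = 0).
Proof.
move=> [g [cg gw hg]] hL; have [e e0 he] := (near_cmod w _).1 hg.
have [e' e0' he'] := (near_cmod w _).1 hL.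
move/eqP: gw; apply; apply: (continuous_punctured_eq cg (g := fun=> 0)).
  exact: ccont_cst.
apply/near_punctured_cmod; exists (Num.min e e'); first by rewrite lt_min e0.
move=> t tw; rewrite lt_min => /andP[t1 t2].
have := he t t1; rewrite he' // => /esym/eqP.
by rewrite mulf_eq0 expf_eq0 subr_eq0 (negbTE tw) andbF => /eqP.
Qed.

(** * From the Wiener-Hopf pair to the product formula *)

Section ProductFormula.
Context (R : realType).
Variables (F psi0 L H : R[i] -> R[i]) (b alpha beta : R) (z : int -> R[i]).
Hypothesis WH : wiener_hopf_pair F psi0 b L H.
Hypothesis b0 : 0 <= b.
Hypothesis Freal : forall x : R, x < 0 -> Im (F x%:C) = 0.
Hypothesis psi0_le1 : forall x : R, 0 <= x -> cmod (psi0 x%:C) <= 1.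
Hypothesis alpha0 : alpha < 0.
Hypothesis Fexp : exponential_order (fun x : R => Re (F x%:C)) (- alpha) -oo_R.
Hypothesis zneg : forall n, Re (z n) < 0.
Hypothesis zord : forall w, Re w < 0 -> exists2 m, zero_of_order F w m &
  ([set n | z n = w] #= `I_m)%card.

Let L_order w : Re w < 0 -> exists2 m, order_at L w m & ([set n | z n = w] #= `I_m)%card.
Proof.
move=> w0; have [m hm hc] := zord w0; exists m => //.
apply: order_at_quotient hm => //; first exact: (wh_left WH).
  by have [] := wh_H WH w0.
by move=> t t0; have [] := wh_H WH t0.
Qed.

Let L_right w : 0 <= Re w -> L w != 0.
Proof.
move=> w0; apply/eqP => h; have := wh_right WH w0; rewrite h mulr0 => /eqP.
by rewrite eq_sym oner_eq0.
Qed.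

Let L_not_locally0 (w : R[i]) : ~ (\forall t \near w, L t = 0).
Proof.
have [w0|w0] := ltP (Re w) 0.
  by have [m hm _] := L_order w0; exact: order_at_not_locally0 hm.
by move=> /nbhs_singleton h; have := L_right w0; rewrite h eqxx.
Qed.

Let L_neq0 w : (forall n, w != z n) -> L w != 0.
Proof.
move=> wz; have [w0|w0] := ltP (Re w) 0; last exact: L_right.
(* No index is sent to [w], so the order is zero. *)
have [m hm hc] := L_order w0.
have e : [set n | z n = w] = set0.
  by apply/seteqP; split => // n /= h; have := wz n; rewrite h eqxx.
rewrite e in hc.
case: m hm hc => [|m] hm hc; first exact: order_at0 hm.
by move: hc; rewrite card_eq_sym card_eq0 => /eqP h; have : `I_m.+1 0%N by []; rewrite h.
Qed.

Let F_cmod (x : R) : x < 0 -> cmod (F x%:C) = `|Re (F x%:C)|.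
Proof.
move=> x0; have -> : F x%:C = (Re (F x%:C))%:C by apply: complexP => //=; exact: Freal.
by rewrite cmod_real.
Qed.

Let L_growth_left (e : R) : 0 < e -> exists x0 : R, forall x : R, x0 <= x ->
  expR ((- alpha - e) * x) <= cmod (L (- x)%:C) <= expR ((- alpha + e) * x).
Proof.
move=> e0; have [h h0 hH] := wh_H_real WH.
have [_ /(_ e e0) [/cvgr0Pnorm_lt hu /cvgr0Pnorm_lt hl]] := Fexp.
have [M1 [_ hM1]] := hu _ h0.
have [M2 [_ hM2]] := hl _ ltr01.
have [M3 [_ hM3]] := Fexp.1.
(* Far to the left, [|F|] is below [h * exp ((- alpha + e) x)] and above [exp
   ((- alpha - e) x)], and [h <= |H| <= 1]. *)
exists (Num.max 1 (Num.max (- M1 + 1) (Num.max (- M2 + 1) (- M3 + 1)))) => x.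
rewrite !ge_max => /and4P[x1 xM1 xM2 xM3].
have x0 : 0 < x := lt_le_trans ltr01 x1.
have nx0 : Re ((- x)%:C : R[i]) < 0 by rewrite /= oppr_lt0.
have {}hM1 := hM1 (- x); have {}hM2 := hM2 (- x); have {}hM3 := hM3 (- x).
have := hM1 ltac:(lra); have := hM2 ltac:(lra); have fn0 := hM3 ltac:(lra).
have nx : - x < 0 by rewrite oppr_lt0.
rewrite !normrM normrV ?unitfE // !(ger0_norm (expR_ge0 _)) normrN (gtr0_norm x0) -!F_cmod //.
have FE := wh_left WH nx0.
have /andP[H1 H2] := hH x x1.
have Hp : 0 < cmod (H (- x)%:C) := lt_le_trans h0 H1.
have cF : cmod (F (- x)%:C) = cmod (L (- x)%:C) * cmod (H (- x)%:C) by rewrite FE cmodM.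
have cF0 : 0 < cmod (F (- x)%:C).
  by rewrite F_cmod // normr_gt0.
rewrite ltr_pdivrMr // mul1r => lo up.
have L0 := cmod_ge0 (L (- x)%:C).
apply/andP; split.
  apply: (le_trans (ltW lo)); rewrite cF -[leRHS]mulr1; exact: ler_wpM2l.
have E0 := expR_gt0 (- (- alpha + e) * x).
have e1 : cmod (L (- x)%:C) * h <= cmod (F (- x)%:C) by rewrite cF; exact: ler_wpM2l.
have e2 : cmod (L (- x)%:C) * h * expR (- (- alpha + e) * x) < h.
  by apply: le_lt_trans up; apply: ler_wpM2r; [exact: ltW|].
have -> : expR ((- alpha + e) * x) = (expR (- (- alpha + e) * x))^-1.
  by rewrite -expRN mulNr opprK.
rewrite -[leRHS]mul1r ler_pdivlMr // ltW // -(ltr_pM2l h0) mulr1.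
by rewrite mulrA [h * _]mulrC.
Qed.

Hypothesis zconj : forall n, z (- n) = (z n)^*.
Hypothesis zRe : (fun n : nat => Re (z n%:Z)) =o_\oo
    (fun n : nat => Num.sqrt n%:R : R).
Hypothesis zIm : (fun n : nat => Im (z n%:Z)) =
    (fun n : nat => - 2 * pi * n%:R / alpha + beta) +o_\oo
    (fun _ : nat => 1 : R).

Let L_product (u : R[i]) :
  zero_prod z N u @[N --> \oo] --> L u * cexp (- alpha%:C * u / 2).
Proof.
have [c [ec c0 c1 Lc]] := wh_entire WH.
have [B B1 hB] := wh_growth WH.
have [C1 hC1] := wh_L_pos WH.
have Lf : L = pser c by apply/funext => t; exact: Lc.
have gr t : cmod (pser c t) <= B * expR (b * cmod t) by rewrite -Lf.
have nz w : 0 <= Re w -> pser c w != 0 by move=> h; rewrite -Lf; exact: L_right.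
have od w : Re w < 0 -> exists2 m, order_at (pser c) w m & ([set n | z n = w] #= `I_m)%card.
  by move=> h; rewrite -Lf; exact: L_order.
have pos (x : R) : 0 <= x -> 1 <= cmod (pser c x%:C) <= C1.
  move=> x0; rewrite -Lf hC1 // andbT.
  have h := wh_right WH (w := x%:C) x0.
  have : cmod (psi0 x%:C) * cmod (L x%:C) = 1 by rewrite -cmodM h cmod1.
  move=> <-; rewrite -[leRHS]mul1r; apply: ler_wpM2r; [exact: cmod_ge0|exact: psi0_le1].
have neg (e : R) : 0 < e -> exists x0 : R, forall x : R, x0 <= x ->
    expR ((- alpha - e) * x) <= cmod (pser c (- x)%:C) <= expR ((- alpha + e) * x).
  by move=> e0; rewrite -Lf; exact: L_growth_left.
rewrite Lf; exact: (canonical_product alpha0 zneg zconj zRe zIm ec c0 c1 B1 b0 gr nz od pos neg).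
Qed.

Lemma meromorphic_extension_exists :
  exists psi, meromorphic psi /\ forall w, 0 <= Re w -> psi w = psi0 w.
Proof.
exists (fun t => (L t)^-1); split.
  exact: (meromorphicV (wh_analytic WH) L_not_locally0).
move=> w w0; apply: (mulIf (L_right w0)).
by rewrite mulVf ?L_right // (wh_right WH).
Qed.

(** The pair factors multiply to the products of [canonical_product] divided
    by the factor of [z 0]; the limit is nonzero away from the [z n], so the
    inverses converge as well. *)
Lemma product_formula (psi : R[i] -> R[i]) (theta : R[i]) : meromorphic psi ->
  (forall w, 0 <= Re w -> psi w = psi0 w) -> (forall n, theta != z n) ->
  (fun n => \prod_(1 <= k < n.+1) (pair_factor z k theta)^-1) @ \oo -->
    ((1 - theta / z 0) / (L theta * cexp (- alpha%:C * theta / 2))) /\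
  psi theta = cexp (- alpha%:C * theta / 2) * (1 - theta / z 0)^-1 *
    ((1 - theta / z 0) / (L theta * cexp (- alpha%:C * theta / 2))).
Proof.
move=> mpsi hpsi thz.
have Lt := L_neq0 thz.
have ct := cexp_neq0 (- alpha%:C * theta / 2).
have z0 := zero_neq0 zneg 0.
have d0 : 1 - theta / z 0 != 0.
  rewrite subr_eq0 eq_sym; apply: contraNneq (thz 0) => h.
  by rewrite -[z 0]mul1r -h divfK.
have psiE : psi theta = (L theta)^-1.
  apply: (inverse_continuation mpsi (wh_analytic WH) L_not_locally0) => // w w0.
  by rewrite hpsi ?ltW // (wh_right WH) // ltW.
set cx := cexp _ in ct *; set D := 1 - _ in d0 *.
split; last first.
  rewrite psiE; have alg (K : fieldType) (l c d : K) : l != 0 -> c != 0 -> d != 0 ->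
    l^-1 = c * d^-1 * (d / (l * c)) by move=> ? ? ?; field; apply/and3P.
  exact: alg.
have hQ : (fun n => \prod_(1 <= k < n.+1) pair_factor z k theta) @ \oo --> D^-1 * (L theta * cx).
  have e : (fun n => \prod_(1 <= k < n.+1) pair_factor z k theta) =
      (fun n => D^-1 * zero_prod z n theta).
    by apply/funext => n; rewrite (zero_prodE zneg zconj) mulrA mulVf // mul1r.
  have hc : (fun _ : nat => D^-1) @ \oo --> D^-1 by exact: cvg_cst.
  by rewrite e; apply: (cvgnM hc); exact: L_product.
have q0 : D^-1 * (L theta * cx) != 0 by rewrite !mulf_neq0 // invr_eq0.
have hV := cvg_comp _ _ hQ (ccontV (@ccont_id _ _) q0).
have e : (fun n => \prod_(1 <= k < n.+1) (pair_factor z k theta)^-1) =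
   (fun t => t^-1) \o (fun n => \prod_(1 <= k < n.+1) pair_factor z k theta).
  by apply/funext => n; rewrite /= prodfV.
have -> : D / (L theta * cx) = (D^-1 * (L theta * cx))^-1 by rewrite [RHS]invfM invrK.
rewrite e; exact: hV.
Qed.

End ProductFormula.

(** * The theorem *)

Lemma expectation_mean d (T : measurableType d) (R : realType) (P : probability T R)
    (X : {RV P >-> R}) : finite_mean P X -> ('E_P[X] = (mean P X)%:E)%E.
Proof. by move=> iX; rewrite expectation_def EFin_mean. Qed.

Lemma cintegrable_exp d (T : measurableType d) (R : realType) (P : probability T R)
    (X : T -> R) (s : R) : cintegrable P (fun t => cexp (- (- s)%:C * (X t)%:C)) ->
  finite_mean P (fun t => expR (s * X t)).
Proof.
move=> [h _]; have e : (fun t => expR (s * X t)) = (fun t => Re (cexp (- (- s)%:C * (X t)%:C))).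
  by apply/funext => t; rewrite rmorphN opprK -rmorphM cexp_real.
by rewrite e; exact: h.
Qed.

Lemma laplace_real_le1 d (T : measurableType d) (R : realType) (P : probability T R)
    (V : T -> R) (x : R) : measurable_fun setT V -> (forall t, 0 <= V t) -> 0 <= x ->
  cmod (laplace P V x%:C) <= 1.
Proof.
move=> mV V0 x0; rewrite /laplace cmeanE cmean_W_real cmod_real; apply: mean_bnd.
  by apply: measurableT_comp; [exact: measurable_expR|exact: measurable_funM].
move=> t; rewrite ger0_norm ?expR_ge0 // -expR0 ler_expR mulNr oppr_le0.
exact: mulr_ge0.
Qed.

Section QueueF.
Context d (T : measurableType d) (R : realType) (P : probability T R).
Variables (X Y : T -> R) (alpha : R).
Hypothesis mX : measurable_fun setT X.
Hypothesis mY : measurable_fun setT Y.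
Hypothesis X0 : forall t, 0 <= X t.
Hypothesis XY : independent_rv P X Y.
Hypothesis iY : forall s, 0 <= s -> finite_mean P (fun t => expR (s * Y t)).
Hypothesis alpha0 : alpha < 0.
Hypothesis Fexp : exponential_order (fun x : R => Re (queueF P X Y x%:C)) (- alpha) -oo_R.

Lemma queueF_real (x : R) : x <= 0 ->
  queueF P X Y x%:C = (mean P (fun t => expR (- x * (Y t - X t))) - 1)%:C.
Proof.
move=> x0; rewrite (queueF_cmean mX mY X0 XY) //; last by apply: iY; rewrite oppr_ge0.
by rewrite cmean_W_real rmorphB.
Qed.

(** [F (- x) + 1] is the exponential moment [E exp (x (Y - X))]; its order of
    growth [- alpha] bounds the support of [Y - X]. *)
Lemma queue_tail_null : P [set t | 1 - alpha < Y t - X t] = 0%E.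
Proof.
have h12 : (0 : R) < 1 / 2 by lra.
have [_ /(_ _ h12) [/cvgr0Pnorm_lt /(_ _ ltr01) [M [_ hM]] _]] := Fexp.
have c0 : 0 <= - alpha + 1 / 2.
  by apply: addr_ge0; [rewrite oppr_ge0 ltW|exact: ltW].
have cb : - alpha + 1 / 2 < 1 - alpha by rewrite addrC ltrD2r; lra.
apply: (tail_null mX mY X0 c0 cb iY (x0 := Num.max 1 (- M + 1))).
move=> x; rewrite ge_max => /andP[x1 xM].
have x0 : 0 < x := lt_le_trans ltr01 x1.
have := hM (- x) ltac:(lra); rewrite normrN (gtr0_norm x0) queueF_real; last by rewrite oppr_le0 ltW.
rewrite opprK /= normrM (ger0_norm (expR_ge0 _)) mulNr expRN ltr_pdivrMr ?expR_gt0 // mul1r.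
set m := mean _ _; set k := expR _; move=> h; have := ler_norm (m - 1); lra.
Qed.

(** A function with an exponential order is eventually nonzero. *)
Lemma queueF_not_all0 : exists n : nat, queueF P X Y (- n.+1%:R)%:C != 0.
Proof.
have [M [_ hM]] := Fexp.1.
have [n hn] : exists n : nat, `|M| < n%:R by exists (Num.bound `|M|); exact: archi_boundP.
exists n; have h : - n.+1%:R < M.
  by have := ler_norm (- M); rewrite normrN -[n.+1]add1n natrD; lra.
by have := hM _ h; apply: contra => /eqP ->.
Qed.

End QueueF.

Theorem theorem2p3 (R : realType) (d : measure_display) (T : measurableType d)
    (P : probability T R) (X Y V : {RV P >-> R})
    (eps0 alpha beta eta eps : R) (z : int -> R[i]) (n1 : nat) (r : nat -> R) :
  (forall t, 0 <= X t) -> (forall t, 0 <= Y t) ->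
  independent_rv P X Y ->
  ('E_P[Y] < 'E_P[X])%E ->
  ~ lattice_rv P X \/ ~ lattice_rv P Y ->
  stationary_workload P X Y V ->
  0 < eps0 ->
  laplace_analytic P X [set w | - eps0 < complex.Re w < eps0] ->
  laplace_analytic P Y setT ->
  alpha < 0 ->
  exponential_order (fun x : R => complex.Re (queueF P X Y x%:C))
    (- alpha) -oo_R ->
  (forall n, complex.Re (z n) < 0) ->
  (forall w, complex.Re w < 0 ->
     exists2 m, zero_of_order (queueF P X Y) w m &
                ([set n | z n = w] #= `I_m)%card) ->
  (forall n, z (- n) = (z n)^*) ->
  (fun n : nat => complex.Re (z n%:Z)) =o_\oo
    (fun n : nat => Num.sqrt n%:R : R) ->
  (fun n : nat => complex.Im (z n%:Z)) =
    (fun n : nat => - 2 * pi * n%:R / alpha + beta) +o_\oo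
    (fun _ : nat => 1 : R) ->
  0 < eta -> 0 < eps ->
  (forall n, (n1 <= n)%N -> 0 < r n) ->
  sublinear_from n1 eta r ->
  (forall n w, (n1 <= n)%N -> complex.Re w < 0 -> `|w| = (r n)%:C ->
     eps%:C < `|queueF P X Y w|) ->
  (exists psi, laplace_continuation P V psi) /\
  forall psi, laplace_continuation P V psi ->
    forall theta, (forall n, theta != z n) ->
      let partial n := \prod_(1 <= k < n.+1)
        (1 - (2 * complex.Re (z k%:Z))%:C * theta / (z k%:Z * (z k%:Z)^*)
           + theta ^+ 2 / (z k%:Z * (z k%:Z)^*))^-1 in
      cvgn partial /\
      psi theta = cexp (- alpha%:C * theta / 2) * (1 - theta / z 0)^-1
                  * limn partial.
Proof.
move=> X0 Y0 XY EYX _ [V0 VU stat] eps00 [iX _] [iY _] alpha0 Fexp zneg zord zconj zRe zIm _ _ _ _ _.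
have mX : measurable_fun setT X by exact: measurable_funPT.
have mY : measurable_fun setT Y by exact: measurable_funPT.
have mV : measurable_fun setT V by exact: measurable_funPT.
have iYs s : 0 <= s -> finite_mean P (fun t => expR (s * Y t)).
  by move=> _; apply: cintegrable_exp; exact: iY.
have e0 : 0 < eps0 / 2 by apply: divr_gt0.
have iXe : finite_mean P (fun t => expR (eps0 / 2 * X t)).
  by apply: cintegrable_exp; apply: iX => /=; apply/andP; split; lra.
have iX1 := finite_mean_of_exp mX X0 e0 iXe.
have iY1 := finite_mean_of_exp mY Y0 ltr01 (iYs _ ler01).
have YX : mean P Y < mean P X.
  by move: EYX; rewrite !expectation_mean // lte_fin.
have b0 : 0 < 1 - alpha by lra.
have bnull := queue_tail_null mX mY X0 XY iYs alpha0 Fexp.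
have Fn0 := queueF_not_all0 Fexp.
have [L [H WH]] := wiener_hopf_exists mX mY mV X0 Y0 XY YX e0 iXe iYs V0 VU stat b0 bnull Fn0.
have Freal (x : R) : x < 0 -> Im (queueF P X Y x%:C) = 0.
  by move=> x0; rewrite (queueF_real mX mY X0 XY iYs) // ltW.
have psi1 (x : R) : 0 <= x -> cmod (laplace P V x%:C) <= 1.
  by move=> x0; exact: laplace_real_le1.
have b0' := ltW b0.
split.
  have [psi [h1 h2]] := meromorphic_extension_exists WH zord.
  by exists psi.
move=> psi [mpsi hpsi] theta thz partial.
have [hc hv] := product_formula WH b0' Freal psi1 alpha0 Fexp zneg zord zconj zRe zIm mpsi hpsi thz.
have hp : partial @ \oo --> (1 - theta / z 0) / (L theta * cexp (- alpha%:C * theta / 2)) by exact: hc.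
split; first by apply/cvg_ex; eexists; exact: hp.
by rewrite hv; congr (_ * _); apply/esym; apply: cvg_lim => //; exact: norm_hausdorff.
Qed.
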